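(* Let $X$ be a real-valued Gaussian zero-mean isotropic square integrable random field on $\mathbb S$ with power spectrum $(C_\ell)_{\ell\in\mathbb N}$, and let $W$ and $D$ be deterministic elements of $\mathbb H$. Let $\bar W=1-W$ and let $\bar w_{\ell m}=\langle\bar W,Y_{\ell m}\rangle$, $d_{\ell m}=\langle D,Y_{\ell m}\rangle$ be the multipole coefficients of $\bar W$ and $D$. Let $L=\{\ell_{\min},\dots,\ell_{\max}\}\subset\mathbb N$, and for a real vector $\mathbf b=(b_\ell)_{\ell\in L}$ with $\sum_{\ell\in L}\sigma_\ell^2b_\ell^2>0$, where $\sigma_\ell^2=(2\ell+1)C_\ell$, let $R(\mathbf b)$ be the mean integrated square error defined in the context. Then $$R(\mathbf b)=\frac{\mathbf b'\mathbf Q\,\mathbf b}{\mathbf b'\boldsymbol\sigma\,\mathbf b},$$ where $'$ denotes transposition, $\boldsymbol\sigma=\mathrm{diag}\bigl((\sigma_\ell^2)_{\ell\in L}\bigr)$ and $\mathbf Q=(Q_{\ell\ell'})_{\ell,\ell'\in L}$ is the matrix with entries $$Q_{\ell\ell'}=\sum_{m=-\ell}^{\ell}\ \sum_{m'=-\ell'}^{\ell'}\ \sum_{(\ell_1,m_1)}C_{\ell_1}\sum_{(\ell_2,m_2),(\ell_3,m_3),(\ell_4,m_4)}\bar w_{\ell_2m_2}\,\bar w_{\ell_3m_3}^{*}\,d_{\ell_4m_4}\begin{bmatrix}\ell_1&\ell_2&\ell\\ m_1&m_2&m\end{bmatrix}\begin{bmatrix}\ell_1&\ell_3&\ell'\\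 m_1&m_3&m'\end{bmatrix}^{*}\begin{bmatrix}\ell&\ell_4&\ell'\\ m&m_4&m'\end{bmatrix}.$$ If both $W$ and $D$ are axisymmetric, the ten-tuple summation above reduces to a five-tuple one: $$Q_{\ell\ell'}=\sum_m\ \sum_{\ell_1,\ell_2,\ell_3,\ell_4}C_{\ell_1}\bar w_{\ell_20}\,\bar w_{\ell_30}\,d_{\ell_40}\begin{bmatrix}\ell_1&\ell_2&\ell\\ m&0&m\end{bmatrix}\begin{bmatrix}\ell_1&\ell_3&\ell'\\ m&0&m\end{bmatrix}\begin{bmatrix}\ell&\ell_4&\ell'\\ m&0&m\end{bmatrix}=\sum_mA_{\ell\ell'm}D_{\ell\ell'm},$$ where $$A_{\ell\ell'm}=\sum_{\ell_1,\ell_2,\ell_3}C_{\ell_1}\bar w_{\ell_20}\bar w_{\ell_30}\begin{bmatrix}\ell_1&\ell_2&\ell\\ m&0&m\end{bmatrix}\begin{bmatrix}\ell_1&\ell_3&\ell'\\ m&0&m\end{bmatrix},\qquad D_{\ell\ell'm}=\sum_{\ell_4}d_{\ell_40}\begin{bmatrix}\ell&\ell_4&\ell'\\ m&0&m\end{bmatrix}.$$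
   Context: $\mathbb S$ is the unit sphere in $\mathbb R^3$ with its surface measure $d\xi$ and polar coordinates $\xi=(\theta,\varphi)$; a function on $\mathbb S$ is axisymmetric if it depends only on the colatitude $\theta$. $\mathbb N=\{0,1,2,\dots\}$; $z^*$ denotes complex conjugation (whereas the bar in $\bar W$, $\bar w_{\ell m}$, $\bar a_{\ell m}$ is not conjugation but refers to $1-W$). $\mathbb H=L^2(\mathbb S)$ is the space of complex-valued square integrable functions with $\langle f,g\rangle=\int_{\mathbb S}f(\xi)g^*(\xi)\,d\xi$. $(Y_{\ell m})_{\ell\ge0,-\ell\le m\le\ell}$ are the usual orthonormal complex spherical harmonics. Power spectrum: the multipole moments $a_{\ell m}=\langle X,Y_{\ell m}\rangle$ are centered complex Gaussian variables with $a_{\ell m}=(-1)^m a_{\ell,-m}^*$ (real-valuedness of $X$), and $\mathbb E[a_{\ell m}a_{\ell'm'}^*]=C_\ell\,\delta_{\ell\ell'}\delta_{mm'}$; square integrability means $\sum_\ell(2\ell+1)C_\ell<\infty$. Brackets: $\begin{bmatrix}\ell&\ell'&\ell''\\ m&m'&m''\end{bmatrix}:=\int_{\mathbb S}Y_{\ell m}(\xi)Y_{\ell'm'}(\xi)Y^*_{\ell''m''}(\xi)\,d\xi$, taken to be $0$ if $|m|>\ell$, $|m'|>\ell'$ or $|m''|>\ell''$. Sums over pairs $(\ell_i,m_i)$ run over $\ell_i\in\mathbb N$, $m_i\in\{-\ell_i,\dots,\ell_i\}$; sums over $\ell_i$ alone run over $\mathbb N$. In multiple sums the sum over index $1$ is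 outermost; for fixed index $1$ the remaining sums have finitely many non-zero terms. In the axisymmetric formulas, $m$ runs over the integers with $|m|\le\min(\ell,\ell')$. Error criterion: let $\Phi=\sum_{\ell\in L}b_\ell\Pi_\ell$, where $\Pi_\ell$ is the orthogonal projection of $\mathbb H$ onto the span of $Y_{\ell m}$, $-\ell\le m\le\ell$. The normalized difference field between the analysis of $X$ and of the weighted field $XW$ is $$\epsilon(\xi)=\Bigl(\sum_{\ell\in L}\sigma_\ell^2b_\ell^2\Bigr)^{-1/2}\bigl(\Phi X(\xi)-\Phi(XW)(\xi)\bigr)=\Bigl(\sum_{\ell\in L}\sigma_\ell^2b_\ell^2\Bigr)^{-1/2}\sum_{\ell\in L}\sum_{m=-\ell}^{\ell}b_\ell\,\bar a_{\ell m}Y_{\ell m}(\xi),\qquad \bar a_{\ell m}=\langle X\bar W,Y_{\ell m}\rangle,$$ and the mean integrated square error is $R(\mathbf b)=\mathbb E\int_{\mathbb S}D(\xi)\,|\epsilon(\xi)|^2\,d\xi$.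
   Formalization: In the axisymmetric formulas for Q and A, the second coefficient of 1-W (index l3) is conjugated for general complex W, since the printed formula fails e.g. for W=1-i, D=1; the formula exactly as printed is proved when W is real-valued. *)

(* Defs.v *)
From HB Require Import structures.
From mathcomp Require Import all_boot all_order all_algebra.
From mathcomp Require Import complex.
From mathcomp Require Import all_classical all_reals all_analysis.
From mathcomp Require Import measurable_realfun.

Set Implicit Arguments.
Unset Strict Implicit.
Unset Printing Implicit Defensive.

Import Order.TTheory GRing.Theory Num.Theory.
Import numFieldNormedType.Exports.

Local Open Scope classical_set_scope.
Local Open Scope ring_scope.

Section sphere.
Variable R : realType.

Definition sphere : set (R * R * R) :=
  [set x | x.1.1 ^+ 2 + x.1.2 ^+ 2 + x.2 ^+ 2 = 1].

Definition polar (p : R * R) : R * R * R :=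
  (sin p.1 * cos p.2, sin p.1 * sin p.2, cos p.1).

Definition polar_domain : set (R * R) := `[0, pi] `*` `[0, pi *+ 2[.

Definition colatitude (x : R * R * R) : R := acos x.2.

(* The value at the two poles, acos 0, is irrelevant. *)
Definition longitude (x : R * R * R) : R :=
  let c := acos (x.1.1 / Num.sqrt (x.1.1 ^+ 2 + x.1.2 ^+ 2)) in
  if 0 <= x.1.2 then c else pi *+ 2 - c.

Lemma measurable_polar : measurable_fun [set: R * R] polar.
Proof.
have m1 : measurable_fun [set: R * R] (fun p : R * R => sin p.1).
  by apply: measurableT_comp => //; apply: continuous_measurable_fun;
    exact: continuous_sin.
have m2 : measurable_fun [set: R * R] (fun p : R * R => cos p.1).
  by apply: measurableT_comp => //; apply: continuous_measurable_fun;
    exact: continuous_cos.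
have m3 : measurable_fun [set: R * R] (fun p : R * R => sin p.2).
  by apply: measurableT_comp => //; apply: continuous_measurable_fun;
    exact: continuous_sin.
have m4 : measurable_fun [set: R * R] (fun p : R * R => cos p.2).
  by apply: measurableT_comp => //; apply: continuous_measurable_fun;
    exact: continuous_cos.
by apply: measurable_fun_pair => //; apply: measurable_fun_pair;
  exact: measurable_funM.
Qed.

(* sin theta dtheta dphi, carried to the sphere by the polar map *)
Definition surface_measure (A : set (R * R * R)) : \bar R :=
  (\int[lebesgue_measure \x lebesgue_measure]_(p in
     polar_domain `&` polar @^-1` A) (sin p.1)%:E)%E.

Let measurable_polar_preimage (A : set (R * R * R)) :
  measurable A -> measurable (polar_domain `&` polar @^-1` A).
Proof.
move=> mA; apply: measurableI; first exact: measurableX.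
by rewrite -[X in measurable X]setTI; exact: measurable_polar.
Qed.

Let measurable_sin1 (A : set (R * R)) :
  measurable_fun A (fun p : R * R => (sin p.1)%:E).
Proof.
apply: measurable_funTS; apply/measurable_EFinP.
by apply: measurableT_comp => //; apply: continuous_measurable_fun;
  exact: continuous_sin.
Qed.

Let sin1_ge0 (p : R * R) : polar_domain p -> (0 <= (sin p.1)%:E)%E.
Proof.
by case=> /=; rewrite in_itv/= => h _; rewrite lee_fin sin_ge0_pi// in_itv.
Qed.

Let surface_measure0 : surface_measure set0 = 0%E.
Proof. by rewrite /surface_measure preimage_set0 setI0 integral_set0. Qed.

Let surface_measure_ge0 A : (0 <= surface_measure A)%E.
Proof. by apply: integral_ge0 => p [+ _]; exact: sin1_ge0. Qed.

Let surface_measure_sigma_additive : semi_sigma_additive surface_measure.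
Proof.
move=> F mF tF mUF; rewrite /surface_measure preimage_bigcup setI_bigcupr.
rewrite ge0_integral_bigcup//=.
- by apply: is_cvg_ereal_nneg_natsum => n _; exact: surface_measure_ge0.
- by move=> n; exact: measurable_polar_preimage.
- exact: measurable_sin1.
- by move=> p [n _ [+ _]]; exact: sin1_ge0.
- apply/trivIsetP => i j _ _ ij; rewrite setIACA -preimage_setI.
  by move/trivIsetP : tF => -> //; rewrite preimage_set0 setI0.
Qed.

HB.instance Definition _ := isMeasure.Build _ _ _ surface_measure
  surface_measure0 surface_measure_ge0 surface_measure_sigma_additive.

End sphere.
Arguments sphere {R}.
Arguments surface_measure {R}.

Section complex_analysis.
Variable R : realType.

(* componentwise integral of a complex-valued function *)
Definition cintegral d (T : measurableType d) (mu : {measure set T -> \bar R})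
    (D : set T) (f : T -> R[i]) : R[i] :=
  ((\int[mu]_(x in D) complex.Re (f x)) +i*
   (\int[mu]_(x in D) complex.Im (f x)))%C.

(* R[i]^o carries the topology of the complex modulus. *)
Definition is_csummable (u : nat -> R[i]) : Prop :=
  cvgn (series (u : nat -> R[i]^o)).

Definition csum (u : nat -> R[i]) : R[i] :=
  limn (series (u : nat -> R[i]^o)).

Definition expi (t : R) : R[i] := (cos t +i* sin t)%C.

End complex_analysis.

Section harmonics.
Variable R : realType.
Local Notation S2 := (R * R * R)%type.

Definition square_integrable (f : S2 -> R[i]) : Prop :=
  [/\ measurable_fun sphere (fun x => complex.Re (f x)),
      measurable_fun sphere (fun x => complex.Im (f x)) &
      (\int[surface_measure]_(x in sphere)
         ((complex.Re (f x)) ^+ 2 + (complex.Im (f x)) ^+ 2)%:E < +oo)%E].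

Definition inner (f g : S2 -> R[i]) : R[i] :=
  cintegral surface_measure sphere (fun x => f x * (g x)^*).

(* Functions on the sphere are identified up to null sets. *)
Definition axisymmetric (f : S2 -> R[i]) : Prop :=
  exists g : R -> R[i],
    {ae surface_measure, forall x, sphere x -> f x = g (colatitude x)}.

Definition real_valued (f : S2 -> R[i]) : Prop :=
  {ae surface_measure, forall x, sphere x -> complex.Im (f x) = 0}.

(* Rodrigues' formula *)
Definition legendre (l : nat) : {poly R} :=
  ((2 ^ l * l`!)%N%:R)^-1 *: (('X ^+ 2 - 1) ^+ l)^`(l).

(* with the Condon-Shortley phase *)
Definition assoc_legendre (l m : nat) (t : R) : R :=
  (-1) ^+ m * Num.sqrt (1 - t ^+ 2) ^+ m * ((legendre l)^`(m)).[t].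

Definition Ylm_nat (l m : nat) (x : S2) : R[i] :=
  (Num.sqrt ((2 * l + 1)%N%:R / (4 * pi) * ((l - m)`!%:R / (l + m)`!%:R))
     * assoc_legendre l m (cos (colatitude x)))%:C%C
  * expi (m%:R * longitude x).

Definition Ylm (l : nat) (m : int) (x : S2) : R[i] :=
  if 0 <= m then Ylm_nat l `|m|%N x
  else (-1) ^+ `|m|%N * (Ylm_nat l `|m|%N x)^*.

Definition coef (f : S2 -> R[i]) (l : nat) (m : int) : R[i] :=
  inner f (Ylm l m).

Definition bracket (l1 : nat) (m1 : int) (l2 : nat) (m2 : int)
    (l3 : nat) (m3 : int) : R[i] :=
  if [&& (`|m1| <= l1)%N, (`|m2| <= l2)%N & (`|m3| <= l3)%N] then
    cintegral surface_measure sphere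
      (fun x => Ylm l1 m1 x * Ylm l2 m2 x * (Ylm l3 m3 x)^*)
  else 0.

(* the integers -l, ..., l *)
Definition mrange (l : nat) : seq int :=
  [seq j%:Z - l%:Z | j <- iota 0 (l.*2).+1].

End harmonics.

Section random_field.
Variable R : realType.
Local Notation S2 := (R * R * R)%type.
Context d (T : measurableType d) (P : probability T R).

Definition col3 (x : S2) : 'cV[R]_3 :=
  \col_i tnth [tuple x.1.1; x.1.2; x.2] i.

Definition rotation (g : 'M[R]_3) : Prop := g^T *m g = 1%:M /\ \det g = 1.

Definition measurable_field (X : T -> S2 -> R) : Prop :=
  measurable_fun ([set: T] `*` sphere) (fun p : T * S2 => X p.1 p.2).

(* normal_prob 0 0 is not the degenerate law, which is treated apart. *)
Definition centered_normal (s : R) (A : set R) : \bar R :=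
  if s == 0 then \d_(0 : R) A else normal_prob 0 s A.

Definition gaussian_zero_mean (X : T -> S2 -> R) : Prop :=
  forall (n : nat) (xi : 'I_n -> S2) (c : 'I_n -> R),
    (forall i, sphere (xi i)) ->
    exists s : R, forall A : set R, measurable A ->
      P [set w | A (\sum_(i < n) c i * X w (xi i))] = centered_normal s A.

(* The finite-dimensional laws are invariant under rotations. *)
Definition isotropic (X : T -> S2 -> R) : Prop :=
  forall (g : 'M[R]_3) (n : nat) (xi eta : 'I_n -> S2),
    rotation g -> (forall i, sphere (xi i)) ->
    (forall i, col3 (eta i) = g *m col3 (xi i)) ->
    forall A : set (n.-tuple R), measurable A ->
      P [set w | A [tuple X w (eta i) | i < n]] =
      P [set w | A [tuple X w (xi i) | i < n]].

Definition cfield (X : T -> S2 -> R) (w : T) (x : S2) : R[i] := (X w x)%:C%C.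

Definition power_spectrum (X : T -> S2 -> R) (C : nat -> R) : Prop :=
  forall (l l' : nat) (m m' : int), (`|m| <= l)%N -> (`|m'| <= l')%N ->
    cintegral P [set: T]
      (fun w => coef (cfield X w) l m * (coef (cfield X w) l' m')^*) =
    if (l == l') && (m == m') then (C l)%:C%C else 0.

Definition square_summable_spectrum (C : nat -> R) : Prop :=
  (\sum_(0 <= l <oo) ((2 * l + 1)%N%:R * C l)%:E < +oo)%E.

End random_field.

Section risk.
Variable R : realType.
Local Notation S2 := (R * R * R)%type.
Variables lmin lmax : nat.

(* L = {lmin, ..., lmax} is indexed by 'I_(lmax - lmin).+1, with i standing
   for the multipole lmin + i. *)
Local Notation card_L := (lmax - lmin).+1.

Definition mult (i : 'I_card_L) : nat := (lmin + i)%N.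

Definition sigma2 (C : nat -> R) (l : nat) : R := (2 * l + 1)%N%:R * C l.

(* The defining formula of Pi_l makes sense for integrable f, such as the
   paths of X W, which need not be square integrable. *)
Definition Pi_ (l : nat) (f : S2 -> R[i]) (x : S2) : R[i] :=
  \sum_(m <- mrange l) coef f l m * Ylm l m x.

Definition Phi (b : 'cV[R]_(card_L)) (f : S2 -> R[i]) (x : S2) : R[i] :=
  \sum_i (b i 0)%:C%C * Pi_ (mult i) f x.

Definition energy (C : nat -> R) (b : 'cV[R]_(card_L)) : R :=
  \sum_i sigma2 C (mult i) * b i 0 ^+ 2.

Context d (T : measurableType d) (P : probability T R).

Definition eps (X : T -> S2 -> R) (C : nat -> R) (W : S2 -> R[i])
    (b : 'cV[R]_(card_L)) (w : T) (x : S2) : R[i] :=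
  ((Num.sqrt (energy C b))^-1)%:C%C *
  (Phi b (cfield X w) x - Phi b (fun y => cfield X w y * W y) x).

Definition mise (X : T -> S2 -> R) (C : nat -> R) (W D : S2 -> R[i])
    (b : 'cV[R]_(card_L)) : R[i] :=
  cintegral P [set: T] (fun w => cintegral surface_measure sphere
    (fun x => D x * `|eps X C W b w x| ^+ 2)).

End risk.

Section Q.
Variable R : realType.
Local Notation S2 := (R * R * R)%type.
Variables (C : nat -> R).

(* pairs (l, m) with -l <= m <= l *)
Definition lm_pairs : set (nat * int) := [set p | (`|p.2| <= p.1)%N].

(* Sums over index 1 are series in l1; for fixed index 1 the other sums have
   finite support and are written \sum_(_ \in _). *)
Section general.
Variables (w dd : nat -> int -> R[i]).
Variables (l l' : nat) (m m' : int).

Definition Q_inner_term (l1 : nat) (m1 : int)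
    (p : (nat * int) * (nat * int) * (nat * int)) : R[i] :=
  let: ((l2, m2), (l3, m3), (l4, m4)) := p in
  w l2 m2 * (w l3 m3)^* * dd l4 m4
  * bracket R l1 m1 l2 m2 l m * (bracket R l1 m1 l3 m3 l' m')^*
  * bracket R l m l4 m4 l' m'.

Definition Q_series (l1 : nat) : R[i] :=
  \sum_(m1 <- mrange l1) (C l1)%:C%C *
    \sum_(p \in lm_pairs `*` lm_pairs `*` lm_pairs) Q_inner_term l1 m1 p.

Definition Q_summable : Prop :=
  (forall l1 m1, finite_set
     ((lm_pairs `*` lm_pairs `*` lm_pairs) `&`
      [set p | Q_inner_term l1 m1 p != 0])) /\
  is_csummable Q_series.

End general.

Definition Q_entry (w dd : nat -> int -> R[i]) (l l' : nat) : R[i] :=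
  \sum_(m <- mrange l) \sum_(m' <- mrange l') csum (Q_series w dd l l' m m').

(* Axisymmetric case: w2, w3 and dd stand for the coefficients of order 0. *)
Section axisymmetric.
Variables (w2 w3 dd : nat -> R[i]).
Variables (l l' : nat) (m : int).

Definition Qaxi_term (l1 : nat) (p : nat * nat * nat) : R[i] :=
  let: (l2, l3, l4) := p in
  (C l1)%:C%C * w2 l2 * w3 l3 * dd l4
  * bracket R l1 m l2 0 l m * bracket R l1 m l3 0 l' m
  * bracket R l m l4 0 l' m.

Definition Qaxi_series (l1 : nat) : R[i] :=
  \sum_(p \in [set: nat * nat * nat]) Qaxi_term l1 p.

Definition A_term (l1 : nat) (p : nat * nat) : R[i] :=
  let: (l2, l3) := p in
  (C l1)%:C%C * w2 l2 * w3 l3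
  * bracket R l1 m l2 0 l m * bracket R l1 m l3 0 l' m.

Definition A_series (l1 : nat) : R[i] :=
  \sum_(p \in [set: nat * nat]) A_term l1 p.

Definition A_coef : R[i] := csum A_series.

Definition D_term (l4 : nat) : R[i] := dd l4 * bracket R l m l4 0 l' m.

Definition D_coef : R[i] := \sum_(l4 \in [set: nat]) D_term l4.

Definition Qaxi_summable : Prop :=
  [/\ forall l1, finite_set [set p | Qaxi_term l1 p != 0],
      is_csummable Qaxi_series,
      forall l1, finite_set [set p | A_term l1 p != 0],
      is_csummable A_series &
      finite_set [set l4 | D_term l4 != 0]].
End axisymmetric.

Definition Qaxi_entry (w2 w3 dd : nat -> R[i]) (l l' : nat) : R[i] :=
  \sum_(m <- mrange (minn l l')) csum (Qaxi_series w2 w3 dd l l' m).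

Definition AD_entry (w2 w3 dd : nat -> R[i]) (l l' : nat) : R[i] :=
  \sum_(m <- mrange (minn l l')) A_coef w2 w3 l l' m * D_coef dd l l' m.

End Q.

(* Main.v *)
From HB Require Import structures.
Require Import Defs.
From mathcomp Require Import all_boot all_order all_algebra.
From mathcomp Require Import complex.
From mathcomp Require Import all_classical all_reals all_analysis.
From mathcomp Require Import measurable_realfun ring lra zify.

(** Write V = 1 - W. The error between the two analyses only involves the
    coefficients a_lm = <X V, Y_lm>. Expanding |eps|^2 and integrating against
    D turns the mean integrated square error into
      sum b_l b_l' E(a_lm conj a_l'm') int D Y_lm conj Y_l'm' / energy,
    a quadratic form in b ([miseE], [mise_quadratic]). Two facts identify its
    matrix with Q: a formula for the covariance of the a_lm, and the expansion
    of an integral int F Y_lm conj Y_l'm' in brackets.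

    For the covariance, a_lm = <X, f> with f = conj V Y_lm. By isotropy the
    one-point law of X is the same normal law everywhere, since a rotation
    carries the north pole to any point; so E X(x)^2 is a finite constant and,
    by Tonelli's theorem, E int X^2 is finite ([field_square_integrable]).
    Then f |-> <X, f> is a continuous map from L^2 of the sphere to L^2 of the
    probability space. By completeness of the spherical harmonics f is the
    limit of its Fourier sums, on which the covariance is read off the power
    spectrum; passing to the limit,
      E(<X, f> conj <X, g>) = sum_l1 C_l1 sum_m1 conj <f, Y_l1m1> <g, Y_l1m1>
    ([field_covariance]). For f = conj V Y_lm the number conj <f, Y_l1m1> is
    int V Y_l1m1 conj Y_lm, an integral of the kind above.

    For the expansion, the product of two harmonics of degrees l and l' is, on
    the sphere, a combination of harmonics of degree at most l + l'
    ([zharmM_in_span]). Pairing F with it gives a finite sum of coefficients of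
    F times brackets ([triple_integral_sum]), and no limit has to be exchanged
    with a sum: for fixed l1 the inner sums of Q are products of three such
    finite sums ([Q_inner_sum]).

    Completeness ([harmonics_complete]) rests on the fact that the span of the
    harmonics is an algebra of bounded functions containing the coordinates of
    the space. The sets whose indicator is an L^2 limit of the span form a
    sigma-algebra, which contains the superlevel sets of the coordinates, hence
    all Borel sets; simple functions follow, and then all of L^2.

    If F is axisymmetric, it is constant on almost every parallel, and the
    harmonics of nonzero order have mean zero on parallels; so only the
    coefficients of order 0 survive ([axisymmetric_coef]). As brackets with
    middle order 0 vanish unless the two other orders agree ([bracket_order]),
    the factor with D forces m = m' and those with V force m1 = m: the sums over
    m1 and m' collapse. These brackets are real ([bracket_conj]), so that only
    the coefficients remain conjugated, and the factor with D, which does not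
    depend on l1, comes out of the series. *)

Set Implicit Arguments.
Unset Strict Implicit.
Unset Printing Implicit Defensive.

Import Order.TTheory GRing.Theory Num.Theory.
Import numFieldNormedType.Exports.

Local Open Scope classical_set_scope.
Local Open Scope ring_scope.

(** * Complex numbers by components *)

Section complex_scalars.
Variable R : realType.
Implicit Types z w : R[i].

Definition sqmod z : R := complex.Re z ^+ 2 + complex.Im z ^+ 2.

Lemma complex_eqP z w :
  complex.Re z = complex.Re w -> complex.Im z = complex.Im w -> z = w.
Proof. by case: z w => a b [c e] /= -> ->. Qed.

Lemma complex_ReD z w : complex.Re (z + w) = complex.Re z + complex.Re w.
Proof. by case: z w => a b []. Qed.
Lemma complex_ImD z w : complex.Im (z + w) = complex.Im z + complex.Im w.
Proof. by case: z w => a b []. Qed.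
Lemma complex_ReN z : complex.Re (- z) = - complex.Re z.
Proof. by case: z. Qed.
Lemma complex_ImN z : complex.Im (- z) = - complex.Im z.
Proof. by case: z. Qed.
Lemma complex_ReM z w : complex.Re (z * w) =
  complex.Re z * complex.Re w - complex.Im z * complex.Im w.
Proof. by case: z w => a b []. Qed.
Lemma complex_ImM z w : complex.Im (z * w) =
  complex.Re z * complex.Im w + complex.Im z * complex.Re w.
Proof. by case: z w => a b []. Qed.
Lemma complex_Re_conj z : complex.Re z^* = complex.Re z.
Proof. by case: z. Qed.
Lemma complex_Im_conj z : complex.Im z^* = - complex.Im z.
Proof. by case: z. Qed.
Lemma conj_real (a : R) : (a%:C%C)^* = a%:C%C.
Proof. by apply: complex_eqP; rewrite !(complex_Re_conj, complex_Im_conj)//= oppr0. Qed.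

Lemma conjM z w : (z * w)^* = z^* * w^*.
Proof. exact: rmorphM. Qed.

Lemma mul_conj_sqmod z : z * z^* = (sqmod z)%:C%C.
Proof.
by apply: complex_eqP; rewrite !(complex_ReM, complex_ImM, complex_Re_conj, complex_Im_conj)/= /sqmod; ring.
Qed.

Lemma normr2_sqmod z : `|z| ^+ 2 = (sqmod z)%:C%C.
Proof. by rewrite -add_Re2_Im2. Qed.

Lemma sqmod_ge0 z : 0 <= sqmod z.
Proof. by rewrite addr_ge0 ?sqr_ge0. Qed.
Lemma sqmodM z w : sqmod (z * w) = sqmod z * sqmod w.
Proof. by rewrite /sqmod complex_ReM complex_ImM; ring. Qed.

Lemma sqmodN z : sqmod (- z) = sqmod z.
Proof. by rewrite /sqmod complex_ReN complex_ImN; ring. Qed.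

Lemma sqmod_conj z : sqmod z^* = sqmod z.
Proof. by rewrite /sqmod complex_Re_conj complex_Im_conj; ring. Qed.

Lemma sqmod_real (a : R) : sqmod a%:C%C = a ^+ 2.
Proof. by rewrite /sqmod /= expr0n /= addr0. Qed.

Lemma sqmod0 : sqmod (0 : R[i]) = 0.
Proof. by rewrite (sqmod_real 0) expr0n. Qed.

(** The crude factor 2 spares square roots: all the estimates below are made
    with squared moduli and squared norms. *)
Lemma sqmodD z w : sqmod (z + w) <= 2 * sqmod z + 2 * sqmod w.
Proof.
rewrite /sqmod complex_ReD complex_ImD -subr_ge0.
set a := complex.Re z; set b := complex.Im z.
set c := complex.Re w; set e := complex.Im w.
have -> : 2 * (a ^+ 2 + b ^+ 2) + 2 * (c ^+ 2 + e ^+ 2) -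
  ((a + c) ^+ 2 + (b + e) ^+ 2) = (a - c) ^+ 2 + (b - e) ^+ 2 by ring.
by rewrite addr_ge0 ?sqr_ge0.
Qed.

End complex_scalars.
#[global] Hint Extern 0 (is_true (0 <= sqmod _)) => exact: sqmod_ge0 : core.

(** * Complex-valued square integrable functions *)

Section complex_L2.
Context d (T : measurableType d) (R : realType).
Variables (mu : {measure set T -> \bar R}) (D : set T).
Hypothesis mD : measurable D.
Implicit Types f g h : T -> R[i].

Definition cmeasurable f :=
  measurable_fun D (fun x => complex.Re (f x)) /\
  measurable_fun D (fun x => complex.Im (f x)).

Definition cintegrable f :=
  mu.-integrable D (fun x => (complex.Re (f x))%:E) /\
  mu.-integrable D (fun x => (complex.Im (f x))%:E).

Definition sq_integrable f :=
  [/\ measurable_fun D (fun x => complex.Re (f x)),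
      measurable_fun D (fun x => complex.Im (f x)) &
      (\int[mu]_(x in D) (sqmod (f x))%:E < +oo)%E].

Local Notation cint := (cintegral mu D).

Lemma eq_cintegral f g : {in D, f =1 g} -> cint f = cint g.
Proof.
by move=> fg; apply: complex_eqP => /=; apply: eq_Rintegral => x xD; rewrite fg.
Qed.

Lemma eq_cintegrable f g : {in D, f =1 g} -> cintegrable f -> cintegrable g.
Proof.
move=> fg [h1 h2]; split; [move: h1|move: h2]; apply: eq_integrable => // x xD.
  by rewrite fg.
by rewrite fg.
Qed.

Lemma eq_cmeasurable f g : {in D, f =1 g} -> cmeasurable f -> cmeasurable g.
Proof.
move=> fg [h1 h2]; split; [move: h1|move: h2]; apply: eq_measurable_fun => // x xD.
  by rewrite fg.
by rewrite fg.
Qed.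

Lemma cintegrableD f g : cintegrable f -> cintegrable g ->
  cintegrable (fun x => f x + g x).
Proof.
move=> [f1 f2] [g1 g2]; split.
- rewrite (_ : (fun x => _) = (fun x => (complex.Re (f x))%:E) \+
    (fun x => (complex.Re (g x))%:E))%E; first exact: integrableD.
  by apply/funext => x /=; rewrite complex_ReD EFinD.
- rewrite (_ : (fun x => _) = (fun x => (complex.Im (f x))%:E) \+
    (fun x => (complex.Im (g x))%:E))%E; first exact: integrableD.
  by apply/funext => x /=; rewrite complex_ImD EFinD.
Qed.

Lemma cintegralD f g : cintegrable f -> cintegrable g ->
  cint (fun x => f x + g x) = cint f + cint g.
Proof.
move=> [f1 f2] [g1 g2]; apply: complex_eqP; rewrite !(complex_ReD, complex_ImD)/=.
  by rewrite -RintegralD//; apply: eq_Rintegral => x _; rewrite complex_ReD.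
by rewrite -RintegralD//; apply: eq_Rintegral => x _; rewrite complex_ImD.
Qed.

Let integrable_comb (u v : T -> R) (a b : R) :
  mu.-integrable D (EFin \o u) -> mu.-integrable D (EFin \o v) ->
  mu.-integrable D (EFin \o (fun x => a * u x + b * v x)).
Proof.
move=> hu hv; rewrite (_ : _ \o _ = (fun x => (a%:E * (EFin \o u) x)) \+
  (fun x => (b%:E * (EFin \o v) x)))%E//.
by apply: integrableD => //; exact: integrableZl.
Qed.

Let Rintegral_comb (u v : T -> R) (a b : R) :
  mu.-integrable D (EFin \o u) -> mu.-integrable D (EFin \o v) ->
  \int[mu]_(x in D) (a * u x + b * v x) =
  a * (\int[mu]_(x in D) u x) + b * (\int[mu]_(x in D) v x).
Proof.
move=> hu hv; have au := integrableZl mD a hu; have bv := integrableZl mD b hv.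
by rewrite RintegralD// !RintegralZl.
Qed.

Lemma cintegrableZ (c : R[i]) f : cintegrable f -> cintegrable (fun x => c * f x).
Proof.
move=> [f1 f2]; split.
- rewrite (_ : (fun x => _) = EFin \o (fun x => complex.Re c * complex.Re (f x) +
    (- complex.Im c) * complex.Im (f x))); first exact: integrable_comb.
  by apply/funext => x /=; rewrite complex_ReM mulNr.
- rewrite (_ : (fun x => _) = EFin \o (fun x => complex.Re c * complex.Im (f x) +
    complex.Im c * complex.Re (f x))); first exact: integrable_comb.
  by apply/funext => x /=; rewrite complex_ImM.
Qed.

Lemma cintegralZ (c : R[i]) f : cintegrable f ->
  cint (fun x => c * f x) = c * cint f.
Proof.
move=> [f1 f2]; apply: complex_eqP; rewrite !(complex_ReM, complex_ImM)/=.
  rewrite -mulNr -Rintegral_comb//; apply: eq_Rintegral => x _.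
  by rewrite complex_ReM mulNr.
by rewrite -Rintegral_comb//; apply: eq_Rintegral => x _; rewrite complex_ImM.
Qed.

Lemma cintegrableN f : cintegrable f -> cintegrable (fun x => - f x).
Proof.
by move=> fi; apply: (eq_cintegrable _ (cintegrableZ (-1) fi)) => x _; rewrite mulN1r.
Qed.

Lemma cintegralB f g : cintegrable f -> cintegrable g ->
  cint (fun x => f x - g x) = cint f - cint g.
Proof.
move=> fi gi; rewrite cintegralD//; last exact: cintegrableN.
congr (_ + _); rewrite -[RHS]mulN1r -cintegralZ//.
by apply: eq_cintegral => x _; rewrite mulN1r.
Qed.

Lemma cintegral_conj f : cintegrable f -> cint (fun x => (f x)^*) = (cint f)^*.
Proof.
move=> [f1 f2]; apply: complex_eqP; rewrite !(complex_Re_conj, complex_Im_conj)/=.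
  by apply: eq_Rintegral => x _; rewrite complex_Re_conj.
rewrite -mulN1r -RintegralZl//; apply: eq_Rintegral => x _.
by rewrite complex_Im_conj mulN1r.
Qed.

Lemma cintegrable0 : cintegrable (fun=> 0).
Proof. by split; exact: integrable0. Qed.

Lemma cintegral0 : cint (fun=> 0) = 0.
Proof. by apply: complex_eqP => /=; rewrite /Rintegral integral0. Qed.

Lemma cintegrable_sum (I : eqType) (s : seq I) (F : I -> T -> R[i]) :
  (forall i, i \in s -> cintegrable (F i)) ->
  cintegrable (fun x => \sum_(i <- s) F i x).
Proof.
elim: s => [|i s ih] Fi.
  by apply: (eq_cintegrable _ cintegrable0) => x _; rewrite big_nil.
apply: (@eq_cintegrable (fun x => F i x + \sum_(j <- s) F j x)).
  by move=> x _; rewrite big_cons.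
apply: cintegrableD; first by apply: Fi; rewrite mem_head.
by apply: ih => j js; apply: Fi; rewrite inE js orbT.
Qed.

Lemma cintegral_sum (I : eqType) (s : seq I) (F : I -> T -> R[i]) :
  (forall i, i \in s -> cintegrable (F i)) ->
  cint (fun x => \sum_(i <- s) F i x) = \sum_(i <- s) cint (F i).
Proof.
elim: s => [|i s ih] Fi.
  rewrite big_nil -[RHS]cintegral0; apply: eq_cintegral => x _.
  by rewrite big_nil.
rewrite big_cons -ih; last by move=> j js; apply: Fi; rewrite inE js orbT.
rewrite -cintegralD; [|by apply: Fi; rewrite mem_head|].
  by apply: eq_cintegral => x _; rewrite big_cons.
by apply: cintegrable_sum => j js; apply: Fi; rewrite inE js orbT.
Qed.

Lemma cmeasurableD f g : cmeasurable f -> cmeasurable g ->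
  cmeasurable (fun x => f x + g x).
Proof.
move=> [f1 f2] [g1 g2]; split.
  by under eq_fun do rewrite complex_ReD; exact: measurable_funD.
by under eq_fun do rewrite complex_ImD; exact: measurable_funD.
Qed.

Lemma cmeasurableM f g : cmeasurable f -> cmeasurable g ->
  cmeasurable (fun x => f x * g x).
Proof.
move=> [f1 f2] [g1 g2]; split.
  by under eq_fun do rewrite complex_ReM; apply: measurable_funB; exact: measurable_funM.
by under eq_fun do rewrite complex_ImM; apply: measurable_funD; exact: measurable_funM.
Qed.

Lemma cmeasurable_conj f : cmeasurable f -> cmeasurable (fun x => (f x)^*).
Proof.
move=> [f1 f2]; split; first by under eq_fun do rewrite complex_Re_conj.
by under eq_fun do rewrite complex_Im_conj; exact: measurable_funN.
Qed.

Lemma cmeasurable_cst (c : R[i]) : cmeasurable (fun=> c).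
Proof. by split; exact: measurable_cst. Qed.

Lemma measurable_sqmod f : cmeasurable f -> measurable_fun D (fun x => sqmod (f x)).
Proof. by move=> [f1 f2]; apply: measurable_funD; exact: measurable_funX. Qed.

Lemma sq_integrable_meas f : sq_integrable f -> cmeasurable f.
Proof. by case. Qed.

Lemma sq_integrable_sqmod f : sq_integrable f ->
  mu.-integrable D (EFin \o (fun x => sqmod (f x))).
Proof.
move=> [f1 f2 f3]; apply/integrableP; split.
  by apply/measurable_EFinP; exact: measurable_sqmod.
apply: le_lt_trans f3; rewrite le_eqVlt; apply/orP; left; apply/eqP.
by apply: eq_integral => x _ /=; rewrite ger0_norm.
Qed.

(** Domination by an integrable k, rather than by a square integrable function,
    is the form that serves both sums and bounded products. *)
Lemma le_sq_integrable f (k : T -> R) : cmeasurable f ->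
  mu.-integrable D (EFin \o k) -> (forall x, D x -> sqmod (f x) <= k x) ->
  sq_integrable f.
Proof.
move=> mf ki fk; have [m1 m2] := mf; split => //.
have /integrableP[_] : mu.-integrable D (EFin \o (fun x => sqmod (f x))).
  apply: (le_integrable mD _ _ ki).
    by apply/measurable_EFinP; exact: measurable_sqmod.
  move=> x Dx /=; rewrite lee_fin ger0_norm//.
  exact: le_trans (fk _ Dx) (ler_norm _).
move=> h; apply: le_lt_trans h; rewrite le_eqVlt; apply/orP; left; apply/eqP.
by apply: eq_integral => x _ /=; rewrite ger0_norm.
Qed.

Lemma eq_sq_integrable f g : {in D, f =1 g} -> sq_integrable f -> sq_integrable g.
Proof.
move=> fg hf; apply: (le_sq_integrable _ (sq_integrable_sqmod hf)).
  by apply: (eq_cmeasurable fg); exact: sq_integrable_meas.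
by move=> x Dx /=; rewrite fg ?inE.
Qed.

Lemma sq_integrableD f g : sq_integrable f -> sq_integrable g ->
  sq_integrable (fun x => f x + g x).
Proof.
move=> hf hg.
have h := integrable_comb 2 2 (sq_integrable_sqmod hf) (sq_integrable_sqmod hg).
apply: (le_sq_integrable _ h); last by move=> x _; exact: sqmodD.
by apply: cmeasurableD; exact: sq_integrable_meas.
Qed.

Lemma sq_integrableMb f g (M : R) : sq_integrable f -> cmeasurable g ->
  (forall x, D x -> sqmod (g x) <= M) -> sq_integrable (fun x => f x * g x).
Proof.
move=> hf mg gM.
have h := integrable_comb M 0 (sq_integrable_sqmod hf) (sq_integrable_sqmod hf).
apply: (le_sq_integrable _ h).
  by apply: cmeasurableM => //; exact: sq_integrable_meas.
move=> x Dx; rewrite mul0r addr0 sqmodM mulrC ler_wpM2r//; exact: gM.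
Qed.

Lemma sq_integrableZ (c : R[i]) f : sq_integrable f ->
  sq_integrable (fun x => c * f x).
Proof.
move=> hf; under eq_fun do rewrite mulrC.
by apply: (@sq_integrableMb _ _ (sqmod c)) => //; exact: cmeasurable_cst.
Qed.

Lemma sq_integrableN f : sq_integrable f -> sq_integrable (fun x => - f x).
Proof. by move=> hf; under eq_fun do rewrite -mulN1r; exact: sq_integrableZ. Qed.

Lemma sq_integrableB f g : sq_integrable f -> sq_integrable g ->
  sq_integrable (fun x => f x - g x).
Proof. by move=> hf hg; apply: sq_integrableD => //; exact: sq_integrableN. Qed.

Lemma sq_integrable_conj f : sq_integrable f -> sq_integrable (fun x => (f x)^*).
Proof.
move=> hf; apply: (le_sq_integrable _ (sq_integrable_sqmod hf)).
  by apply: cmeasurable_conj; exact: sq_integrable_meas.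
by move=> x _; rewrite sqmod_conj.
Qed.

Lemma sq_integrable0 : sq_integrable (fun=> 0).
Proof.
split; [exact: measurable_cst..|].
by under eq_integral do rewrite sqmod0; rewrite integral0.
Qed.

Lemma sq_integrable_sum (I : eqType) (s : seq I) (F : I -> T -> R[i]) :
  (forall i, i \in s -> sq_integrable (F i)) ->
  sq_integrable (fun x => \sum_(i <- s) F i x).
Proof.
elim: s => [|i s ih] Fi.
  by apply: (eq_sq_integrable _ sq_integrable0) => x _; rewrite big_nil.
apply: (@eq_sq_integrable (fun x => F i x + \sum_(j <- s) F j x)).
  by move=> x _; rewrite big_cons.
apply: sq_integrableD; first by apply: Fi; rewrite mem_head.
by apply: ih => j js; apply: Fi; rewrite inE js orbT.
Qed.

(** Both components of a product of complex numbers are at most the sum of the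
    two squared moduli in absolute value. *)
Lemma sq_integrableM f g : sq_integrable f -> sq_integrable g ->
  cintegrable (fun x => f x * g x).
Proof.
move=> hf hg.
have h := integrable_comb 1 1 (sq_integrable_sqmod hf) (sq_integrable_sqmod hg).
have [m1 m2] := cmeasurableM (sq_integrable_meas hf) (sq_integrable_meas hg).
have key (a b c e : R) : `|a * c - b * e| <= a ^+ 2 + b ^+ 2 + (c ^+ 2 + e ^+ 2).
  have := sqr_ge0 (a - c); have := sqr_ge0 (a + c).
  have := sqr_ge0 (b - e); have := sqr_ge0 (b + e) => h1 h2 h3 h4.
  by rewrite ler_norml; apply/andP; split; nra.
split; apply: (le_integrable mD _ _ h) => //=; try exact/measurable_EFinP;
  move=> x _; rewrite lee_fin !mul1r [leRHS]ger0_norm ?(addr_ge0, sqr_ge0)//.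
  by rewrite complex_ReM; exact: key.
rewrite complex_ImM -[X in _ + X]opprK -mulrN.
by apply: le_trans (key _ _ _ _) _; rewrite /sqmod sqrrN [X in _ + X]addrC.
Qed.

Definition ip f g : R[i] := cint (fun x => f x * (g x)^*).
Definition nrm2 f : R := \int[mu]_(x in D) sqmod (f x).

Lemma cintegrable_ip f g : sq_integrable f -> sq_integrable g ->
  cintegrable (fun x => f x * (g x)^*).
Proof. by move=> hf hg; apply: sq_integrableM => //; exact: sq_integrable_conj. Qed.

Lemma ipDl f g h : sq_integrable f -> sq_integrable g -> sq_integrable h ->
  ip (fun x => f x + g x) h = ip f h + ip g h.
Proof.
move=> hf hg hh; rewrite /ip -cintegralD; try exact: cintegrable_ip.
by apply: eq_cintegral => x _; rewrite mulrDl.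
Qed.

Lemma ipC f g : sq_integrable f -> sq_integrable g -> ip f g = (ip g f)^*.
Proof.
move=> hf hg; rewrite /ip -cintegral_conj; last exact: cintegrable_ip.
by apply: eq_cintegral => x _; rewrite rmorphM /= conjCK mulrC.
Qed.

Lemma ipDr f g h : sq_integrable f -> sq_integrable g -> sq_integrable h ->
  ip h (fun x => f x + g x) = ip h f + ip h g.
Proof.
move=> hf hg hh; rewrite ipC//; last exact: sq_integrableD.
by rewrite ipDl// rmorphD/= -!ipC.
Qed.

Lemma ipZl (c : R[i]) f g : sq_integrable f -> sq_integrable g ->
  ip (fun x => c * f x) g = c * ip f g.
Proof.
move=> hf hg; rewrite /ip -cintegralZ; last exact: cintegrable_ip.
by apply: eq_cintegral => x _; rewrite mulrA.
Qed.

Lemma ipZr (c : R[i]) f g : sq_integrable f -> sq_integrable g ->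
  ip f (fun x => c * g x) = c^* * ip f g.
Proof.
move=> hf hg; rewrite ipC//; last exact: sq_integrableZ.
by rewrite ipZl// rmorphM/= -ipC.
Qed.

Lemma ipBl f g h : sq_integrable f -> sq_integrable g -> sq_integrable h ->
  ip (fun x => f x - g x) h = ip f h - ip g h.
Proof.
move=> hf hg hh; rewrite /ip -cintegralB; try exact: cintegrable_ip.
by apply: eq_cintegral => x _; rewrite mulrBl.
Qed.

Lemma ipBr f g h : sq_integrable f -> sq_integrable g -> sq_integrable h ->
  ip h (fun x => f x - g x) = ip h f - ip h g.
Proof.
move=> hf hg hh; rewrite ipC//; last exact: sq_integrableB.
by rewrite ipBl// rmorphB/= -!ipC.
Qed.

Lemma ip_suml (I : eqType) (s : seq I) (c : I -> R[i]) (F : I -> T -> R[i]) g :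
  (forall i, i \in s -> sq_integrable (F i)) -> sq_integrable g ->
  ip (fun x => \sum_(i <- s) c i * F i x) g = \sum_(i <- s) c i * ip (F i) g.
Proof.
move=> hF hg; rewrite /ip.
under eq_cintegral do rewrite big_distrl/=.
rewrite cintegral_sum; last first.
  by move=> i /hF hi; apply: cintegrable_ip => //; exact: sq_integrableZ.
by apply: eq_big_seq => i /hF hi; rewrite -ipZl.
Qed.

Lemma ip_sumr (I : eqType) (s : seq I) (c : I -> R[i]) (F : I -> T -> R[i]) g :
  (forall i, i \in s -> sq_integrable (F i)) -> sq_integrable g ->
  ip g (fun x => \sum_(i <- s) c i * F i x) = \sum_(i <- s) (c i)^* * ip g (F i).
Proof.
move=> hF hg; rewrite ipC//; last first.
  by apply: sq_integrable_sum => i /hF; exact: sq_integrableZ.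
rewrite ip_suml// rmorph_sum/=; apply: eq_big_seq => i /hF hi.
by rewrite rmorphM/= -ipC.
Qed.

Lemma eq_ip f f' g g' : {in D, f =1 f'} -> {in D, g =1 g'} -> ip f g = ip f' g'.
Proof.
by move=> ff' gg'; apply: eq_cintegral => x xD; rewrite ff'// gg'.
Qed.

Lemma nrm2_ge0 f : 0 <= nrm2 f.
Proof. exact: Rintegral_ge0. Qed.
Hint Extern 0 (is_true (0 <= nrm2 _)) => exact: nrm2_ge0 : core.

Lemma eq_nrm2 f g : {in D, f =1 g} -> nrm2 f = nrm2 g.
Proof. by move=> fg; apply: eq_Rintegral => x xD; rewrite fg. Qed.

Lemma ip_nrm2 f : ip f f = (nrm2 f)%:C%C.
Proof.
rewrite /ip; under eq_cintegral do rewrite mul_conj_sqmod.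
by apply: complex_eqP => //=; rewrite /Rintegral integral0.
Qed.

Lemma EFin_nrm2 f : sq_integrable f ->
  ((nrm2 f)%:E = \int[mu]_(x in D) (sqmod (f x))%:E)%E.
Proof.
move=> [_ _ h]; rewrite /nrm2 /Rintegral fineK// ge0_fin_numE//.
by apply: integral_ge0 => x _; rewrite lee_fin.
Qed.

Lemma nrm2D f g : sq_integrable f -> sq_integrable g ->
  nrm2 (fun x => f x + g x) <= 2 * nrm2 f + 2 * nrm2 g.
Proof.
move=> hf hg; rewrite -Rintegral_comb; try exact: sq_integrable_sqmod.
apply: le_Rintegral => //.
- by apply: sq_integrable_sqmod; exact: sq_integrableD.
- by apply: integrable_comb; exact: sq_integrable_sqmod.
- by move=> x _; exact: sqmodD.
Qed.

Lemma nrm2N f : nrm2 (fun x => - f x) = nrm2 f.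
Proof. by apply: eq_Rintegral => x _; rewrite sqmodN. Qed.

(** The discriminant argument, applied to the squared norm of t f - <f, g> g,
    which is a nonnegative quadratic polynomial in the real number t. *)
Lemma cauchy_schwarz_ip f g : sq_integrable f -> sq_integrable g ->
  sqmod (ip f g) <= nrm2 f * nrm2 g.
Proof.
move=> hf hg; set c := ip f g.
have key (t : R) : 0 <= t ^+ 2 * nrm2 f - 2 * t * sqmod c + sqmod c * nrm2 g.
  have htf := sq_integrableZ (t%:C)%C hf; have hcg := sq_integrableZ c hg.
  have h := nrm2_ge0 (fun x => (t%:C)%C * f x - c * g x).
  suff -> : t ^+ 2 * nrm2 f - 2 * t * sqmod c + sqmod c * nrm2 g =
    nrm2 (fun x => (t%:C)%C * f x - c * g x) by [].
  apply: (@complexI R); rewrite -ip_nrm2 ipBl//; last exact: sq_integrableB.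
  rewrite !ipBr// !ipZl// !ipZr// (ipC hg hf) !ip_nrm2 -/c conj_real.
  move: (mul_conj_sqmod c); generalize (sqmod c); generalize c => z S hS.
  generalize (nrm2 f) (nrm2 g) => F G.
  by rewrite !(rmorphB, rmorphD, rmorphM, rmorphXn)/= -hS; ring.
have := nrm2_ge0 f; rewrite le_eqVlt => /predU1P[f0|f0]; last first.
  (* the minimum of the polynomial *)
  have := key (sqmod c / nrm2 f).
  have [-> _|c0] := eqVneq (sqmod c) 0; first by rewrite mulr_ge0.
  have cp : 0 < sqmod c by rewrite lt_neqAle eq_sym c0 sqmod_ge0.
  have -> : (sqmod c / nrm2 f) ^+ 2 * nrm2 f - 2 * (sqmod c / nrm2 f) * sqmod c +
     sqmod c * nrm2 g = sqmod c * (nrm2 g - sqmod c / nrm2 f).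
    by field; exact: lt0r_neq0.
  by rewrite pmulr_rge0// subr_ge0 ler_pdivrMr// mulrC.
rewrite -f0 mul0r leNgt; apply/negP => cp.
(* here the polynomial is affine in t, and negative at this value of t *)
have := key (nrm2 g / 2 + 1); rewrite -f0 mulr0 add0r.
have -> : - (2 * (nrm2 g / 2 + 1) * sqmod c) + sqmod c * nrm2 g = - (2 * sqmod c).
  by field.
by rewrite oppr_ge0 pmulr_rle0 ?ltr0n// leNgt cp.
Qed.

(** The inner product is jointly continuous:
    <f, g> - <F, G> = <f - F, g> + <F, g - G>, and the norms of the F n are
    bounded. *)
Lemma ip_cvg f g (F G : nat -> T -> R[i]) : sq_integrable f -> sq_integrable g ->
  (forall n, sq_integrable (F n)) -> (forall n, sq_integrable (G n)) ->
  nrm2 (fun x => f x - F n x) @[n --> \oo] --> (0 : R) ->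
  nrm2 (fun x => g x - G n x) @[n --> \oo] --> (0 : R) ->
  sqmod (ip f g - ip (F n) (G n)) @[n --> \oo] --> (0 : R).
Proof.
move=> hf hg hF hG cF cG.
pose a n := nrm2 (fun x => f x - F n x); pose b n := nrm2 (fun x => g x - G n x).
have hfF n := sq_integrableB hf (hF n); have hgG n := sq_integrableB hg (hG n).
have bF n : nrm2 (F n) <= 2 * nrm2 f + 2 * a n.
  have := nrm2D hf (sq_integrableN (hfF n)).
  rewrite nrm2N; apply: le_trans.
  by rewrite le_eqVlt; apply/orP; left; apply/eqP/eq_nrm2 => x _; ring.
apply: (@squeeze_cvgr _ _ _ _ (fun=> 0)
  (fun n => 2 * (a n * nrm2 g) + 2 * ((2 * nrm2 f + 2 * a n) * b n))).
- near=> n; rewrite sqmod_ge0/=.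
  have -> : ip f g - ip (F n) (G n) = ip (fun x => f x - F n x) g +
      ip (F n) (fun x => g x - G n x).
    by rewrite ipBl// ipBr//; ring.
  apply: le_trans (sqmodD _ _) _; rewrite lerD// ler_wpM2l//.
    exact: cauchy_schwarz_ip.
  apply: le_trans (cauchy_schwarz_ip (hF n) (hgG n)) _.
  by rewrite ler_wpM2r// nrm2_ge0.
- exact: cvg_cst.
- have -> : (0 : R) = 2 * (0 * nrm2 g) + 2 * ((2 * nrm2 f + 2 * 0) * 0) by ring.
  apply: cvgD; apply: cvgMr.
    exact: cvgMl.
  apply: cvgM => //; apply: cvgD; first exact: cvg_cst.
  exact: cvgMr.
Unshelve. all: by end_near. Qed.

End complex_L2.

(** * Image of a measure with a density *)

Section density_transfer.
Local Open Scope ereal_scope.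
Context d1 d2 (T1 : measurableType d1) (T2 : measurableType d2) (R : realType).
Variables (mu : {measure set T1 -> \bar R}) (nu : {measure set T2 -> \bar R}).
Variables (phi : T1 -> T2) (E : set T1) (g : T1 -> \bar R).
Hypotheses (mphi : measurable_fun setT phi) (mE : measurable E).
Hypotheses (mg : measurable_fun E g) (g0 : forall x, E x -> 0 <= g x).
Hypothesis gfin : forall x, g x \is a fin_num.
Hypothesis nuE : forall A, measurable A ->
  nu A = \int[mu]_(x in E `&` phi @^-1` A) g x.

Import HBNNSimple.

Let mpre A : measurable A -> measurable (phi @^-1` A).
Proof. by move=> mA; rewrite -[X in measurable X]setTI; exact: mphi. Qed.

(** Both sides agree on indicators by hypothesis, hence on simple functions, and
    on their increasing limits by monotone convergence. *)
Lemma ge0_integral_density (f : T2 -> \bar R) :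
  measurable_fun setT f -> (forall y, 0 <= f y) ->
  \int[nu]_y f y = \int[mu]_(x in E) (f (phi x) * g x).
Proof.
move=> mf f0; pose h := nnsfun_approx measurableT mf.
have -> : \int[nu]_y f y = limn (fun n => \int[nu]_y (EFin \o h n) y).
  have fE y : setT y -> f y = limn (EFin \o h ^~ y).
    by move=> _; apply/esym/cvg_lim => //; exact: cvg_nnsfun_approx.
  under eq_integral => y _ do rewrite fE//.
  apply: monotone_convergence => //.
  - by move=> n; exact/measurable_EFinP/measurable_funP.
  - by move=> n y _ /=; rewrite lee_fin.
  - by move=> y _ a b ab; rewrite lee_fin; exact/lefP/nd_nnsfun_approx.
have mhg n : measurable_fun E (fun x => (h n (phi x))%:E * g x).
  apply: emeasurable_funM => //; apply/measurable_EFinP.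
  by apply: measurable_funTS; exact: measurableT_comp.
have -> : \int[mu]_(x in E) (f (phi x) * g x) =
    limn (fun n => \int[mu]_(x in E) ((h n (phi x))%:E * g x)).
  have fE x : E x -> f (phi x) * g x = limn (fun n => (h n (phi x))%:E * g x).
    move=> Ex; apply/esym/cvg_lim => //; apply: cvgeZr => //.
    exact: cvg_nnsfun_approx.
  under eq_integral => x /[!inE] Ex do rewrite fE//.
  apply: monotone_convergence => //.
  - by move=> n x Ex; rewrite mule_ge0 ?lee_fin ?g0.
  - move=> x Ex a b ab; rewrite lee_wpmul2r ?g0// lee_fin.
    exact/lefP/nd_nnsfun_approx.
suff suf n : \int[nu]_y (EFin \o h n) y =
    \int[mu]_(x in E) ((h n (phi x))%:E * g x) by under eq_fun do rewrite suf.
clear mhg; move: (h n) => {}h.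
under eq_integral => y _ do rewrite /= fimfunE -fsumEFin//.
rewrite ge0_integral_fsum//; last 2 first.
  - by move=> r; apply/measurable_EFinP; exact: measurable_funM.
  - by move=> r y _; exact: nnfun_muleindic_ge0.
under [RHS]eq_integral => x xE.
  rewrite fimfunE -fsumEFin// ge0_mule_fsuml; last first.
    by move=> r; exact: nnfun_muleindic_ge0.
  over.
rewrite ge0_integral_fsum//; last 2 first.
  - move=> r; apply: emeasurable_funM => //; apply/measurable_EFinP.
    apply: measurable_funM => //; apply: measurable_funTS.
    by apply: measurableT_comp => //; exact: measurable_indic.
  - move=> r x Ex; rewrite mule_ge0 ?g0//; exact: nnfun_muleindic_ge0.
apply: eq_fsbigr => r; rewrite inE => -[y0 _ <-].
under eq_integral do rewrite EFinM.
rewrite ge0_integralZl//; last 2 first.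
  - by apply/measurable_EFinP.
  - by rewrite lee_fin.
rewrite integral_indic// setIT nuE//.
under [RHS]eq_integral do rewrite EFinM -muleA.
rewrite ge0_integralZl//; last 3 first.
  - apply: emeasurable_funM => //; apply/measurable_EFinP.
    by apply: measurable_funTS; apply: measurableT_comp => //; exact: measurable_indic.
  - by move=> x Ex; rewrite mule_ge0 ?g0 ?lee_fin.
  - by rewrite lee_fin.
congr (_ * _).
rewrite integral_mkcondr; apply: eq_integral => x _.
by rewrite epatch_indic muleC.
Qed.

End density_transfer.

(** * Surface integrals in polar coordinates *)

Section surface.
Variable R : realType.
Local Notation S2 := (R * R * R)%type.
Local Notation sigma := (@surface_measure R).
Local Notation lam2 :=
  ((@lebesgue_measure R) \x (@lebesgue_measure R))%E.

Lemma polar_sphere (p : R * R) : sphere (polar p).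
Proof.
case: p => t u; rewrite /sphere /polar/= !exprMn -mulrDr (addrC (cos u ^+ 2)).
by rewrite [sin u ^+ 2 + _]addrC cos2Dsin2 mulr1 addrC cos2Dsin2.
Qed.

Lemma measurable_sphere : measurable (@sphere R).
Proof.
have m : measurable_fun [set: S2]
    (fun x : S2 => x.1.1 ^+ 2 + x.1.2 ^+ 2 + x.2 ^+ 2).
  have m1 : measurable_fun [set: S2] (fun x : S2 => x.1.1) by exact: measurableT_comp.
  have m2 : measurable_fun [set: S2] (fun x : S2 => x.1.2) by exact: measurableT_comp.
  by repeat apply: measurable_funD => //; apply: measurable_funX.
rewrite (_ : sphere =
  setT `&` (fun x : S2 => x.1.1 ^+ 2 + x.1.2 ^+ 2 + x.2 ^+ 2) @^-1` [set 1]).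
  exact: m.
by rewrite setTI.
Qed.
Hint Resolve measurable_sphere : core.

Let measurable_dom : measurable (@polar_domain R).
Proof. exact: measurableX. Qed.
Hint Resolve measurable_dom : core.

Let measurable_sin1 : measurable_fun (@polar_domain R) (fun p : R * R => sin p.1).
Proof.
apply: measurable_funTS; apply: measurableT_comp => //.
by apply: continuous_measurable_fun; exact: continuous_sin.
Qed.

Let sin1_ge0 (p : R * R) : polar_domain p -> 0 <= sin p.1.
Proof. by case=> /=; rewrite in_itv/= => h _; rewrite sin_ge0_pi// in_itv. Qed.

Lemma ge0_surface_integral (f : S2 -> \bar R) : measurable_fun sphere f ->
  (forall x, sphere x -> (0 <= f x)%E) ->
  (\int[sigma]_(x in sphere) f x =
   \int[lam2]_(p in @polar_domain R) (f (polar p) * (sin p.1)%:E))%E.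
Proof.
move=> mf f0; rewrite integral_mkcond.
rewrite (@ge0_integral_density _ _ _ _ _ lam2 _ (@polar R) (@polar_domain R)
  (fun p => (sin p.1)%:E))//.
- apply: eq_integral => p _; rewrite patchE ifT// inE; exact: polar_sphere.
- exact: measurable_polar.
- exact/measurable_EFinP.
- by apply/(measurable_restrictT _ _).1.
- by move=> y; rewrite patchE; case: ifPn => //; rewrite inE; exact: f0.
Qed.

Lemma surface_measure_finite : (sigma setT < +oo)%E.
Proof.
rewrite /surface_measure/= preimage_setT setIT.
apply: (@le_lt_trans _ _ (\int[lam2]_(p in @polar_domain R) (cst 1) p)%E).
  apply: ge0_le_integral => //.
  - exact/measurable_EFinP.
  - by move=> p _; rewrite lee_fin sin_le1.
rewrite integral_cst// mul1e [X in (X < _)%E](_ : _ =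
  lebesgue_measure (`[0%R, pi]%classic : set R) *
  lebesgue_measure (`[0%R, (pi *+ 2)%R[%classic : set R))%E;
  last exact: product_measure1E.
by rewrite !lebesgue_measure_itv/=; do 2 case: ifP => _;
  rewrite ?mule0 ?mul0e ?ltry// -!EFinB -EFinM ltry.
Qed.

HB.instance Definition _ := Measure_isFinite.Build _ _ _ (@surface_measure R)
  (lty_fin_num_fun surface_measure_finite).

(** Transfer to polar coordinates of the positive and of the negative part,
    followed by Fubini's theorem. *)
Lemma surface_integral (f : S2 -> R) :
  sigma.-integrable sphere (EFin \o f) ->
  (\int[sigma]_(x in sphere) (f x)%:E =
   \int[@lebesgue_measure R]_(t in `[0%R, pi])
     \int[@lebesgue_measure R]_(u in `[0%R, (pi *+ 2)%R[)
        (f (polar (t, u)) * sin t)%:E)%E.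
Proof.
move=> fi; have /integrableP[/= mf foo] := fi.
pose G (p : R * R) : \bar R := (f (polar p) * sin p.1)%:E.
have mfR : measurable_fun sphere f by exact/measurable_EFinP.
have mG : measurable_fun (@polar_domain R) G.
  apply/measurable_EFinP; apply: measurable_funM; last exact: measurable_sin1.
  apply: (@measurable_comp _ _ _ _ _ _ sphere) => //.
    by move=> _ [p _ <-]; exact: polar_sphere.
  by apply: measurable_funTS; exact: measurable_polar.
have Gabs p : polar_domain p -> `|G p|%E = (`|f (polar p)|%:E * (sin p.1)%:E)%E.
  by move=> pd; rewrite /G abse_EFin normrM (ger0_norm (sin1_ge0 pd)) EFinM.
have Gi : lam2.-integrable (@polar_domain R) G.
  apply/integrableP; split => //.
  apply: le_lt_trans foo; rewrite ge0_surface_integral//; last first.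
    by apply/measurable_EFinP; exact: measurableT_comp.
  rewrite le_eqVlt; apply/orP; left; apply/eqP; apply: eq_integral => p.
  by rewrite inE => pd; rewrite Gabs.
have -> : (\int[sigma]_(x in sphere) (f x)%:E =
    \int[lam2]_(p in @polar_domain R) G p)%E.
  rewrite integralE [RHS]integralE !ge0_surface_integral; last 4 first.
  - exact: measurable_funeneg.
  - by move=> x _; exact: funeneg_ge0.
  - exact: measurable_funepos.
  - by move=> x _; exact: funepos_ge0.
  congr (_ - _)%E; apply: eq_integral => p; rewrite inE => pd;
    rewrite ?funeposE ?funenegE /G /= ?EFinM.
    by rewrite maxe_pMl ?mul0e// lee_fin; exact: sin1_ge0.
  by rewrite -mulNr EFinM maxe_pMl ?mul0e// lee_fin; exact: sin1_ge0.
rewrite integral_mkcond -integral12_prod_meas1; last first.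
  exact/(integrable_mkcond _ _).1.
rewrite [RHS]integral_mkcond; apply: eq_integral => t _; rewrite patchE.
rewrite /fubini_F; case: ifPn => [|/negP]; rewrite inE => ht.
  rewrite [RHS]integral_mkcond; apply: eq_integral => u _; rewrite !patchE.
  by congr (if _ then _ else _); apply/idP/idP; rewrite !inE; [case|split].
rewrite -[RHS](@integral0 _ _ _ (@lebesgue_measure R) setT).
apply: eq_integral => u _; rewrite patchE ifF//; apply/negP; rewrite inE => -[h _].
exact: ht.
Qed.

End surface.
#[global] Hint Extern 0 (measurable (@sphere _)) => exact: measurable_sphere : core.

(** * Orthogonality of the associated Legendre functions *)

Section legendre_orthogonality.
Variable R : realType.
Implicit Types p q r F : {poly R}.

(** The integral of p over the interval from -1 to 1. As a formal sum over
    coefficients it is manifestly linear, and it turns the Legendre theory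
    into algebra; the link with Lebesgue integrals is made only once, through
    the substitution of cos t. *)
Definition poly_integral p : R :=
  \sum_(i < size p) p`_i * ((1 - (-1) ^+ i.+1) / i.+1%:R).
Local Notation I := poly_integral.

Lemma poly_integral_wide n p : (size p <= n)%N ->
  I p = \sum_(i < n) p`_i * ((1 - (-1) ^+ i.+1) / i.+1%:R).
Proof.
move=> sp; rewrite /I (big_ord_widen n (fun i => p`_i * ((1 - (-1) ^+ i.+1) / i.+1%:R)) sp).
rewrite big_mkcond/=; apply: eq_bigr => i _; case: ifPn => //.
by rewrite -leqNgt => h; rewrite nth_default// mul0r.
Qed.

Lemma poly_integralD p q : I (p + q) = I p + I q.
Proof.
pose n := maxn (size p) (size q).
rewrite !(@poly_integral_wide n) ?leq_maxl ?leq_maxr//.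
  by rewrite -big_split/=; apply: eq_bigr => i _; rewrite coefD mulrDl.
exact: size_polyD.
Qed.

Lemma poly_integralZ c p : I (c *: p) = c * I p.
Proof.
rewrite (@poly_integral_wide (size p)) ?size_scale_leq// big_distrr/=.
by apply: eq_bigr => i _; rewrite coefZ mulrA.
Qed.

Lemma poly_integral_deriv F : I F^`() = F.[1] - F.[-1].
Proof.
have sF : (size F^`() <= (size F).-1)%N.
  have [->|F0] := eqVneq F 0; first by rewrite deriv0 size_poly0.
  by rewrite -ltnS prednK ?size_poly_gt0//; exact: lt_size_deriv.
rewrite (poly_integral_wide sF).
have [F0|F0] := eqVneq F 0.
  by rewrite F0 size_poly0 big_ord0 !horner0 subrr.
have sF' : (size F <= (size F).-1.+1)%N by rewrite prednK// size_poly_gt0.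
rewrite !(horner_coef_wide _ sF').
rewrite -sumrB big_ord_recl/= !expr0 subrr add0r; apply: eq_bigr => i _.
rewrite coef_deriv /bump /= add1n expr1n -[_`_i.+1 *+ _]mulr_natr.
have n0 : i.+1%:R != 0 :> R by rewrite pnatr_eq0.
by move: (i.+1%:R : R) F`_i.+1 ((-1) ^+ i.+1 : R) n0 => n a e n0; field.
Qed.

Lemma poly_integral_parts p q :
  I (p^`() * q) = (p * q).[1] - (p * q).[-1] - I (p * q^`()).
Proof.
by rewrite -poly_integral_deriv derivM poly_integralD addrK.
Qed.

Definition primitive p : {poly R} := \poly_(i < (size p).+1) (p`_i.-1 / i%:R).

Lemma deriv_primitive p : (primitive p)^`() = p.
Proof.
apply/polyP => i; rewrite coef_deriv coef_poly/= ltnS; case: ifPn => h.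
  by rewrite -[(_ / _) *+ _]mulr_natr divfK// pnatr_eq0.
by rewrite mul0rn nth_default// leqNgt.
Qed.

Local Notation W := ('X ^+ 2 - 1 : {poly R}).

(** Each derivation lowers by one the order of the zeros of W at 1 and -1. *)
Lemma derivn_vanish j k q : exists r, (W ^+ (j + k) * q)^`(k) = W ^+ j * r.
Proof.
elim: k j => [|k ih] j; first by exists q; rewrite addn0 derivn0.
rewrite -addSnnS derivnS; have [r ->] := ih j.+1.
exists (('X *+ 2) * r *+ j.+1 + W * r^`()).
rewrite derivM deriv_exp/= derivB derivXn derivC subr0 /= expr1 (exprS W).
by move: (W ^+ j) => V; ring.
Qed.

Lemma hornerW1 j (r : {poly R}) x : x ^+ 2 = 1 -> (W ^+ j.+1 * r).[x] = 0.
Proof. by move=> x1; rewrite hornerM horner_exp !hornerE x1 subrr expr0n/= mul0r. Qed.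

(** Integration by parts n times; the boundary terms vanish because at most n - 1
    derivatives have been taken of a polynomial with zeros of order n. *)
Lemma poly_integral_parts_iter n p q :
  I ((W ^+ n * q)^`(n) * p) = (-1) ^+ n * I (W ^+ n * q * p^`(n)).
Proof.
suff key k j p' : (k + j)%N = n -> I ((W ^+ n * q)^`(k) * p') =
    (-1) ^+ k * I (W ^+ n * q * p'^`(k)) by apply: (key n 0%N); rewrite addn0.
elim: k j p' => [|k ih] j p' kj; first by rewrite !derivn0 expr0 mul1r.
rewrite derivnS poly_integral_parts (ih j.+1); last by rewrite -kj addnS addSn.
have [r hr] : exists r, (W ^+ n * q)^`(k) = W ^+ j.+1 * r.
  by have := derivn_vanish j.+1 k q; rewrite addSnnS addnC kj.
rewrite hr -mulrA !hornerW1 ?sqrrN ?expr1n// subrr sub0r (exprS (-1)) mulN1r mulNr.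
by rewrite derivSn.
Qed.

(** The constant of Rodrigues' formula. *)
Definition lcoef l : R := ((2 ^ l * l`!)%N%:R)^-1.

Lemma size_W l : size (W ^+ l) = (2 * l).+1.
Proof.
have s2 : size W = 3%N by rewrite size_polyDl ?size_polyXn// size_polyN size_poly1.
have h := size_exp W l; rewrite s2/= in h.
have : (0 < size (W ^+ l))%N.
  by rewrite size_poly_gt0 expf_neq0// -size_poly_gt0 s2.
by move=> h0; rewrite -(prednK h0) h.
Qed.

Lemma lead_W l : (W ^+ l)`_(2 * l) = 1.
Proof.
have -> : (2 * l)%N = (size (W ^+ l)).-1 by rewrite size_W.
rewrite -lead_coefE lead_coef_exp lead_coefDl ?lead_coefXn ?expr1n//.
by rewrite size_polyXn size_polyN size_poly1.
Qed.

Lemma size_derivn_le n p : (size p^`(n) <= size p - n)%N.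
Proof.
apply/leq_sizeP => i hi; rewrite coef_derivn nth_default ?mul0rn//.
by rewrite -leq_subLR.
Qed.

Lemma size_legendre l : (size (legendre R l) <= l.+1)%N.
Proof.
apply: leq_trans (size_scale_leq _ _) _; apply: leq_trans (size_derivn_le _ _) _.
by rewrite size_W mul2n -addnn subSn ?leq_addr// addnK.
Qed.

Lemma legendre_lead l : (legendre R l)`_l = lcoef l * ((2 * l) ^_ l)%:R.
Proof.
by rewrite coefZ coef_derivn addnn -mul2n lead_W.
Qed.

Lemma legendre_lead_neq0 l : (legendre R l)`_l != 0.
Proof.
rewrite legendre_lead mulf_neq0// ?invr_eq0 ?pnatr_eq0.
  by rewrite muln_eq0 expn_eq0/= -lt0n fact_gt0.
by rewrite -lt0n ffact_gt0 leq_pmull.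
Qed.

(** By Rodrigues' formula and l integrations by parts, only the coefficient of
    degree l of q remains. *)
Lemma poly_integral_legendre l q : (size q <= l.+1)%N ->
  I (legendre R l * q) = lcoef l * (-1) ^+ l * (q`_l * l`!%:R) * I (W ^+ l).
Proof.
move=> sq; rewrite /legendre -scalerAl poly_integralZ.
have := poly_integral_parts_iter l q 1; rewrite !mulr1 => ->.
have -> : q^`(l) = (q`_l * l`!%:R)%:P.
  apply/polyP => i; rewrite coef_derivn coefC; case: i => [|i]/=.
    by rewrite addn0 ffactnn mulr_natr.
  by rewrite nth_default ?mul0rn// (leq_trans sq)// addnS ltnS leq_addr.
rewrite [W ^+ l * _]mulrC mul_polyC poly_integralZ -/(lcoef l).
by move: ((-1) ^+ l : R) => e; ring.
Qed.

(** The squared norm of the Legendre polynomial, by the recurrence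
    (2 l + 3) I(W^(l+1)) = - (2 l + 2) I(W^l). *)
Lemma poly_integral_W l :
  lcoef l ^+ 2 * ((2 * l)`!)%:R * (-1) ^+ l * I (W ^+ l) = 2 / (2 * l + 1)%:R.
Proof.
elim: l => [|l ih].
  rewrite /lcoef !expr0 muln0 !fact0 expn0 muln1 invr1 expr1n !mul1r.
  have -> : (1 : {poly R}) = ('X)^`() by rewrite derivX.
  by rewrite poly_integral_deriv !hornerX opprK mulr1.
have rec : (2 * l + 3)%:R * I (W ^+ l.+1) = - (2 * l.+1)%:R * I (W ^+ l).
  (* the recurrence comes from integrating the derivative of X W^(l+1) *)
  have h := poly_integral_parts 'X (W ^+ l.+1).
  rewrite derivX mul1r (mulrC 'X (W ^+ l.+1)) !hornerW1 ?sqrrN ?expr1n// in h.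
  have e : 'X * (W ^+ l.+1)^`() = (2 * l.+1)%:R *: (W ^+ l.+1 + W ^+ l).
    rewrite deriv_exp/= derivB derivXn derivC subr0 expr1 (exprS W).
    by move: (W ^+ l) => V; rewrite -mul_polyC polyC_natr natrM; ring.
  rewrite subrr sub0r e poly_integralZ poly_integralD in h.
  move: (I (W ^+ l.+1)) (I (W ^+ l)) h => A B h.
  have -> : (2 * l + 3)%:R * A = A + (2 * l.+1)%:R * (A + B) - (2 * l.+1)%:R * B.
    by rewrite !natrD !natrM; ring.
  have -> : A + (2 * l.+1)%:R * (A + B) = 0 by rewrite [X in X + _]h addNr.
  by rewrite sub0r mulNr.
have -> : I (W ^+ l.+1) = - (2 * l.+1)%:R / (2 * l + 3)%:R * I (W ^+ l).
  by rewrite mulrAC -rec [_%:R * _]mulrC mulfK// pnatr_eq0 addn3.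
have -> : lcoef l.+1 = lcoef l / (2 * l.+1)%:R.
  by rewrite /lcoef expnS factS -invfM -natrM; congr (_%:R^-1); nia.
have -> : (2 * l.+1 = (2 * l).+2)%N by rewrite mulnS.
rewrite !factS !natrM (exprS (-1)) mulN1r.
set x := I (W ^+ l) in ih *.
have h1 : lcoef l != 0 by rewrite invr_eq0 pnatr_eq0 muln_eq0 expn_eq0/= -lt0n fact_gt0.
have h2 : ((2 * l)`!)%:R != 0 :> R by rewrite pnatr_eq0 -lt0n fact_gt0.
have h3 : (-1) ^+ l != 0 :> R by rewrite expf_neq0// oppr_eq0 oner_eq0.
have -> : x = 2 / (2 * l + 1)%:R / (lcoef l ^+ 2 * ((2 * l)`!)%:R * (-1) ^+ l).
  by rewrite -ih [RHS]mulrC mulKf// !mulf_neq0// expf_neq0.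
move: (lcoef l) ((2 * l)`!%:R : R) ((-1) ^+ l : R) h1 h2 h3 => a c e h1 h2 h3.
have hl : 0 <= l%:R :> R by [].
have E k : (2 * l + k)%:R = 2 * l%:R + k%:R :> R by rewrite natrD natrM.
have -> : ((2 * l).+2 + 1 = 2 * l + 3)%N by lia.
have -> : ((2 * l).+2 = 2 * l + 2)%N by lia.
have -> : ((2 * l).+1 = 2 * l + 1)%N by lia.
rewrite !E; move: (l%:R : R) hl => y y0.
by field; rewrite h1 h2 h3 !lt0r_neq0//; lra.
Qed.

(** Moving m derivatives from the factor of degree l to the other ones yields
    the product of the Legendre polynomial of degree l with a polynomial of
    degree at most l', so that the previous lemmas apply; on the diagonal,
    only the leading coefficients matter. *)
Lemma assoc_legendre_orthogonal (l l' m : nat) : (m <= l')%N -> (l' <= l)%N ->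
  I ((1 - 'X ^+ 2) ^+ m * ((legendre R l)^`(m) * (legendre R l')^`(m))) =
  if l == l' then 2 / (2 * l + 1)%:R * ((l + m)`!%:R / (l - m)`!%:R) else 0.
Proof.
move=> ml' l'l.
have -> : (1 - 'X ^+ 2) ^+ m = (-1) ^+ m *: W ^+ m :> {poly R}.
  by rewrite -opprB -scaleN1r exprZn.
rewrite -scalerAl poly_integralZ.
have -> : W ^+ m * ((legendre R l)^`(m) * (legendre R l')^`(m)) =
  W ^+ m * (legendre R l')^`(m) * (legendre R l)^`(m) by ring.
rewrite -poly_integral_parts_iter.
set u := (W ^+ m * _)^`(m).
have su : (size u <= l'.+1)%N.
  apply: leq_trans (size_derivn_le _ _) _.
  rewrite leq_subLR; apply: leq_trans (size_polyMleq _ _) _.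
  rewrite size_W; have := leq_trans (size_derivn_le m _) (leq_sub2r m (size_legendre l')).
  by move: ml'; lia.
rewrite mulrC poly_integral_legendre ?(leq_trans su)//.
have [/eqP ll|ll] := ifPn; last first.
  rewrite (_ : u`_l = 0) ?mul0r ?mulr0 ?mul0r// nth_default//.
  by apply: leq_trans su _; rewrite ltn_neqAle eq_sym ll.
subst l'.
have ul : u`_l = (legendre R l)`_l * ((l + m)`!%:R / (l - m)`!%:R).
  rewrite coef_derivn.
  have -> : (W ^+ m * (legendre R l)^`(m))`_(m + l) = (legendre R l)`_l * (l ^_ m)%:R.
    have e : (m + l = 2 * m + (l - m))%N by lia.
    rewrite e coefM (bigD1 (Ordinal (leq_addr (l - m) (2 * m).+1)))//= addKn lead_W mul1r.
    rewrite big1 ?addr0; last first.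
      move=> [i hi] /= /eqP ne; have {}ne : i <> (2 * m)%N by move=> h; apply: ne; exact/val_inj.
      have [h|h] := ltnP (2 * m) i.
        by rewrite nth_default ?mul0r// size_W.
      rewrite [X in _ * X]nth_default ?mulr0//.
      apply: leq_trans (size_derivn_le _ _) _.
      by apply: leq_trans (leq_sub2r m (size_legendre l)) _; lia.
    by rewrite coef_derivn subnKC// mulr_natr.
  rewrite -[_ *+ (m + l) ^_ m]mulr_natr -mulrA; congr (_ * _).
  have f0 : (l - m)`!%:R != 0 :> R by rewrite pnatr_eq0 -lt0n fact_gt0.
  apply: (mulIf f0); rewrite divfK// -!natrM; congr _%:R.
  rewrite mulnAC (ffact_fact ml') mulnC addnC.
  by have := ffact_fact (leq_addl l m); rewrite addnK.
rewrite ul legendre_lead -poly_integral_W.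
have e : ((2 * l)`! = (2 * l) ^_ l * l`!)%N.
  by rewrite -(@ffact_fact (2 * l) l) ?leq_pmull// mul2n -addnn addnK.
rewrite e natrM.
have s : (-1) ^+ m * (-1) ^+ m = 1 :> R by rewrite -exprD -signr_odd addnn odd_double.
by rewrite mulrC; ring: s.
Qed.

(** The m-th derivative of the l-th Legendre polynomial has degree exactly l - m,
    so these polynomials are a triangular basis. *)
Lemma legendre_derivn_span (m N : nat) q : (size q + m <= N)%N ->
  exists c : nat -> R, q = \sum_(m <= l < N) c l *: (legendre R l)^`(m).
Proof.
elim: N q => [|N ih] q sq.
  exists (fun=> 0); move: sq; rewrite leqn0 addn_eq0 => /andP[/eqP + _].
  by move=> /eqP; rewrite size_poly_eq0 => /eqP ->; rewrite big1// => i _; rewrite scale0r.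
have [Nm|mN] := ltnP N m.
  exists (fun=> 0).
  have : size q == 0%N by move: sq Nm; lia.
  by rewrite size_poly_eq0 => /eqP ->; rewrite big1// => i _; rewrite scale0r.
pose k := (legendre R N)^`(m)`_(N - m).
have k0 : k != 0.
  rewrite /k coef_derivn subnKC// -mulr_natr mulf_neq0 ?legendre_lead_neq0//.
  by rewrite pnatr_eq0 -lt0n ffact_gt0.
pose q' := q - (q`_(N - m) / k) *: (legendre R N)^`(m).
have sP := leq_trans (size_derivn_le m _) (leq_sub2r m (size_legendre N)).
have sq' : (size q' + m <= N)%N.
  suff : (size q' <= N - m)%N by move: mN; lia.
  apply/leq_sizeP => j; rewrite leq_eqVlt => /predU1P[<-|hj].
    by rewrite coefB coefZ -/k divfK// subrr.
  rewrite coefB coefZ [X in _ * X]nth_default ?mulr0 ?subr0.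
    have sq1 : (size q <= N.+1 - m)%N by rewrite -(addnK m (size q)) leq_sub2r.
    by rewrite nth_default// (leq_trans sq1)// subSn.
  by apply: leq_trans sP _; rewrite subSn.
have [c hc] := ih _ sq'.
exists (fun l => if l == N then q`_(N - m) / k else c l).
rewrite big_nat_recr//= eqxx.
rewrite (_ : q = q' + (q`_(N - m) / k) *: (legendre R N)^`(m)); last by rewrite subrK.
rewrite {1}hc; congr (_ + _); last by rewrite subrK.
by apply: eq_big_nat => i /andP[_ iN]; rewrite ltn_eqF.
Qed.

End legendre_orthogonality.

(** * Spherical harmonics in Cartesian coordinates *)

Section harmonics_on_sphere.
Variable R : realType.
Local Notation S2 := (R * R * R)%type.
Local Notation "z %:Cx" := (real_complex R z) (at level 2, format "z %:Cx").
Implicit Types (x : S2) (m : int).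

(** The factor (sin theta)^|m| exp(i m phi) of a harmonic of order m, which is a
    polynomial in the Cartesian coordinates: a power of x + i y or of its
    conjugate. *)
Definition zpow m x : R[i] :=
  if 0 <= m then (x.1.1 +i* x.1.2)%C ^+ `|m|%N else (x.1.1 -i* x.1.2)%C ^+ `|m|%N.

Lemma zpowN_conj m x : (zpow m x)^* = zpow (- m) x.
Proof.
have [->|m0] := eqVneq m 0; first by rewrite oppr0 /zpow lexx !expr0 rmorph1.
rewrite /zpow abszN oppr_ge0; case: (ltrP m 0) => hm.
  rewrite (ltW hm) rmorphXn/=; congr (_ ^+ _).
  by apply: complex_eqP; rewrite ?complex_Re_conj ?complex_Im_conj//= opprK.
by rewrite leNgt lt_neqAle eq_sym m0 hm/= rmorphXn.
Qed.

Lemma zpow0 x : zpow 0 x = 1.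
Proof. by rewrite /zpow lexx. Qed.

Let wpoly : {poly R} := 1 - 'X ^+ 2.

Lemma sphere_conjM x : sphere x ->
  (x.1.1 +i* x.1.2)%C * (x.1.1 -i* x.1.2)%C = (wpoly.[x.2])%:Cx.
Proof.
rewrite /sphere /= => h; rewrite /wpoly !hornerE -h.
by apply: complex_eqP; rewrite ?complex_ReM ?complex_ImM/=; ring.
Qed.

Lemma size_wpoly_exp n : (size (wpoly ^+ n) <= n.*2.+1)%N.
Proof.
have s : (size wpoly <= 3)%N.
  by rewrite (leq_trans (size_polyD _ _))// size_polyN size_polyXn size_poly1.
apply: leq_trans (size_poly_exp_leq _ _) _.
by rewrite ltnS -muln2 mulnC leq_mul2l; apply/orP; right; move: s; case: size.
Qed.

(** On the sphere (x + i y) (x - i y) = 1 - z^2, so factors of opposite signs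
    cancel into a polynomial in z. The bound on its size is what makes the
    degrees of harmonics add under multiplication. *)
Lemma zpowM m m' : exists r : {poly R},
  (size r + `|(m + m')%R|%N <= `|m|%N + `|m'|%N + 1)%N /\
  forall x, sphere x -> zpow m x * zpow m' x = zpow (m + m') x * r.[x.2]%:Cx.
Proof.
have pm (a b : nat) : exists r : {poly R},
    (size r + `|(a%:Z - b%:Z)%R|%N <= a + b + 1)%N /\
    forall x, sphere x -> (x.1.1 +i* x.1.2)%C ^+ a * (x.1.1 -i* x.1.2)%C ^+ b =
      zpow (a%:Z - b%:Z) x * r.[x.2]%:Cx.
  have [ab|ba] := leqP a b.
    exists (wpoly ^+ a); split; first by have := size_wpoly_exp a; lia.
    move=> x xS; rewrite horner_exp rmorphXn/= -sphere_conjM// exprMn.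
    rewrite -{1}(subnKC ab) exprD mulrA mulrC; congr (_ * _); rewrite /zpow.
    have [h|h] := lerP 0 (a%:Z - b%:Z).
      have -> : b = a by lia.
      by rewrite subnn subrr !expr0.
    by congr (_ ^+ _); lia.
  exists (wpoly ^+ b); split; first by have := size_wpoly_exp b; lia.
  move=> x xS; rewrite horner_exp rmorphXn/= -sphere_conjM// exprMn.
  rewrite -{1}(subnK (ltnW ba)) exprD -mulrA; congr (_ * _); rewrite /zpow ifT; last lia.
  by congr (_ ^+ _); lia.
rewrite {1 2}/zpow; case: (lerP 0 m) => hm; case: (lerP 0 m') => hm'.
- exists 1; rewrite size_poly1; split; first by lia.
  move=> x _; rewrite hornerC rmorph1 mulr1 /zpow ifT; last lia.
  by rewrite -exprD; congr (_ ^+ _); lia.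
- have [r [sr hr]] := pm `|m|%N `|m'|%N.
  have e : (`|m|%N%:Z - `|m'|%N%:Z) = m + m' by lia.
  by exists r; rewrite -e; split => // x xS; rewrite hr.
- have [r [sr hr]] := pm `|m'|%N `|m|%N.
  have e : (`|m'|%N%:Z - `|m|%N%:Z) = m + m' by lia.
  exists r; rewrite -e; split; first by rewrite (addnC `|m|%N).
  by move=> x xS; rewrite mulrC hr.
- exists 1; rewrite size_poly1; split; first by lia.
  move=> x _; rewrite hornerC rmorph1 mulr1 /zpow ifF; last lia.
  by rewrite -exprD; congr (_ ^+ _); lia.
Qed.

Lemma zpow_conjM m x : sphere x ->
  zpow m x * zpow (- m) x = ((wpoly ^+ `|m|%N).[x.2])%:Cx.
Proof.
move=> xS; rewrite -zpowN_conj /zpow horner_exp rmorphXn/= -sphere_conjM// exprMn.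
have e : ((x.1.1 +i* x.1.2)%C)^* = (x.1.1 -i* x.1.2)%C by [].
have e' : ((x.1.1 -i* x.1.2)%C)^* = (x.1.1 +i* x.1.2)%C.
  by rewrite -e conjCK.
by case: ifPn => _; rewrite rmorphXn/= ?e ?e'// mulrC.
Qed.

Lemma expiD (s t : R) : expi (s + t) = expi s * expi t.
Proof.
by apply: complex_eqP; rewrite ?complex_ReM ?complex_ImM/= ?cosD ?sinD; ring.
Qed.

Lemma expiMn n (t : R) : expi (n%:R * t) = expi t ^+ n.
Proof.
elim: n => [|n ih]; last by rewrite exprS -ih -expiD -nat1r mulrDl mul1r.
by rewrite expr0 mul0r; apply: complex_eqP; rewrite /= ?cos0 ?sin0.
Qed.

Lemma sphere_z_bound x : sphere x -> -1 <= x.2 <= 1.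
Proof.
rewrite /sphere/= => h; rewrite -ler_norml -(@ler_pXn2r _ 2)// ?nnegrE//.
rewrite real_normK ?num_real// expr1n -h lerDr addr_ge0 ?sqr_ge0//.
Qed.

Lemma cos_colatitude x : sphere x -> cos (colatitude x) = x.2.
Proof. by move=> xS; rewrite acosK// in_itv/= sphere_z_bound. Qed.

(** The two branches of the longitude recover the sign of the second coordinate;
    at the poles the left-hand factor is zero, whatever the longitude. *)
Lemma sqrt_expi_longitude x : sphere x ->
  (Num.sqrt (1 - x.2 ^+ 2))%:Cx * expi (longitude x) = (x.1.1 +i* x.1.2)%C.
Proof.
move=> xS; have -> : 1 - x.2 ^+ 2 = x.1.1 ^+ 2 + x.1.2 ^+ 2.
  by rewrite -xS; ring.
set a := x.1.1; set b := x.1.2; set s := Num.sqrt _.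
have ab0 : 0 <= a ^+ 2 + b ^+ 2 by rewrite addr_ge0 ?sqr_ge0.
have s2 : s ^+ 2 = a ^+ 2 + b ^+ 2 by rewrite sqr_sqrtr.
have [s0|s0] := eqVneq s 0.
  move: s2; rewrite s0 mul0r expr0n/= => /esym/eqP.
  by rewrite paddr_eq0 ?sqr_ge0// !sqrf_eq0 => /andP[/eqP -> /eqP ->].
have sp : 0 < s by rewrite lt_neqAle eq_sym s0 sqrtr_ge0.
have c1 : -1 <= a / s <= 1.
  rewrite -ler_norml normrM normfV (gtr0_norm sp) ler_pdivrMr// mul1r.
  by rewrite -(@ler_pXn2r _ 2)// ?nnegrE ?(ltW sp)// real_normK ?num_real// s2 lerDl sqr_ge0.
have cosc : cos (acos (a / s)) = a / s by rewrite acosK// in_itv.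
have sinc : sin (acos (a / s)) = `|b| / s.
  rewrite sin_acos//; apply/(pexpIrn (n := 2)) => //.
  - by rewrite nnegrE sqrtr_ge0.
  - by rewrite nnegrE divr_ge0// ltW.
  rewrite sqr_sqrtr; last by move: c1 => /andP[]; nra.
  rewrite !exprMn exprVn real_normK ?num_real//.
  have -> : b ^+ 2 = s ^+ 2 - a ^+ 2 by rewrite s2; ring.
  by field.
have [b0|b0] := lerP 0 b.
  rewrite /longitude -/a -/b -/s b0; apply: complex_eqP; rewrite ?complex_ReM ?complex_ImM/=.
    by rewrite cosc mul0r subr0 mulrC divfK.
  by rewrite sinc mul0r addr0 ger0_norm// mulrC divfK.
rewrite /longitude -/a -/b -/s leNgt b0/=.
have c2 : cos (pi *+ 2 - acos (a / s)) = a / s.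
  by rewrite cosB cos2pi sin2pi mul1r mul0r addr0.
have s2' : sin (pi *+ 2 - acos (a / s)) = b / s.
  by rewrite sinB cos2pi sin2pi mul1r mul0r sub0r sinc ltr0_norm// mulNr opprK.
apply: complex_eqP; rewrite ?complex_ReM ?complex_ImM/=.
  by rewrite c2 mul0r subr0 mulrC divfK.
by rewrite s2' mul0r addr0 mulrC divfK.
Qed.

Definition ynorm (l : nat) m : R :=
  (if 0 <= m then (-1) ^+ `|m|%N else 1) *
  Num.sqrt ((2 * l + 1)%N%:R / (4 * pi) * ((l - `|m|)`!%:R / (l + `|m|)`!%:R)).

Definition ypoly (l : nat) m : {poly R} := (legendre R l)^`(`|m|%N).

(** The cosines and sines of the definition disappear; the Condon-Shortley sign
    cancels out for negative orders and is part of [ynorm] otherwise. *)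
Lemma Ylm_zpow l m x : sphere x ->
  Ylm l m x = (ynorm l m)%:Cx * (zpow m x * (ypoly l m).[x.2]%:Cx).
Proof.
move=> xS.
have nat_case n : Ylm_nat l n x =
    ((-1) ^+ n * Num.sqrt ((2 * l + 1)%N%:R / (4 * pi) * ((l - n)`!%:R / (l + n)`!%:R)))%:Cx *
    ((x.1.1 +i* x.1.2)%C ^+ n * ((legendre R l)^`(n)).[x.2]%:Cx).
  rewrite /Ylm_nat /assoc_legendre cos_colatitude// expiMn -(sqrt_expi_longitude xS).
  by rewrite exprMn !rmorphM/= !rmorphXn/=; ring.
rewrite /Ylm /ynorm /zpow /ypoly; case: (lerP 0 m) => hm; first by rewrite nat_case.
rewrite nat_case !rmorphM/= !rmorphXn/= !conj_real mul1r.
rewrite (_ : ((x.1.1 +i* x.1.2)%C)^* = (x.1.1 -i* x.1.2)%C)//.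
rewrite (_ : (-1)%:Cx = -1); last by rewrite rmorphN rmorph1.
by rewrite -!mulrA signrMK.
Qed.

End harmonics_on_sphere.

(** * Integrals of elementary harmonics *)

Section sphere_integrals.
Variable R : realType.
Local Notation S2 := (R * R * R)%type.
Local Notation sigma := (@surface_measure R).
Local Notation "z %:Cx" := (real_complex R z) (at level 2, format "z %:Cx").
Implicit Types (x : S2) (p : {poly R}) (m : int).

Lemma integral_derivative (f F : R -> R) (a b : R) : a < b ->
  (forall t, is_derive t (1:R) F (f t)) -> continuous f ->
  (\int[@lebesgue_measure R]_(t in `[a, b]) (f t)%:E = (F b)%:E - (F a)%:E)%E.
Proof.
move=> ab dF cf; apply: continuous_FTC2 => //.
- exact: continuous_subspaceT.
- have cF t : {for t, continuous F}.
    by apply/differentiable_continuous/derivable1_diffP; have [] := dF t.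
  split.
  + by move=> t _; have [] := dF t.
  + by apply: cvg_at_right_filter; exact: cF.
  + by apply: cvg_at_left_filter; exact: cF.
- by move=> t _; rewrite derive1E; have [_ ->] := dF t.
Qed.

Let pi2_gt0 : 0 < pi *+ 2 :> R.
Proof. by rewrite mulr2n addr_gt0 ?pi_gt0. Qed.

Lemma expi_2piMn n : expi (n%:R * (pi *+ 2)) = 1 :> R[i].
Proof.
rewrite expiMn (_ : expi (pi *+ 2) = 1) ?expr1n//.
by rewrite /expi cos2pi sin2pi.
Qed.

Lemma continuous_trig n (a b : R) :
  continuous (fun u : R => a * cos (n%:R * u) + b * sin (n%:R * u)).
Proof.
have cn : continuous (fun u : R => n%:R * u).
  by move=> t; apply: cvgM; [exact: cvg_cst|exact: cvg_id].
move=> t; apply: cvgD; apply: cvgM; try exact: cvg_cst.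
  by apply: continuous_comp; [exact: cn|exact: continuous_cos].
by apply: continuous_comp; [exact: cn|exact: continuous_sin].
Qed.

Lemma circle_integral n (a b : R) : (0 < n)%N ->
  (\int[@lebesgue_measure R]_(u in `[0%R, (pi *+ 2)%R[)
     (a * cos (n%:R * u) + b * sin (n%:R * u))%:E = 0)%E.
Proof.
move=> n0; have n0' : n%:R != 0 :> R by rewrite pnatr_eq0 -lt0n.
have d t : is_derive t (1:R)
    (fun u => a / n%:R * sin (n%:R * u) - b / n%:R * cos (n%:R * u))
    (a * cos (n%:R * t) + b * sin (n%:R * t)).
  by apply: trigger_derive; rewrite /GRing.scale/=; field.
have ct := @continuous_trig n a b.
rewrite integral_itv_bndo_bndc; last first.
  apply/measurable_EFinP; apply: measurable_funTS.
  exact: continuous_measurable_fun.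
rewrite (integral_derivative _ d ct) ?pi2_gt0//.
have [-> ->] : cos (n%:R * (pi *+ 2)) = 1 :> R /\ sin (n%:R * (pi *+ 2)) = 0 :> R.
  by have [-> ->] := expi_2piMn n.
by rewrite !mulr0 sin0 cos0 !mulr0 subee.
Qed.

Lemma bounded_sq_integrable (f : S2 -> R[i]) (M : R) : cmeasurable sphere f ->
  (forall x, sphere x -> sqmod (f x) <= M) -> sq_integrable sigma sphere f.
Proof.
move=> mf fM; apply: (le_sq_integrable _ mf (k := cst M)) => //.
exact: finite_measure_integrable_cst.
Qed.

Lemma sq_integrable_cst (c : R[i]) : sq_integrable sigma sphere (fun=> c).
Proof. by apply: (@bounded_sq_integrable _ (sqmod c)) => //; exact: cmeasurable_cst. Qed.

Lemma sq_integrable_cintegrable (f : S2 -> R[i]) :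
  sq_integrable sigma sphere f -> cintegrable sigma sphere f.
Proof.
move=> fi; apply: (@eq_cintegrable _ _ _ _ _ _ (fun x => f x * 1)) => //.
  by move=> x _; rewrite mulr1.
by apply: sq_integrableM => //; exact: sq_integrable_cst.
Qed.

Lemma cmeasurable_zpow m : cmeasurable sphere (@zpow R m).
Proof.
have h (s : R) n : cmeasurable sphere (fun x => (x.1.1 +i* (s * x.1.2))%C ^+ n).
  elim: n => [|n ih].
    by apply: (eq_cmeasurable _ (cmeasurable_cst _ 1)) => x _; rewrite expr0.
  apply: (@eq_cmeasurable _ _ _ _ (fun x => (x.1.1 +i* (s * x.1.2))%C *
    (x.1.1 +i* (s * x.1.2))%C ^+ n)); first by move=> x _; rewrite exprS.
  apply: cmeasurableM => //; split => /=.
    by apply: measurable_funTS; exact: measurableT_comp.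
  by apply: measurable_funM => //; apply: measurable_funTS; exact: measurableT_comp.
have [hm|hm] := lerP 0 m.
  apply: (eq_cmeasurable _ (h 1 `|m|%N)) => x _.
  by rewrite /zpow hm mul1r.
apply: (eq_cmeasurable _ (h (-1) `|m|%N)) => x _.
by rewrite /zpow leNgt hm mulN1r.
Qed.

Lemma sqmodX (z : R[i]) n : sqmod (z ^+ n) = sqmod z ^+ n.
Proof.
elim: n => [|n ih]; last by rewrite !exprS sqmodM ih.
by rewrite !expr0 (sqmod_real 1) expr1n.
Qed.

Lemma sqmod_zpow_le1 m x : sphere x -> sqmod (zpow m x) <= 1.
Proof.
rewrite /sphere/= => xS.
have h : x.1.1 ^+ 2 + x.1.2 ^+ 2 <= 1 by rewrite -xS lerDl sqr_ge0.
have h0 : 0 <= x.1.1 ^+ 2 + x.1.2 ^+ 2 by rewrite addr_ge0 ?sqr_ge0.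
by rewrite /zpow; case: ifP => _; rewrite sqmodX /sqmod/= ?sqrrN exprn_ile1.
Qed.

(** On the sphere these functions are closed under products and conjugation; the
    spherical harmonics are the multiples of those for which p is a derivative
    of a Legendre polynomial. *)
Definition zharm m p x : R[i] := zpow m x * p.[x.2]%:Cx.

Lemma cmeasurable_zharm m p : cmeasurable sphere (zharm m p).
Proof.
apply: cmeasurableM; first exact: cmeasurable_zpow.
split; last exact: measurable_cst.
apply: measurable_funTS => /=; apply: (measurableT_comp (f := fun t : R => p.[t])) => //.
by apply: continuous_measurable_fun; exact: continuous_horner.
Qed.

Lemma zharm_bounded m p : exists M, forall x, sphere x -> sqmod (zharm m p x) <= M.
Proof.
exists ((\sum_(i < size p) `|p`_i|) ^+ 2) => x xS.
rewrite sqmodM -[leRHS]mul1r ler_pM// ?sqmod_zpow_le1// sqmod_real.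
rewrite -real_normK ?num_real// ler_pXn2r// ?nnegrE ?sumr_ge0//.
rewrite horner_coef; apply: le_trans (ler_norm_sum _ _ _) _.
apply: ler_sum => i _; rewrite normrM ler_piMr// normrX exprn_ile1//.
by rewrite ler_norml; exact: sphere_z_bound.
Qed.

Lemma sq_integrable_zharm m p : sq_integrable sigma sphere (zharm m p).
Proof.
have [M hM] := zharm_bounded m p.
by apply: bounded_sq_integrable hM; exact: cmeasurable_zharm.
Qed.

Lemma zpow_polar m (t u : R) : zpow m (polar (t, u)) =
  (sin t ^+ `|m|)%:Cx * (cos (`|m|%N%:R * u) +i*
     (if 0 <= m then sin (`|m|%N%:R * u) else - sin (`|m|%N%:R * u)))%C.
Proof.
have e : (sin t * cos u +i* (sin t * sin u))%C = (sin t)%:Cx * expi u.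
  by apply: complex_eqP; rewrite ?complex_ReM ?complex_ImM/=; ring.
rewrite /zpow /=; case: ifP => _; first by rewrite e exprMn -expiMn -rmorphXn.
have -> : (sin t * cos u -i* (sin t * sin u))%C = ((sin t)%:Cx * expi u)^*.
  by rewrite -e.
by rewrite -rmorphXn/= exprMn -expiMn -rmorphXn/= rmorphM/= conj_real.
Qed.

Lemma zharm0 p x : zharm 0 p x = p.[x.2]%:Cx.
Proof. by rewrite /zharm zpow0 mul1r. Qed.

Lemma Re_zharm_polar m p (t u : R) : complex.Re (zharm m p (polar (t, u))) =
  sin t ^+ `|m| * p.[cos t] * cos (`|m|%N%:R * u).
Proof. by rewrite /zharm zpow_polar /= !mul0r !mulr0 !subr0 mulrAC. Qed.

Lemma Im_zharm_polar m p (t u : R) : complex.Im (zharm m p (polar (t, u))) =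
  sin t ^+ `|m| * p.[cos t] * (if 0 <= m then 1 else -1) * sin (`|m|%N%:R * u).
Proof.
by rewrite /zharm zpow_polar /= !mul0r !mulr0 !add0r !addr0; case: ifP => _; ring.
Qed.

(** The integral over each parallel is that of a trigonometric monomial of
    nonzero frequency over a period. *)
Lemma cintegral_zharm m p : m != 0 -> cintegral sigma sphere (zharm m p) = 0.
Proof.
move=> m0; have n0 : (0 < `|m|)%N by rewrite absz_gt0.
have [i1 i2] := sq_integrable_cintegrable (sq_integrable_zharm m p).
apply: complex_eqP; rewrite /= /Rintegral surface_integral//.
  rewrite (eq_integral (cst 0%E)) ?integral0// => t _.
  rewrite -[RHS](circle_integral (sin t ^+ `|m| * p.[cos t] * sin t) 0 n0).
  by apply: eq_integral => u _; rewrite Re_zharm_polar mulrAC mul0r addr0.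
rewrite (eq_integral (cst 0%E)) ?integral0// => t _.
rewrite -[RHS](circle_integral 0 (sin t ^+ `|m| * p.[cos t] *
  (if 0 <= m then 1 else -1) * sin t) n0).
by apply: eq_integral => u _; rewrite Im_zharm_polar mulrAC mul0r add0r.
Qed.

(** The substitution z = cos theta: an antiderivative of p(cos t) sin t is
    - P(cos t) for P a primitive of p. *)
Lemma cintegral_zharm0 p :
  cintegral sigma sphere (zharm 0 p) = (pi *+ 2 * poly_integral p)%:Cx.
Proof.
have [i1 i2] := sq_integrable_cintegrable (sq_integrable_zharm 0 p).
apply: complex_eqP; last first.
  rewrite /= /Rintegral (eq_integral (cst 0%E)) ?integral0//.
  by move=> x _ /=; rewrite mulr0 mul0r addr0.
rewrite -[LHS]/(fine (\int[sigma]_(x in sphere) (complex.Re (zharm 0 p x))%:E)).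
rewrite surface_integral//.
pose q := - primitive p.
pose f t : R := pi *+ 2 * (p.[cos t] * sin t).
have -> : (\int[@lebesgue_measure R]_(t in `[0%R, pi])
     \int[@lebesgue_measure R]_(u in `[0%R, (pi *+ 2)%R[)
        (complex.Re (zharm 0 p (polar (t, u))) * sin t)%:E =
  \int[@lebesgue_measure R]_(t in `[0%R, pi]) (f t)%:E)%E.
  apply: eq_integral => t _.
  rewrite (eq_integral (cst (p.[cos t] * sin t)%:E)); last first.
    by move=> u _; rewrite zharm0.
  rewrite integral_cst//= lebesgue_measure_itv/= lte_fin pmulrn_lgt0 ?pi_gt0//.
  by rewrite sube0 -EFinM mulrC.
have d t : is_derive t (1:R) (fun s => pi *+ 2 * q.[cos s]) (f t).
  have h := is_derive1_comp (is_derive_poly q (cos t)) (is_derive_cos t).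
  have -> : (fun s : R => pi *+ 2 * q.[cos s]) = (pi *+ 2) *: (horner q \o cos) by [].
  apply: trigger_derive; rewrite /f /q /GRing.scale/=.
  by rewrite derivN deriv_primitive hornerN mulrNN.
have cf : continuous f.
  move=> t; apply: cvgM; first exact: cvg_cst.
  apply: cvgM; last exact: continuous_sin.
  by apply: continuous_comp; [exact: continuous_cos|exact: continuous_horner].
rewrite (integral_derivative _ d cf) ?pi_gt0//=.
rewrite cospi cos0 -mulrBr -[in RHS](deriv_primitive p) poly_integral_deriv.
by rewrite /q !hornerN opprK addrC.
Qed.

End sphere_integrals.

(** * Orthonormality and products of spherical harmonics *)

Section spherical_harmonics.
Variable R : realType.
Local Notation S2 := (R * R * R)%type.
Local Notation sigma := (@surface_measure R).
Local Notation "z %:Cx" := (real_complex R z) (at level 2, format "z %:Cx").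
Implicit Types (x : S2) (p r : {poly R}) (m : int) (f g : S2 -> R[i]).

Lemma mem_mrange (l : nat) m : (m \in mrange l) = (`|m| <= l)%N.
Proof.
apply/mapP/idP => [[j]|h].
  by rewrite mem_iota => hj ->; move: hj; lia.
by exists `|(m + l%:Z)%R|%N; rewrite ?mem_iota; lia.
Qed.

Lemma mrange_uniq (l : nat) : uniq (mrange l).
Proof. by rewrite map_inj_uniq ?iota_uniq// => i j; lia. Qed.

(** The pairs are listed by increasing l, so that sums over these lists are the
    partial sums of the series in l. *)
Definition lm_seq (N : nat) : seq (nat * int) :=
  [seq (l, m) | l <- iota 0 N, m <- mrange l].

Lemma mem_lm_seq N (k : nat * int) :
  (k \in lm_seq N) = (k.1 < N)%N && (`|k.2| <= k.1)%N.
Proof.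
case: k => l m; apply/allpairsPdep/idP => /= [[l' [m' [hl hm [-> ->]]]]|/andP[h1 h2]].
  by move: hl hm; rewrite mem_iota mem_mrange add0n => /andP[_ ->].
by exists l, m; rewrite mem_iota mem_mrange.
Qed.

Lemma lm_seq_uniq N : uniq (lm_seq N).
Proof.
apply: allpairs_uniq_dep; [exact: iota_uniq| by move=> l _; exact: mrange_uniq|].
by move=> [a b] [c e] _ _ /= [-> ->].
Qed.

Lemma sum_lm_seq (V : zmodType) N (F : nat -> int -> V) :
  \sum_(k <- lm_seq N) F k.1 k.2 = \sum_(0 <= l < N) \sum_(m <- mrange l) F l m.
Proof.
by rewrite /lm_seq big_allpairs_dep/= /index_iota subn0.
Qed.

Definition Yk (k : nat * int) : S2 -> R[i] := Ylm k.1 k.2.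

Lemma Ylm_zharm l m x : sphere x ->
  Ylm l m x = (ynorm R l m)%:Cx * zharm m (ypoly R l m) x.
Proof. exact: Ylm_zpow. Qed.

Lemma zharm_conj m p x : (zharm m p x)^* = zharm (- m) p x.
Proof. by rewrite /zharm conjM zpowN_conj conj_real. Qed.

Lemma cmeasurable_Ylm l m : cmeasurable sphere (@Ylm R l m).
Proof.
apply: (@eq_cmeasurable _ _ _ _
    (fun x => (ynorm R l m)%:Cx * zharm m (ypoly R l m) x)).
  by move=> x /[!inE] xS; rewrite Ylm_zharm.
by apply: cmeasurableM; [exact: cmeasurable_cst|exact: cmeasurable_zharm].
Qed.

Lemma Ylm_bounded l m : exists M : R, forall x, sphere x -> sqmod (Ylm l m x) <= M.
Proof.
have [M hM] := zharm_bounded m (ypoly R l m).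
exists (sqmod (ynorm R l m)%:Cx * M) => x xS.
by rewrite Ylm_zharm// sqmodM ler_wpM2l// hM.
Qed.

Lemma sq_integrable_Ylm l m : sq_integrable sigma sphere (@Ylm R l m).
Proof.
have [M hM] := Ylm_bounded l m.
by apply: bounded_sq_integrable hM; exact: cmeasurable_Ylm.
Qed.

Lemma ynorm_sq l m : ynorm R l m ^+ 2 =
  (2 * l + 1)%N%:R / (4 * pi) * ((l - `|m|)`!%:R / (l + `|m|)`!%:R).
Proof.
rewrite /ynorm exprMn sqr_sqrtr; last first.
  by rewrite mulr_ge0// divr_ge0// mulr_ge0// pi_ge0.
by case: ifP => _; rewrite ?expr1n ?mul1r// sqrr_sign mul1r.
Qed.

(** For different orders the product has nonzero order and integral zero; for
    equal orders it is a polynomial in z, whose integral is that of a product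
    of associated Legendre functions. *)
Lemma Ylm_orthonormal l m l' m' : (`|m| <= l)%N -> (`|m'| <= l')%N ->
  ip sigma sphere (Ylm l m) (Ylm l' m') = ((l == l') && (m == m'))%:R.
Proof.
move=> ml ml'.
have -> : ip sigma sphere (Ylm l m) (Ylm l' m') =
  (ynorm R l m * ynorm R l' m')%:Cx * cintegral sigma sphere
    (fun x => zharm m (ypoly R l m) x * zharm (- m') (ypoly R l' m') x).
  rewrite -cintegralZ//; last by apply: sq_integrableM => //; exact: sq_integrable_zharm.
  apply: eq_cintegral => x /[!inE] xS.
  rewrite !Ylm_zharm// conjM conj_real zharm_conj.
  by move: (ynorm R l m) (ynorm R l' m') => a a'; rewrite rmorphM/=; ring.
have [mm|mm] := eqVneq m m'; last first.
  have [r [_ hr]] := zpowM R m (- m').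
  rewrite andbF.
  rewrite (@eq_cintegral _ _ _ _ _ _ (zharm (m - m') (r * (ypoly R l m * ypoly R l' m')))).
    by rewrite cintegral_zharm ?mulr0// subr_eq0.
  move=> x /[!inE] xS; rewrite /zharm mulrACA hr// !hornerM !rmorphM/=; ring.
rewrite -{m'}mm in ml' *; rewrite andbT.
rewrite (@eq_cintegral _ _ _ _ _ _ (zharm 0
    ((1 - 'X ^+ 2) ^+ `|m|%N * (ypoly R l m * ypoly R l' m)))); last first.
  move=> x /[!inE] xS; rewrite /zharm mulrACA zpow_conjM// zpow0 !hornerM !rmorphM/=.
  by rewrite mul1r.
rewrite cintegral_zharm0 -rmorphM/=.
rewrite /ypoly; have [->|ll] := eqVneq l l'.
  rewrite assoc_legendre_orthogonal// eqxx -expr2 ynorm_sq/=.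
  have h1 : (2 * l' + 1)%:R != 0 :> R by rewrite pnatr_eq0 addn1.
  have h2 : (l' - `|m|)`!%:R != 0 :> R by rewrite pnatr_eq0 -lt0n fact_gt0.
  have h3 : (l' + `|m|)`!%:R != 0 :> R by rewrite pnatr_eq0 -lt0n fact_gt0.
  have h4 : pi != 0 :> R by rewrite gt_eqF// pi_gt0.
  rewrite -[RHS](rmorph1 (real_complex R)); congr (_%:Cx).
  move: (_%:R : R) (_`!%:R : R) (_`!%:R : R) (pi : R) h1 h2 h3 h4 => a c e k h1 h2 h3 h4.
  by field; rewrite h1 h2 h3 h4.
have [l'l|ll'] := leqP l' l.
  by rewrite assoc_legendre_orthogonal// (negbTE ll) !mulr0.
rewrite (mulrC (derivn _ (legendre R l))) assoc_legendre_orthogonal ?(ltnW ll')//.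
by rewrite (gtn_eqF ll') !mulr0.
Qed.

Definition in_span (N : nat) f := exists c : nat * int -> R[i],
  forall x, sphere x -> f x = \sum_(k <- lm_seq N) c k * Yk k x.

Lemma eq_in_span N f g : (forall x, sphere x -> f x = g x) ->
  in_span N f -> in_span N g.
Proof. by move=> fg [c hc]; exists c => x xS; rewrite -fg// hc. Qed.

Lemma in_span0 N : in_span N (fun=> 0).
Proof. by exists (fun=> 0) => x _; rewrite big1// => k _; rewrite mul0r. Qed.

Lemma in_spanD N f g : in_span N f -> in_span N g -> in_span N (fun x => f x + g x).
Proof.
move=> [c hc] [e he]; exists (fun k => c k + e k) => x xS.
by rewrite hc// he// -big_split/=; apply: eq_bigr => k _; rewrite mulrDl.
Qed.

Lemma in_spanZ N (a : R[i]) f : in_span N f -> in_span N (fun x => a * f x).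
Proof.
move=> [c hc]; exists (fun k => a * c k) => x xS.
by rewrite hc// big_distrr/=; apply: eq_bigr => k _; rewrite mulrA.
Qed.

Lemma in_span_sum N (I : eqType) (s : seq I) (F : I -> S2 -> R[i]) :
  (forall i, i \in s -> in_span N (F i)) -> in_span N (fun x => \sum_(i <- s) F i x).
Proof.
elim: s => [|i s ih] hF.
  by apply: eq_in_span (in_span0 N) => x _; rewrite big_nil.
apply: (@eq_in_span _ (fun x => F i x + \sum_(j <- s) F j x)).
  by move=> x _; rewrite big_cons.
apply: in_spanD; first by apply: hF; rewrite mem_head.
by apply: ih => j js; apply: hF; rewrite inE js orbT.
Qed.

Lemma in_span_Yk N k : k \in lm_seq N -> in_span N (Yk k).
Proof.
move=> kN; exists (fun j => (j == k)%:R) => x xS.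
rewrite (bigD1_seq k)//= ?lm_seq_uniq// eqxx mul1r big1 ?addr0// => j /negbTE ->.
by rewrite mul0r.
Qed.

Lemma in_spanW N M f : (N <= M)%N -> in_span N f -> in_span M f.
Proof.
move=> NM [c hc].
apply: (@eq_in_span _ (fun x => \sum_(k <- lm_seq N) c k * Yk k x)).
  by move=> x xS; rewrite hc.
apply: in_span_sum => k; rewrite mem_lm_seq => /andP[h1 h2]; apply: in_spanZ.
by apply: in_span_Yk; rewrite mem_lm_seq h2 (leq_trans h1).
Qed.

Lemma ynorm_neq0 l m : ynorm R l m != 0.
Proof.
rewrite -sqrf_eq0 ynorm_sq mulf_neq0// mulf_neq0 ?invr_eq0 ?pnatr_eq0 ?addn1 -?lt0n ?fact_gt0//.
by rewrite mulf_neq0 ?pnatr_eq0// gt_eqF// pi_gt0.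
Qed.

(** The polynomial p is a combination of m-th derivatives of Legendre
    polynomials, each of which makes one harmonic of order m. *)
Lemma in_span_zharm N m p : (size p + `|m| <= N)%N -> in_span N (zharm m p).
Proof.
move=> /legendre_derivn_span[c hc].
apply: (@eq_in_span _ (fun x => \sum_(l <- index_iota `|m|%N N)
    ((c l / ynorm R l m)%:Cx * Yk (l, m) x))).
  move=> x xS; rewrite hc /zharm horner_sum rmorph_sum/= big_distrr/=.
  apply: eq_bigr => l _; rewrite /Yk/= Ylm_zharm// hornerZ mulrA -rmorphM.
  by rewrite divfK ?ynorm_neq0// rmorphM/= /zharm /ypoly mulrCA.
apply: in_span_sum => l; rewrite mem_index_iota => /andP[h1 h2]; apply: in_spanZ.
by apply: in_span_Yk; rewrite mem_lm_seq/= h2.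
Qed.

(** Degrees add: the extra polynomial produced by [zpowM] accounts exactly for
    the loss of order. *)
Lemma zharmM_in_span (a b : nat) m p m' p' :
  (size p + `|m| <= a.+1)%N -> (size p' + `|m'| <= b.+1)%N ->
  in_span (a + b).+1 (fun x => zharm m p x * zharm m' p' x).
Proof.
move=> hp hp'.
have [->|p0] := eqVneq p 0.
  apply: eq_in_span (in_span0 _) => x _.
  by rewrite /zharm horner0 rmorph0 mulr0 mul0r.
have [->|p'0] := eqVneq p' 0.
  apply: eq_in_span (in_span0 _) => x _.
  by rewrite /zharm horner0 rmorph0 !mulr0.
have [r [sr hr]] := zpowM R m m'.
apply: (@eq_in_span _ (zharm (m + m') (r * (p * p')))).
  by move=> x xS; rewrite /zharm mulrACA hr// !hornerM !rmorphM/=; ring.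
apply: in_span_zharm.
have s1 := size_polyMleq p p'; have s2 := size_polyMleq r (p * p').
move: p0 p'0; rewrite -!size_poly_gt0 => p0 p'0.
move: (size p) (size p') (size (p * p')) (size (r * (p * p'))) (size r) hp hp' sr s1 s2 p0 p'0.
lia.
Qed.

Lemma size_ypoly l m : (`|m| <= l)%N -> (size (ypoly R l m) + `|m| <= l.+1)%N.
Proof.
move=> ml; have := leq_trans (size_derivn_le `|m|%N _) (leq_sub2r `|m|%N (size_legendre R l)).
rewrite -/(ypoly R l m); move: (size _); lia.
Qed.

Lemma YkM_in_span (k j : nat * int) : (`|k.2| <= k.1)%N -> (`|j.2| <= j.1)%N ->
  in_span (k.1 + j.1).+1 (fun x => Yk k x * Yk j x).
Proof.
move=> hk hj.
apply: (@eq_in_span _ (fun x => ((ynorm R k.1 k.2)%:Cx * (ynorm R j.1 j.2)%:Cx) *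
   (zharm k.2 (ypoly R k.1 k.2) x * zharm j.2 (ypoly R j.1 j.2) x))).
  by move=> x xS; rewrite /Yk !Ylm_zharm//; ring.
by apply: in_spanZ; apply: zharmM_in_span; exact: size_ypoly.
Qed.

Lemma Yk_conjM_in_span (k j : nat * int) : (`|k.2| <= k.1)%N -> (`|j.2| <= j.1)%N ->
  in_span (k.1 + j.1).+1 (fun x => Yk k x * (Yk j x)^*).
Proof.
move=> hk hj.
apply: (@eq_in_span _ (fun x => ((ynorm R k.1 k.2)%:Cx * (ynorm R j.1 j.2)%:Cx) *
   (zharm k.2 (ypoly R k.1 k.2) x * zharm (- j.2) (ypoly R j.1 j.2) x))).
  by move=> x xS; rewrite /Yk !Ylm_zharm// conjM zharm_conj conj_real; ring.
apply: in_spanZ; apply: zharmM_in_span; first exact: size_ypoly.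
by rewrite abszN; exact: size_ypoly.
Qed.

Lemma in_spanM N M f g : in_span N f -> in_span M g ->
  in_span (N + M) (fun x => f x * g x).
Proof.
move=> [c hc] [e he].
apply: (@eq_in_span _ (fun x => \sum_(k <- lm_seq N) \sum_(j <- lm_seq M)
    (c k * e j) * (Yk k x * Yk j x))).
  move=> x xS; rewrite hc// he// big_distrl/=; apply: eq_bigr => k _.
  by rewrite big_distrr/=; apply: eq_bigr => j _; ring.
apply: in_span_sum => k; rewrite mem_lm_seq => /andP[k1 k2].
apply: in_span_sum => j; rewrite mem_lm_seq => /andP[j1 j2].
apply: in_spanZ; apply: in_spanW (YkM_in_span k2 j2).
by move: k1 j1; lia.
Qed.

Lemma in_span_cst (a : R[i]) : in_span 1 (fun=> a).
Proof.
apply: (@eq_in_span _ (fun x => a * zharm 0 1 x)).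
  by move=> x _; rewrite zharm0 hornerC mulr1.
by apply: in_spanZ; apply: in_span_zharm; rewrite size_poly1.
Qed.

Lemma in_span_coord3 : in_span 2 (fun x => x.2%:Cx).
Proof.
apply: (@eq_in_span _ (zharm 0 'X)); first by move=> x _; rewrite zharm0 hornerX.
by apply: in_span_zharm; rewrite size_polyX.
Qed.

Let in_span_zpow1 (s : bool) : in_span 2 (@zpow R ((-1) ^+ s)).
Proof.
apply: (@eq_in_span _ (zharm ((-1) ^+ s) 1)).
  by move=> x _; rewrite /zharm hornerC rmorph1 mulr1.
by apply: in_span_zharm; rewrite size_poly1; case: s.
Qed.

Lemma in_span_coord1 : in_span 2 (fun x => x.1.1%:Cx).
Proof.
apply: (@eq_in_span _ (fun x => 2^-1 * (zpow 1 x + zpow (-1) x))).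
  move=> x _; rewrite /zpow/= !expr1.
  apply: (@mulfI _ 2); first by rewrite pnatr_eq0.
  rewrite mulrA mulfV ?pnatr_eq0// mul1r.
  by apply: complex_eqP; rewrite ?(complex_ReM, complex_ImM) ?complex_ReD ?complex_ImD/=; ring.
by apply: in_spanZ; apply: in_spanD; [exact: (in_span_zpow1 false)|exact: (in_span_zpow1 true)].
Qed.

Lemma in_span_coord2 : in_span 2 (fun x => x.1.2%:Cx).
Proof.
apply: (@eq_in_span _ (fun x => (2 * 'i%C)^-1 * (zpow 1 x + (-1) * zpow (-1) x))).
  move=> x _; rewrite /zpow/= !expr1.
  have i0 : 2 * 'i%C != 0 :> R[i].
    by rewrite mulf_neq0 ?pnatr_eq0//; apply/eqP => -[] /eqP; rewrite oner_eq0.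
  apply: (mulfI i0); rewrite mulrA mulfV// mul1r.
  apply: complex_eqP; rewrite ?(complex_ReM, complex_ImM) ?complex_ReD ?complex_ImD/=;
    by rewrite ?(complex_ReM, complex_ImM)/=; ring.
apply: in_spanZ; apply: in_spanD; first exact: (in_span_zpow1 false).
by apply: in_spanZ; exact: (in_span_zpow1 true).
Qed.

Lemma sq_integrable_in_span N f : in_span N f -> sq_integrable sigma sphere f.
Proof.
move=> [c hc].
apply: (@eq_sq_integrable _ _ _ _ _ _ (fun x => \sum_(k <- lm_seq N) c k * Yk k x)) => //.
  by move=> x /[!inE] xS; rewrite hc.
apply: sq_integrable_sum => // k _; apply: sq_integrableZ => //.
exact: sq_integrable_Ylm.
Qed.

Lemma in_span_bounded N f : in_span N f ->
  exists M : R, forall x, sphere x -> sqmod (f x) <= M.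
Proof.
move=> [c hc].
suff [M hM] : exists M : R, forall x, sphere x ->
    sqmod (\sum_(k <- lm_seq N) c k * Yk k x) <= M.
  by exists M => x xS; rewrite hc// hM.
elim: (lm_seq N) => [|k s [M hM]].
  by exists 0 => x _; rewrite big_nil sqmod0.
have [K hK] := Ylm_bounded k.1 k.2.
exists (2 * (sqmod (c k) * K) + 2 * M) => x xS; rewrite big_cons.
apply: le_trans (sqmodD _ _) _; rewrite lerD// ler_wpM2l// ?hM//.
by rewrite sqmodM ler_wpM2l// hK.
Qed.

(** By orthonormality the coefficients of the combination are inner products. *)
Lemma in_span_coef N f x : in_span N f -> sphere x ->
  f x = \sum_(k <- lm_seq N) ip sigma sphere f (Yk k) * Yk k x.
Proof.
move=> [c hc] xS; rewrite hc//; apply: eq_big_seq => k kN; congr (_ * _).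
rewrite (@eq_ip _ _ _ _ _ f (fun x => \sum_(j <- lm_seq N) c j * Yk j x) _ (Yk k))//; last first.
  by move=> y /[!inE] yS; rewrite hc.
rewrite ip_suml//; last 2 first.
  by move=> j _; exact: sq_integrable_Ylm.
  exact: sq_integrable_Ylm.
rewrite (bigD1_seq k)//= ?lm_seq_uniq// big_seq_cond big1 ?addr0.
  move: kN; rewrite mem_lm_seq => /andP[_ kk].
  by rewrite Ylm_orthonormal// !eqxx mulr1.
move=> j /andP[jN jk]; move: kN jN; rewrite !mem_lm_seq => /andP[_ kk] /andP[_ jj].
rewrite Ylm_orthonormal// -xpair_eqE -!surjective_pairing (negbTE jk) mulr0//.
Qed.

End spherical_harmonics.

(** * Completeness of the spherical harmonics *)

Section completeness.
Variable R : realType.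
Local Notation S2 := (R * R * R)%type.
Local Notation sigma := (@surface_measure R).
Local Notation "z %:Cx" := (real_complex R z) (at level 2, format "z %:Cx").
Local Notation sqi := (sq_integrable sigma sphere).
Local Notation N2 := (nrm2 sigma sphere).
Implicit Types (f g : S2 -> R[i]) (u v : S2 -> R).

Definition approximable f := forall e : R, 0 < e ->
  exists N h, in_span N h /\ N2 (fun x => f x - h x) <= e.

Lemma approximable_span N f : in_span N f -> approximable f.
Proof.
move=> fN e e0; exists N, f; split => //.
rewrite (@eq_nrm2 _ _ _ _ _ _ (fun=> 0)) ?(ltW e0)//; last by move=> x _; rewrite subrr.
by rewrite /nrm2 /Rintegral; under eq_integral do rewrite sqmod0;
  rewrite integral0/= ltW.
Qed.

Lemma eq_approximable f g : (forall x, sphere x -> f x = g x) ->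
  approximable f -> approximable g.
Proof.
move=> fg fa e e0; have [N [h [hN hh]]] := fa e e0; exists N, h; split => //.
by rewrite (@eq_nrm2 _ _ _ _ _ _ (fun x => f x - h x))// => x /[!inE] xS; rewrite fg.
Qed.

Lemma approximable_closed f : sqi f ->
  (forall e : R, 0 < e -> exists g, [/\ sqi g, approximable g & N2 (fun x => f x - g x) <= e]) ->
  approximable f.
Proof.
move=> hf H e e0; have e4 : 0 < e / 4 by rewrite divr_gt0.
have [g [hg ga fg]] := H _ e4; have [N [h [hN gh]]] := ga _ e4.
exists N, h; split => //; have hh := sq_integrable_in_span hN.
rewrite (@eq_nrm2 _ _ _ _ _ _ (fun x => (f x - g x) + (g x - h x))); last first.
  by move=> x _; ring.
apply: le_trans (nrm2D _ _ _) _ => //; try exact: sq_integrableB.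
by lra.
Qed.

Lemma approximableD f g : sqi f -> sqi g -> approximable f -> approximable g ->
  approximable (fun x => f x + g x).
Proof.
move=> hf hg fa ga e e0; have e4 : 0 < e / 4 by rewrite divr_gt0.
have [N [h [hN fh]]] := fa _ e4; have [M [k [kM gk]]] := ga _ e4.
exists (maxn N M), (fun x => h x + k x); split.
  by apply: in_spanD; [apply: in_spanW hN|apply: in_spanW kM];
    rewrite ?leq_maxl ?leq_maxr.
have hh := sq_integrable_in_span hN; have hk := sq_integrable_in_span kM.
rewrite (@eq_nrm2 _ _ _ _ _ _ (fun x => (f x - h x) + (g x - k x))); last first.
  by move=> x _; ring.
apply: le_trans (nrm2D _ _ _) _ => //; try exact: sq_integrableB.
by lra.
Qed.

(** An element of the span is bounded, and the span is closed under products. *)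
Lemma approximableM_span N f h : sqi f -> approximable f -> in_span N h ->
  approximable (fun x => h x * f x).
Proof.
move=> hf fa hN e e0.
have [M hM] := in_span_bounded hN; have hh := sq_integrable_in_span hN.
have e' : 0 < e / (`|M| + 1) by rewrite divr_gt0// ltr_wpDl.
have [K [k [kK fk]]] := fa _ e'; have hk := sq_integrable_in_span kK.
exists (N + K)%N, (fun x => h x * k x); split; first exact: in_spanM.
rewrite (@eq_nrm2 _ _ _ _ _ _ (fun x => (f x - k x) * h x)); last first.
  by move=> x _; ring.
have hfk : sqi (fun x => f x - k x) by exact: sq_integrableB.
have M1 : 0 < `|M| + 1 by rewrite ltr_wpDl.
apply: (@le_trans _ _ ((`|M| + 1) * N2 (fun x => f x - k x))); last first.
  by rewrite mulrC -ler_pdivlMr.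
rewrite -RintegralZl//; last exact: sq_integrable_sqmod.
apply: le_Rintegral => //.
- apply: sq_integrable_sqmod => //; apply: (sq_integrableMb _ hfk _ hM) => //.
  exact: (sq_integrable_meas hh).
- apply: (@integrableZl _ _ _ _ _ _ (`|M| + 1) (EFin \o (fun x => sqmod (f x - k x)))) => //.
  exact: sq_integrable_sqmod.
- move=> x xS; rewrite sqmodM mulrC ler_wpM2r//.
  by apply: le_trans (hM _ xS) _; rewrite (le_trans (ler_norm _))// lerDl.
Qed.

Lemma approximableZ f (a : R[i]) : sqi f -> approximable f ->
  approximable (fun x => a * f x).
Proof. by move=> hf fa; exact: approximableM_span (in_span_cst a). Qed.

Lemma approximable_sum (I : eqType) (s : seq I) (F : I -> S2 -> R[i]) :
  (forall i, i \in s -> sqi (F i)) -> (forall i, i \in s -> approximable (F i)) ->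
  approximable (fun x => \sum_(i <- s) F i x).
Proof.
elim: s => [|i s ih] hF Fa.
  apply: (@eq_approximable (fun=> 0)); first by move=> x _; rewrite big_nil.
  exact: approximable_span (in_span0 R 0).
apply: (@eq_approximable (fun x => F i x + \sum_(j <- s) F j x)).
  by move=> x _; rewrite big_cons.
apply: approximableD; [by apply: hF; rewrite mem_head| |by apply: Fa; rewrite mem_head|].
  by apply: sq_integrable_sum => // j js; apply: hF; rewrite inE js orbT.
by apply: ih => j js; [apply: hF|apply: Fa]; rewrite inE js orbT.
Qed.

(** First replace f by an element of the span, which costs little since g is
    bounded; then the previous lemma applies to g. *)
Lemma approximableM f g (M : R) : sqi f -> sqi g ->
  (forall x, sphere x -> sqmod (g x) <= M) ->
  approximable f -> approximable g -> approximable (fun x => f x * g x).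
Proof.
move=> hf hg gM fa ga; apply: approximable_closed.
  by apply: (sq_integrableMb _ hf _ gM) => //; exact: (sq_integrable_meas hg).
move=> e e0; have M1 : 0 < `|M| + 1 by rewrite ltr_wpDl.
have e' : 0 < e / (`|M| + 1) by rewrite divr_gt0.
have [N [h [hN fh]]] := fa _ e'; have hh := sq_integrable_in_span hN.
exists (fun x => h x * g x); split.
- by apply: (sq_integrableMb _ hh _ gM) => //; exact: (sq_integrable_meas hg).
- exact: approximableM_span hN.
rewrite (@eq_nrm2 _ _ _ _ _ _ (fun x => (f x - h x) * g x)); last first.
  by move=> x _; ring.
have hfk : sqi (fun x => f x - h x) by exact: sq_integrableB.
apply: (@le_trans _ _ ((`|M| + 1) * N2 (fun x => f x - h x))); last first.
  by rewrite mulrC -ler_pdivlMr.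
rewrite -RintegralZl//; last exact: sq_integrable_sqmod.
apply: le_Rintegral => //.
- apply: sq_integrable_sqmod => //; apply: (sq_integrableMb _ hfk _ gM) => //.
  exact: (sq_integrable_meas hg).
- apply: (@integrableZl _ _ _ _ _ _ (`|M| + 1) (EFin \o (fun x => sqmod (f x - h x)))) => //.
  exact: sq_integrable_sqmod.
- move=> x xS; rewrite sqmodM mulrC ler_wpM2r//.
  by apply: le_trans (gM _ xS) _; rewrite (le_trans (ler_norm _))// lerDl.
Qed.

Lemma cmeasurable_real u : measurable_fun sphere u ->
  cmeasurable sphere (fun x => (u x)%:Cx).
Proof. by move=> mu; split => //; exact: measurable_cst. Qed.

(** Dominated convergence makes pointwise limits L^2 limits. The domination is on
    squares so that the lemma also covers the increasing limits of simple
    functions below. *)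
Lemma dominated_approximable u (un : nat -> S2 -> R) (k : S2 -> R) :
  measurable_fun sphere u -> (forall n, measurable_fun sphere (un n)) ->
  sigma.-integrable sphere (EFin \o k) ->
  (forall n x, sphere x -> un n x ^+ 2 <= k x) ->
  (forall x, sphere x -> un n x @[n --> \oo] --> u x) ->
  (forall n, approximable (fun x => (un n x)%:Cx)) ->
  sqi (fun x => (u x)%:Cx) /\ approximable (fun x => (u x)%:Cx).
Proof.
move=> mu mun ki unk cun una.
have hun n : sqi (fun x => (un n x)%:Cx).
  apply: (le_sq_integrable _ _ ki) => //; first exact: (cmeasurable_real (mun n)).
  by move=> x xS; rewrite sqmod_real unk.
have uk x : sphere x -> u x ^+ 2 <= k x.
  move=> xS; have c : un n x ^+ 2 @[n --> \oo] --> u x ^+ 2.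
    by apply: cvgM; exact: cun.
  rewrite -(cvg_lim _ c)//; apply: limr_le; first by apply/cvg_ex; eexists; exact: c.
  by near=> n; exact: unk.
have hu : sqi (fun x => (u x)%:Cx).
  apply: (le_sq_integrable (@measurable_sphere R) (cmeasurable_real mu) ki).
  by move=> x xS; rewrite sqmod_real uk.
split => //; apply: approximable_closed => // e e0.
pose F n x : \bar R := ((u x - un n x) ^+ 2)%:E.
have mF n : measurable_fun sphere (F n).
  by apply/measurable_EFinP; apply: measurable_funX; exact: measurable_funB.
have k4 : sigma.-integrable sphere (fun x => 4%:E * (k x)%:E)%E.
  exact: (@integrableZl _ _ _ _ _ _ 4 (EFin \o k)).
have cF x : sphere x -> F n x @[n --> \oo] --> cst 0%E x.
  move=> xS; apply: cvg_EFin; first by near=> n.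
  rewrite /comp/= (_ : (0 : R) = (u x - u x) ^+ 2); last by rewrite subrr expr0n.
  by apply: cvgM; apply: cvgB; [exact: cvg_cst|exact: cun|exact: cvg_cst|exact: cun].
have bF x n : sphere x -> (`|F n x| <= 4%:E * (k x)%:E)%E.
  move=> xS; rewrite /F abse_EFin -EFinM lee_fin ger0_norm ?sqr_ge0//.
  have := uk x xS; have := unk n x xS; have := sqr_ge0 (u x + un n x) => h1 h2 h3; nra.
have [_ _ H] := dominated_convergence (@measurable_sphere R) mF (measurable_cst _)
  (aeW _ cF) k4 (aeW _ bF).
rewrite integral0 in H.
have {}H : fine (\int[sigma]_(x in sphere) F n x)%E @[n --> \oo] --> (0 : R).
  exact: fine_cvg H.
have /cvgrPdist_le/(_ e e0)[n _ /(_ n (leqnn n))] := H.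
rewrite sub0r normrN => hn.
exists (fun x => (un n x)%:Cx); split => //.
apply: le_trans hn; apply: le_trans (ler_norm _).
rewrite le_eqVlt; apply/orP; left; apply/eqP; apply: eq_Rintegral => x _.
by rewrite -rmorphB sqmod_real.
Unshelve. all: try end_near.
Qed.

(** Bounded approximable functions form an algebra closed under bounded
    pointwise limits, so the sets with approximable indicator form a
    sigma-algebra. *)
Definition good u := [/\ measurable_fun sphere u,
  exists M : R, forall x, sphere x -> `|u x| <= M &
  approximable (fun x => (u x)%:Cx)].

Let good_bound u (M : R) : (forall x, sphere x -> `|u x| <= M) ->
  forall x, sphere x -> sqmod (u x)%:Cx <= M ^+ 2.
Proof.
move=> uM x xS; rewrite sqmod_real -real_normK ?num_real//.
by rewrite ler_pXn2r ?nnegrE// ?uM// (le_trans _ (uM _ xS)).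
Qed.

Lemma good_sqi u : good u -> sqi (fun x => (u x)%:Cx).
Proof.
move=> [mu [M uM] _]; apply: bounded_sq_integrable (good_bound uM).
exact: cmeasurable_real.
Qed.

Lemma eq_good u v : (forall x, sphere x -> u x = v x) -> good u -> good v.
Proof.
move=> uv [mu [M uM] ua]; split.
- by apply: eq_measurable_fun mu => x /[!inE]; exact: uv.
- by exists M => x xS; rewrite -uv// uM.
- by apply: eq_approximable ua => x xS; rewrite uv.
Qed.

Lemma good_span N u : measurable_fun sphere u -> in_span N (fun x => (u x)%:Cx) -> good u.
Proof.
move=> mu uN; split => //; last exact: approximable_span uN.
have [M hM] := in_span_bounded uN; exists (Num.sqrt M) => x xS.
by have := hM _ xS; rewrite sqmod_real => h; rewrite -sqrtr_sqr ler_wsqrtr.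
Qed.

Lemma good_cst (a : R) : good (fun=> a).
Proof. by apply: (good_span (N := 1)) => //; exact: in_span_cst. Qed.

Lemma goodD u v : good u -> good v -> good (fun x => u x + v x).
Proof.
move=> gu gv; have [mu [M uM] ua] := gu; have [mv [K vK] va] := gv; split.
- exact: measurable_funD.
- by exists (M + K) => x xS; rewrite (le_trans (ler_normD _ _))// lerD ?uM ?vK.
- apply: (@eq_approximable (fun x => (u x)%:Cx + (v x)%:Cx)).
    by move=> x _; rewrite rmorphD.
  by apply: approximableD => //; exact: good_sqi.
Qed.

Lemma goodM u v : good u -> good v -> good (fun x => u x * v x).
Proof.
move=> gu gv; have [mu [M uM] ua] := gu; have [mv [K vK] va] := gv; split.
- exact: measurable_funM.
- by exists (M * K) => x xS; rewrite normrM ler_pM ?uM ?vK.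
- apply: (@eq_approximable (fun x => (u x)%:Cx * (v x)%:Cx)).
    by move=> x _; rewrite rmorphM.
  by apply: approximableM (good_bound vK) _ _ => //; exact: good_sqi.
Qed.

Lemma good_cvg u (un : nat -> S2 -> R) (M : R) : (forall n, good (un n)) ->
  (forall n x, sphere x -> `|un n x| <= M) ->
  (forall x, sphere x -> un n x @[n --> \oo] --> u x) -> good u.
Proof.
move=> gun unM cun.
have mun n : measurable_fun sphere (un n) by have [] := gun n.
have mu : measurable_fun sphere u by exact: (measurable_fun_cvg mun cun).
have [hu ua] : sqi (fun x => (u x)%:Cx) /\ approximable (fun x => (u x)%:Cx).
  apply: (dominated_approximable (k := cst (M ^+ 2)) mu mun _ _ cun).
  - exact: finite_measure_integrable_cst.
  - by move=> n x xS; rewrite -sqmod_real (good_bound (unM n)).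
  - by move=> n; have [] := gun n.
split => //; exists M => x xS.
have c : `|un n x| @[n --> \oo] --> `|u x| by apply: cvg_norm; exact: cun.
rewrite -(cvg_lim _ c)//; apply: limr_le; first by apply/cvg_ex; eexists; exact: c.
by near=> n; exact: unM.
Unshelve. all: try end_near.
Qed.

(** The polynomial 3 t^2 - 2 t^3 fixes 0, 1/2 and 1; its iterates push the
    numbers of [0,1/2[ to 0 and those of ]1/2,1] to 1. Applied to a good function
    they give, in the limit, its superlevel set at 1/2 up to the level set. *)
Let step (t : R) : R := 3 * t ^+ 2 - 2 * t ^+ 3.

Let step_iter_itv n (t : R) : 0 <= t <= 1 -> 0 <= iter n step t <= 1.
Proof.
move=> t01; elim: n => //= n; move: (iter n step t) => s /andP[s0 s1].
rewrite /step; apply/andP; split.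
  rewrite (_ : _ - _ = s ^+ 2 * (3 - 2 * s)); last by ring.
  by rewrite mulr_ge0 ?sqr_ge0//; lra.
rewrite -subr_ge0 (_ : _ - _ = (1 - s) ^+ 2 * (1 + 2 * s)); last by ring.
by rewrite mulr_ge0 ?sqr_ge0//; lra.
Qed.

Let step_iter_low (t : R) : 0 <= t < 2^-1 -> iter n step t @[n --> \oo] --> (0 : R).
Proof.
move=> /andP[t0 t1]; pose c := t * (3 - 2 * t).
have c0 : 0 <= c by rewrite /c; nra.
have c1 : c < 1 by rewrite /c; nra.
have key n : 0 <= iter n step t <= t * c ^+ n.
  elim: n => [|n /andP[h0 h1]]; first by rewrite mulr1 t0 lexx.
  rewrite [iter _ _ _]/= exprS; move: (iter n step t) h0 h1 => s h0 h1.
  have cn1 : c ^+ n <= 1 by rewrite exprn_ile1// ltW.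
  have st : s <= t by apply: le_trans h1 _; rewrite ler_piMr.
  have -> : step s = s * (s * (3 - 2 * s)) by rewrite /step; ring.
  apply/andP; split; first by rewrite mulr_ge0// mulr_ge0//; lra.
  apply: (@le_trans _ _ (s * c)); last by rewrite [leRHS]mulrCA [leRHS]mulrC ler_wpM2r.
  by rewrite ler_wpM2l// /c; nra.
apply: (@squeeze_cvgr _ _ _ _ (fun=> 0) (fun n => t * c ^+ n)).
- by near=> n.
- exact: cvg_cst.
- rewrite -[X in _ --> X](mulr0 t); apply: cvgM; first exact: cvg_cst.
  by apply: cvg_expr; rewrite ger0_norm.
Unshelve. all: try end_near.
Qed.

(** The symmetry about 1/2 reduces the upper half to the lower one. *)
Let step_symm n (t : R) : iter n step (1 - t) = 1 - iter n step t.
Proof. by elim: n => //= n ->; rewrite /step; ring. Qed.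

Let step_half n : iter n step 2^-1 = 2^-1.
Proof. by elim: n => //= n ->; rewrite /step; field. Qed.

(** The limit h of the iterates takes the values 0, 1/2 and 1, the middle one on
    the level set of 1/2; the quadratic polynomial h - 2 h (1 - h) sends 1/2
    to 0 and fixes 0 and 1. *)
Lemma good_superlevel_half u : good u -> (forall x, sphere x -> 0 <= u x <= 1) ->
  good (fun x => (2^-1 < u x)%R%:R).
Proof.
move=> gu u01.
pose h x : R := if u x < 2^-1 then 0 else if u x == 2^-1 then 2^-1 else 1.
have gh : good h.
  apply: (@good_cvg h (fun n x => iter n step (u x)) 1).
  - elim=> [|n ih] //=; rewrite /step.
    apply: (@eq_good (fun x => (3 * iter n step (u x)) * iter n step (u x) +
       ((-2) * (iter n step (u x) * iter n step (u x))) * iter n step (u x))).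
      by move=> x _; ring.
    have g3 (a : R) v : good v -> good (fun x => a * v x) by exact: goodM (good_cst a).
    apply: goodD; first by apply: goodM => //; exact: g3.
    by apply: goodM => //; apply: g3; exact: goodM.
  - move=> n x xS; have /andP[h0 h1] := step_iter_itv n (u01 x xS).
    by rewrite ger0_norm.
  - move=> x xS; have /andP[h0 h1] := u01 x xS.
    rewrite /h; case: ltgtP => [lt|gt|->].
    + by apply: step_iter_low; rewrite h0.
    + have -> : (fun n => iter n step (u x)) = (fun n => 1 - iter n step (1 - u x)).
        by apply/funext => n; rewrite step_symm; ring.
      rewrite -[X in _ --> X]subr0; apply: cvgB; first exact: cvg_cst.
      by apply: step_iter_low; apply/andP; split; lra.
    + by under eq_fun do rewrite step_half; exact: cvg_cst.
apply: (@eq_good (fun x => h x + ((-2) * h x) * (1 + (-1) * h x))).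
  move=> x _; rewrite /h; case: ltgtP => _ /=; [ring|ring|by field].
have g3 (a : R) v : good v -> good (fun x => a * v x) by exact: goodM (good_cst a).
apply: goodD => //; apply: goodM; first exact: g3.
by apply: goodD; [exact: good_cst|exact: g3].
Qed.

(** An affine change of variable sends a bounded function into [0,1] and the level
    a to 1/2. *)
Lemma good_superlevel u (a : R) : good u -> good (\1_[set x | a < u x]).
Proof.
move=> gu; have [_ [M uM] _] := gu.
pose K := 2 * (`|M| + `|a| + 1).
have K0 : 0 < K by rewrite /K mulr_gt0// ltr_wpDl// addr_ge0.
pose v x := 2^-1 + K^-1 * (u x + (- a)).
have gv : good v.
  apply: goodD; first exact: good_cst.
  by apply: goodM; [exact: good_cst|apply: goodD => //; exact: good_cst].
have v01 x : sphere x -> 0 <= v x <= 1.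
  move=> xS; have hu : `|u x - a| <= K / 2.
    rewrite (le_trans (ler_normB _ _))// /K mulrC mulKf//.
    have := uM x xS; have := ler_norm M; lra.
  have : `|K^-1 * (u x - a)| <= 2^-1.
    by rewrite normrM normfV (gtr0_norm K0) mulrC ler_pdivrMr// mulrC.
  by rewrite ler_norml /v => /andP[h1 h2]; apply/andP; split; lra.
apply: eq_good (good_superlevel_half gv v01) => x _.
rewrite indicE /v ltrDl pmulr_rgt0 ?invr_gt0// subr_gt0.
by congr (nat_of_bool _)%:R; apply/idP/idP; rewrite inE.
Qed.

Definition good_set (A : set S2) := good (\1_A).

Lemma good_setC A : good_set A -> good_set (~` A).
Proof.
move=> gA; apply: (@eq_good (fun x => 1 + (-1) * \1_A x)).
  by move=> x _; rewrite !indicE in_setC; case: (x \in A) => /=; ring.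
by apply: goodD; [exact: good_cst|apply: goodM => //; exact: good_cst].
Qed.

Lemma good_setI A B : good_set A -> good_set B -> good_set (A `&` B).
Proof.
move=> gA gB; apply: eq_good (goodM gA gB) => x _.
by rewrite !indicE in_setI; case: (x \in A); case: (x \in B); rewrite ?mulr1 ?mulr0.
Qed.

(** The complement of a countable union is the decreasing limit of the finite
    intersections of the complements. *)
Lemma good_set_sigma_algebra : sigma_algebra setT good_set.
Proof.
have g0 : good_set set0.
  by apply: eq_good (good_cst 0) => x _; rewrite indicE in_set0.
split => //; first by move=> A gA; rewrite setTD; exact: good_setC.
move=> A gA.
pose B n := \big[setI/setT]_(i < n) ~` A i.
have gB n : good_set (B n).
  rewrite /B; elim: n => [|n ih].
    by rewrite big_ord0 -setC0; exact: good_setC.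
  by rewrite big_ord_recr/=; apply: good_setI => //; exact: good_setC.
have -> : \bigcup_k A k = ~` \bigcap_n B n.
  rewrite setC_bigcap; apply/seteqP; split => x.
    move=> [k _ Ax]; exists k.+1 => // Bx.
    by move: Bx; rewrite /B big_ord_recr/= => -[_]; exact.
  move=> [n _ Bx]; apply: contrapT => nA; apply: Bx; rewrite /B.
  elim: n => [|n ih]; first by rewrite big_ord0.
  by rewrite big_ord_recr/=; split => // Anx; apply: nA; exists n.
apply: good_setC.
apply: (@good_cvg _ (fun n => \1_(B n)) 1 gB).
  by move=> n x _; rewrite indicE; case: (_ \in _); rewrite /= ?normr0 ?normr1.
move=> x _; rewrite indicE; case: (asboolP ((\bigcap_n B n) x)) => h.
  rewrite mem_set//=; have -> : (fun n => \1_(B n) x) = (fun=> 1 : R).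
    by apply/funext => n; rewrite indicE mem_set//; exact: h.
  exact: cvg_cst.
rewrite memNset//=; have [n nB] : exists n, ~ B n x.
  by apply: contrapT => H; apply: h => n _; apply: contrapT => K; apply: H; exists n.
apply: cvg_near_cst; exists n => // m /= nm.
rewrite indicE memNset// => Bm; apply: nB; move: Bm.
rewrite /B -(subnKC nm); move: (m - n)%N => k.
elim: k => [|k ih]; first by rewrite addn0.
by rewrite addnS big_ord_recr/= => -[/ih].
Qed.

(** The coordinates are in the span, so their superlevel sets are good: the
    identity is measurable from the sigma-algebra of good sets to the Borel
    one. *)
Lemma good_measurable A : measurable A -> good_set A.
Proof.
move=> mA; pose U := g_sigma_algebraType good_set.
have mU (B : set U) : measurable B -> good_set B.
  by move=> mB; have := sigma_algebra_id good_set_sigma_algebra => <-.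
have Um (B : set U) : good_set B -> measurable B by exact: sub_sigma_algebra.
have coord (u : S2 -> R) : good u -> measurable_fun [set: U] u.
  move=> gu; apply: (measurability _ (RGenOInfty.measurableE R)) => // _ [_ [a ->] <-].
  apply: Um; rewrite setTI (_ : _ @^-1` _ = [set x | a < u x]).
    exact: good_superlevel.
  by apply/seteqP; split => x /=; rewrite in_itv/= andbT.
have mc1 : measurable_fun sphere (fun x : S2 => x.1.1).
  by apply: measurable_funTS; exact: measurableT_comp.
have mc2 : measurable_fun sphere (fun x : S2 => x.1.2).
  by apply: measurable_funTS; exact: measurableT_comp.
have mc3 : measurable_fun sphere (fun x : S2 => x.2).
  by apply: measurable_funTS; exact: measurable_snd.
have mid : measurable_fun [set: U] (fun x : U => ((x.1.1, x.1.2), x.2) : S2).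
  apply: measurable_fun_pair; first apply: measurable_fun_pair; apply: coord.
  - exact: good_span mc1 (in_span_coord1 R).
  - exact: good_span mc2 (in_span_coord2 R).
  - exact: good_span mc3 (in_span_coord3 R).
have := mid measurableT A mA; rewrite setTI => /mU.
by rewrite (_ : _ @^-1` A = A)//; apply/seteqP; split => -[[a b] c].
Qed.

Import HBNNSimple.

(** The simple functions increasing to u are finite combinations of indicators,
    dominated by u. *)
Lemma approximable_ge0 u : measurable_fun sphere u -> (forall x, sphere x -> 0 <= u x) ->
  sqi (fun x => (u x)%:Cx) -> approximable (fun x => (u x)%:Cx).
Proof.
move=> mu u0 hu.
pose k x := u x ^+ 2.
have ki : sigma.-integrable sphere (EFin \o k).
  have := sq_integrable_sqmod hu.
  by apply: eq_integrable => // x _ /=; rewrite sqmod_real.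
have mue : measurable_fun sphere (EFin \o u) by exact/measurable_EFinP.
pose h := nnsfun_approx (@measurable_sphere R) mue.
have u0e x : sphere x -> (0 <= (EFin \o u) x)%E by move=> /u0; rewrite lee_fin.
have hcvg x : sphere x -> h n x @[n --> \oo] --> u x.
  move=> xS; have := cvg_nnsfun_approx (@measurable_sphere R) mue u0e xS.
  by move/fine_cvg.
have hle n x : sphere x -> h n x <= u x.
  move=> xS; rewrite -(cvg_lim _ (hcvg x xS))//.
  apply: nondecreasing_cvgn_le; last by apply/cvg_ex; eexists; exact: hcvg.
  by move=> a b ab; exact/lefP/nd_nnsfun_approx.
have mh n : measurable_fun sphere (h n) by exact: measurable_funTS.
have hk n x : sphere x -> h n x ^+ 2 <= k x.
  by move=> xS; rewrite /k ler_pXn2r ?nnegrE ?hle// u0.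
suff ha n : approximable (fun x => (h n x)%:Cx).
  by have [] := dominated_approximable mu mh ki hk hcvg ha.
apply: (@eq_approximable (fun x => \sum_(y <- finmap.enum_fset (fset_set (range (h n))))
    y%:Cx * (\1_(h n @^-1` [set y]) x)%:Cx)).
  move=> x _; rewrite [in RHS]fimfunE fsbig_finite//= rmorph_sum.
  by apply: eq_bigr => y _; rewrite rmorphM.
have g y : good (\1_(h n @^-1` [set y])) by apply: good_measurable.
apply: approximable_sum => y _.
  by apply: sq_integrableZ => //; exact: good_sqi.
by apply: approximableZ; [exact: good_sqi|have [] := g y].
Qed.

(** The real and imaginary parts, and their positive and negative parts, reduce
    the claim to nonnegative functions. *)
Theorem harmonics_complete f : sqi f -> approximable f.
Proof.
move=> hf; have [m1 m2 _] := hf.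
have real_case u : measurable_fun sphere u -> sqi (fun x => (u x)%:Cx) ->
    approximable (fun x => (u x)%:Cx).
  move=> mu hu.
  have part v : measurable_fun sphere v -> (forall x, 0 <= v x <= `|u x|) ->
      sqi (fun x => (v x)%:Cx) /\ approximable (fun x => (v x)%:Cx).
    move=> mv vu.
    have hv : sqi (fun x => (v x)%:Cx).
      apply: (le_sq_integrable (@measurable_sphere R) (cmeasurable_real mv)
        (sq_integrable_sqmod hu)) => x _ /=.
      rewrite !sqmod_real -(real_normK (num_real (u x))).
      by have /andP[v0 vx] := vu x; rewrite ler_pXn2r ?nnegrE.
    by split => //; apply: approximable_ge0 => // x _; have /andP[] := vu x.
  pose up x := Num.max (u x) 0; pose un x := Num.max (- u x) 0.
  have upb x : 0 <= up x <= `|u x|.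
    by rewrite /up le_max lexx orbT ge_max ler_norm normr_ge0.
  have unb x : 0 <= un x <= `|u x|.
    by rewrite /un le_max lexx orbT ge_max -normrN ler_norm normr_ge0.
  have [hp ap] := part up (measurable_maxr mu (measurable_cst _)) upb.
  have [hn an] := part un (measurable_maxr (measurable_funN mu) (measurable_cst _)) unb.
  apply: (@eq_approximable (fun x => (up x)%:Cx + (-1) * (un x)%:Cx)).
    move=> x _; rewrite mulN1r -rmorphB /up /un; congr _%:Cx.
    by rewrite !maxEle; case: lerP => h1; case: lerP => h2; lra.
  apply: approximableD => //; first exact: sq_integrableZ.
  exact: approximableZ.
have dom u : measurable_fun sphere u -> (forall x, sphere x -> u x ^+ 2 <= sqmod (f x)) ->
    sqi (fun x => (u x)%:Cx).
  move=> mu uf; apply: (le_sq_integrable (@measurable_sphere R) (cmeasurable_real mu)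
    (sq_integrable_sqmod hf)) => x xS.
  by rewrite sqmod_real uf.
have h1 : sqi (fun x => (complex.Re (f x))%:Cx).
  by apply: dom => // x _; rewrite lerDl sqr_ge0.
have h2 : sqi (fun x => (complex.Im (f x))%:Cx).
  by apply: dom => // x _; rewrite lerDr sqr_ge0.
apply: (@eq_approximable (fun x => (complex.Re (f x))%:Cx + 'i%C * (complex.Im (f x))%:Cx)).
  by move=> x _; rewrite -complexE.
apply: approximableD => //; first exact: sq_integrableZ.
  exact: real_case.
by apply: approximableZ => //; exact: real_case.
Qed.

End completeness.

(** * Fourier sums on the sphere *)

Section fourier_sums.
Variable R : realType.
Local Notation S2 := (R * R * R)%type.
Local Notation sigma := (@surface_measure R).
Local Notation sqi := (sq_integrable sigma sphere).
Local Notation N2 := (nrm2 sigma sphere).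
Local Notation ipS := (ip sigma sphere).
Implicit Types (f h : S2 -> R[i]).

Definition fourier_sum n f (x : S2) : R[i] :=
  \sum_(k <- lm_seq n) ipS f (Yk k) * Yk k x.

Lemma sq_integrable_Yk (k : nat * int) : sqi (@Yk R k).
Proof. exact: sq_integrable_Ylm. Qed.

Lemma fourier_sum_in_span n f : in_span n (fourier_sum n f).
Proof. by exists (fun k => ipS f (Yk k)). Qed.

Lemma sq_integrable_fourier_sum n f : sqi (fourier_sum n f).
Proof. exact: sq_integrable_in_span (fourier_sum_in_span n f). Qed.

Lemma ip_fourier_sum n f k : k \in lm_seq n ->
  ipS (fourier_sum n f) (Yk k) = ipS f (Yk k).
Proof.
move=> kn; rewrite /fourier_sum ip_suml//; last 2 first.
- by move=> j _; exact: sq_integrable_Yk.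
- exact: sq_integrable_Yk.
rewrite (bigD1_seq k)//= ?lm_seq_uniq// big_seq_cond big1 ?addr0.
  by move: kn; rewrite mem_lm_seq => /andP[_ kk]; rewrite Ylm_orthonormal// !eqxx mulr1.
move=> j /andP[jn jk]; move: kn jn; rewrite !mem_lm_seq => /andP[_ kk] /andP[_ jj].
by rewrite Ylm_orthonormal// -xpair_eqE -!surjective_pairing (negbTE jk) mulr0.
Qed.

(** Pythagoras: f minus its Fourier sum is orthogonal to the Fourier sum. *)
Lemma bessel n f : sqi f -> N2 (fun x => f x - fourier_sum n f x) <= N2 f.
Proof.
move=> hf; have hn := sq_integrable_fourier_sum n f.
have hr : sqi (fun x => f x - fourier_sum n f x) by exact: sq_integrableB.
set r := (fun x => f x - fourier_sum n f x) in hr *.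
have ort : ipS r (fourier_sum n f) = 0.
  rewrite /fourier_sum ip_sumr//; last by move=> k _; exact: sq_integrable_Yk.
  rewrite big_seq big1// => k kn.
  rewrite /r ipBl//; last exact: sq_integrable_Yk.
  by rewrite ip_fourier_sum// subrr mulr0.
have ort' : ipS (fourier_sum n f) r = 0 by rewrite ipC// ort rmorph0.
have fE x : f x = r x + fourier_sum n f x by rewrite /r subrK.
clearbody r; set s := fourier_sum n f in hn ort ort' fE.
have e : N2 f = N2 r + N2 s.
  apply: (@complexI R); rewrite [RHS]rmorphD/= -!ip_nrm2.
  rewrite (@eq_ip _ _ _ _ _ f (fun x => r x + s x) f (fun x => r x + s x)) => [|x _|x _] //.
  rewrite ipDl//; last exact: sq_integrableD.
  by rewrite !ipDr// ort ort' addr0 add0r.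
by rewrite e lerDl nrm2_ge0.
Qed.

(** A function h of the span is its own Fourier sum of high order, so the error
    for f is the error for f - h, which is at most the norm of f - h. *)
Lemma fourier_sum_cvg f : sqi f ->
  N2 (fun x => f x - fourier_sum n f x) @[n --> \oo] --> (0 : R).
Proof.
move=> hf; apply/cvgrPdist_le => e e0.
have [N [h [hN fh]]] := harmonics_complete hf e0.
exists N => // n /= Nn; rewrite sub0r normrN ger0_norm ?nrm2_ge0//.
apply: le_trans fh; have hh := sq_integrable_in_span hN.
have hg : sqi (fun x => f x - h x) by exact: sq_integrableB.
rewrite (@eq_nrm2 _ _ _ _ _ _
    (fun x => (f x - h x) - fourier_sum n (fun x => f x - h x) x)); last first.
  move=> x /[!inE] xS; rewrite /fourier_sum.
  rewrite (in_span_coef (in_spanW Nn hN) xS) -addrA -opprD; congr (_ - _).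
  rewrite -big_split/=; apply: eq_bigr => k _; rewrite -mulrDl; congr (_ * _).
  rewrite ipBl//; last exact: sq_integrable_Yk.
  by rewrite addrC subrK.
exact: bessel.
Qed.

End fourier_sums.

(** * Measurability of integrals with a parameter *)

Section parametric_integral.
Context d1 d2 (T1 : measurableType d1) (T2 : measurableType d2) (R : realType).
Variables (mu : {sigma_finite_measure set T2 -> \bar R}) (D : set T2).
Hypothesis mD : measurable D.

(** The measurability that Tonelli's theorem provides for positive functions on
    the whole space, extended to signed functions on a measurable set. *)
Lemma measurable_parametric_eintegral (F : T1 * T2 -> R) :
  measurable_fun ([set: T1] `*` D) F ->
  measurable_fun [set: T1] (fun w => \int[mu]_(x in D) (F (w, x))%:E)%E.
Proof.
move=> mF; pose G := (EFin \o F) \_ ([set: T1] `*` D).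
have mTD : measurable ([set: T1] `*` D) by exact: measurableX.
have mG : measurable_fun setT G.
  apply: (measurable_restrictT _ mTD).1; exact/measurable_EFinP.
rewrite (_ : (fun w => _) = fubini_F mu G).
  rewrite (_ : fubini_F mu G = (fubini_F mu G^\+ \- fubini_F mu G^\-)%E).
    apply: emeasurable_funB; apply: measurable_fun_fubini_tonelli_F => //.
      exact: measurable_funepos.
    exact: measurable_funeneg.
  apply/funext => w; rewrite /fubini_F [LHS]integralE.
  congr (_ - _)%E; apply: eq_integral => x _.
    by rewrite !funeposE.
  by rewrite !funenegE.
apply/funext => w /=; rewrite /fubini_F [LHS]integral_mkcond.
apply: eq_integral => x _; rewrite /G !patchE.
congr (if _ then _ else _).
by apply/idP/idP; rewrite !inE/=; [split|case].
Qed.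

Lemma measurable_parametric_integral (F : T1 * T2 -> R) :
  measurable_fun ([set: T1] `*` D) F ->
  measurable_fun [set: T1] (fun w => \int[mu]_(x in D) F (w, x)).
Proof.
move=> mF; apply: (measurableT_comp (fine_measurable measurableT)).
exact: measurable_parametric_eintegral.
Qed.

End parametric_integral.

(** * Rotations *)

Section rotations.
Variable R : realType.
Local Notation S2 := (R * R * R)%type.

Definition north : S2 := (0, 0, 1).

Let o0 : 'I_3 := ord0.
Let o1 : 'I_3 := lift ord0 ord0.
Let o2 : 'I_3 := lift ord0 (lift ord0 ord0).

Let ord3P (i : 'I_3) : [\/ i = o0, i = o1 | i = o2].
Proof.
case: i => [[|[|[|//]]] h]; [apply: Or31|apply: Or32|apply: Or33]; exact/val_inj.
Qed.

(** With z and r the cosine and sine of a colatitude, c and s those of a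
    longitude, the columns are the unit vectors of increasing colatitude and
    longitude at the corresponding point, and that point itself. *)
Let frame (z r c s : R) : 'M[R]_3 := \matrix_(i, j)
  tnth [tuple tnth [tuple z * c; - s; r * c] j;
              tnth [tuple z * s; c; r * s] j;
              tnth [tuple - r; 0; z] j] i.

Let frame_rotation (z r c s : R) : z ^+ 2 + r ^+ 2 = 1 -> c ^+ 2 + s ^+ 2 = 1 ->
  rotation (frame z r c s).
Proof.
move=> zr cs; split.
  apply/matrixP => i j; rewrite !mxE !big_ord_recl big_ord0 !mxE.
  have e1 : z ^+ 2 * (c ^+ 2 + s ^+ 2) + r ^+ 2 = 1 by rewrite cs mulr1.
  have e2 : r ^+ 2 * (c ^+ 2 + s ^+ 2) + z ^+ 2 = 1 by rewrite cs mulr1 addrC.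
  have e3 : z * r * (c ^+ 2 + s ^+ 2 - 1) = 0 by rewrite cs subrr mulr0.
  by case: (ord3P i) => ->; case: (ord3P j) => ->;
    rewrite !(tnth_nth 0)/=; move: e1 e2 e3 cs; rewrite ?mulr1n ?mulr0n => *; nra.
transitivity ((z ^+ 2 + r ^+ 2) * (c ^+ 2 + s ^+ 2)); last by rewrite zr cs mulr1.
rewrite (expand_det_row _ o0) !big_ord_recl big_ord0 /cofactor.
rewrite !(expand_det_row _ ord0) !big_ord_recl !big_ord0 /cofactor !det_mx11.
rewrite !mxE !(tnth_nth 0) /= /bump /= !add0n !expr0 !expr1.
rewrite ?addn0 ?expr0 ?expr1 ?expr2 ?exprS; ring.
Qed.

Lemma rotation_north (x : S2) : sphere x ->
  exists2 g : 'M[R]_3, rotation g & col3 x = g *m col3 north.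
Proof.
move=> xS; pose z := x.2; pose r := Num.sqrt (1 - z ^+ 2).
have /andP[z1 z2] := sphere_z_bound xS.
have r2 : r ^+ 2 = 1 - z ^+ 2 by rewrite sqr_sqrtr// /z; nra.
have e := sqrt_expi_longitude xS.
exists (frame z r (cos (longitude x)) (sin (longitude x))).
  by apply: frame_rotation; rewrite ?cos2Dsin2// r2 addrC subrK.
have [ex ey] : r * cos (longitude x) = x.1.1 /\ r * sin (longitude x) = x.1.2.
  by move: e => [<- <-]; rewrite !mul0r subr0 addr0.
apply/matrixP => i j; rewrite !mxE !big_ord_recl big_ord0 !mxE.
by case: (ord3P i) => ->; rewrite !(tnth_nth 0)/= !mulr0 !add0r mulr1 addr0 ?ex ?ey.
Qed.

End rotations.

(** * Second moment of the field *)

Section gaussian_second_moment.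
Variable R : realType.

(** Since t^2 is at most a multiple of exp (3 t^2 / (8 s^2)), the integrand is
    dominated by a multiple of the normal density with 2 s for s. *)
Lemma normal_second_moment (s : R) : s != 0 ->
  (\int[normal_prob 0 s]_t (t ^+ 2)%:E < +oo)%E.
Proof.
move=> s0; have s20 : 2 * s != 0 by rewrite mulf_neq0// pnatr_eq0.
have mpdf u : measurable_fun [set: R] (fun t => (normal_pdf 0 u t)%:E).
  by apply/measurable_EFinP; exact: measurable_normal_pdf.
have msq : measurable_fun [set: R] (fun t : R => (t ^+ 2)%:E).
  by apply/measurable_EFinP; exact: measurable_funX.
rewrite (@ge0_integral_density _ _ _ _ _ (@lebesgue_measure R) _ id setT
  (fun t => (normal_pdf 0 s t)%:E))//; last 3 first.
- by move=> t _; rewrite lee_fin normal_pdf_ge0.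
- by move=> A mA; rewrite setTI.
- by move=> t; rewrite lee_fin sqr_ge0.
pose K := normal_peak s * (8 / 3 * s ^+ 2) / normal_peak (2 * s).
have p1 := normal_peak_gt0 s0; have p2 := normal_peak_gt0 s20.
have ss : 0 < s ^+ 2 by rewrite exprn_even_gt0.
have h8 : 0 <= 8 / 3 * s ^+ 2 by lra.
have K0 : 0 <= K.
  by apply: divr_ge0; [apply: mulr_ge0 => //; exact: ltW|exact: ltW].
apply: (@le_lt_trans _ _ (\int[lebesgue_measure]_t (K%:E * (normal_pdf 0 (2 * s) t)%:E))%E).
  apply: ge0_le_integral => //.
  - by move=> t _; rewrite mule_ge0// lee_fin ?sqr_ge0// normal_pdf_ge0.
  - by apply: emeasurable_funM => //; exact: mpdf.
  - by apply: emeasurable_funM => //; exact: mpdf.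
  - move=> t _; rewrite -!EFinM lee_fin !normal_pdfE// /K.
    rewrite [leRHS](_ : _ = normal_peak s * (8 / 3 * s ^+ 2 * normal_fun 0 (2 * s) t)); last first.
      by field; rewrite lt0r_neq0.
    rewrite mulrCA ler_pM2l// /normal_fun subr0.
    have -> : - t ^+ 2 / ((2 * s) ^+ 2 *+ 2) = - t ^+ 2 / (s ^+ 2 *+ 2) + 3 / 8 * t ^+ 2 / s ^+ 2.
      by field.
    rewrite expRD; have h := expR_ge1Dx (3 / 8 * t ^+ 2 / s ^+ 2).
    rewrite [leRHS]mulrCA [leRHS]mulrC [leLHS]mulrC -[leRHS]mulrC ler_wpM2l ?expR_ge0//.
    apply: (@le_trans _ _ (8 / 3 * s ^+ 2 * (3 / 8 * t ^+ 2 / s ^+ 2))).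
      by rewrite le_eqVlt; apply/orP; left; apply/eqP; field.
    by rewrite ler_wpM2l//; lra.
rewrite ge0_integralZl//; last by move=> t _; rewrite lee_fin normal_pdf_ge0.
by rewrite integral_normal_pdf mule1 ltry.
all: exact: mpdf.
Qed.

End gaussian_second_moment.

Section field_second_moment.
Variable R : realType.
Local Notation S2 := (R * R * R)%type.
Local Notation sigma := (@surface_measure R).
Context d (T : measurableType d) (P : probability T R) (X : T -> S2 -> R).
Hypotheses (mX : measurable_field X) (gX : gaussian_zero_mean P X).
Hypothesis iX : isotropic P X.

Lemma measurable_field_at x : sphere x -> measurable_fun [set: T] (fun w => X w x).
Proof.
move=> xS; apply: (@measurable_comp _ _ _ _ _ _ ([set: T] `*` sphere)
    (fun p : T * S2 => X p.1 p.2) _ (fun w => (w, x))) => //.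
- exact: measurableX.
- by move=> _ [w _ <-]; split.
Qed.

(** Isotropy, applied to single points, transports the normal law at the north
    pole to every point of the sphere. *)
Lemma field_law : exists s : R, forall x, sphere x -> forall A, measurable A ->
  P [set w | A (X w x)] = centered_normal s A.
Proof.
have nS : @sphere R (north R) by rewrite /sphere/= expr0n/= !add0r expr1n.
have [s hs] := gX (fun i : 'I_1 => 1) (fun _ => nS).
exists s => x xS A mA.
have [g gr gx] := rotation_north xS.
pose B : set (1.-tuple R) := [set t | A (tnth t ord0)].
have mB : measurable B.
  by rewrite -[B]setTI; exact: measurable_tnth.
have := iX (xi := fun=> north R) (eta := fun=> x) gr (fun=> nS) (fun=> gx) mB.
have tE (y : S2) w : tnth [tuple X w y | i < 1] ord0 = X w y by rewrite tnth_mktuple.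
rewrite /B /= (_ : [set w | _] = [set w | A (X w x)]); last first.
  by apply/seteqP; split => w /=; rewrite tE.
move=> ->; rewrite -hs//; congr (P _); apply/seteqP; split => w /=;
  by rewrite tE big_ord1 mul1r.
Qed.

(** The second moment depends on the law only; the degenerate law is the Dirac
    mass at 0. *)
Lemma field_second_moment : exists m : R, forall x, sphere x ->
  (\int[P]_w ((X w x) ^+ 2)%:E)%E = m%:E.
Proof.
have [s hs] := field_law.
have msq : measurable_fun [set: R] (fun t : R => (t ^+ 2)%:E).
  by apply/measurable_EFinP; exact: measurable_funX.
have sq0 (t : R) : (0 <= (t ^+ 2)%:E)%E by rewrite lee_fin sqr_ge0.
have transfer (nu : {measure set (measurableTypeR R) -> \bar R}) :
    (forall A, measurable A -> nu A = centered_normal s A) ->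
    forall x, sphere x -> (\int[P]_w ((X w x) ^+ 2)%:E = \int[nu]_t (t ^+ 2)%:E)%E.
  move=> nuE x xS.
  have mXx : measurable_fun [set: T] (fun w => X w x : measurableTypeR R).
    exact: measurable_field_at.
  have nuE' A : measurable A ->
      nu A = (\int[P]_(w in setT `&` (fun w => X w x) @^-1` A) (cst 1 w))%E.
    move=> mA; rewrite nuE// -(hs x)// integral_cst ?mul1e ?setTI//.
    by rewrite -[X in measurable X]setTI; exact: mXx.
  rewrite (ge0_integral_density mXx measurableT _ _ _ nuE' msq sq0)//.
  by apply: eq_integral => w _; rewrite mule1.
have [s0|s0] := eqVneq s 0.
  exists 0 => x xS; rewrite (transfer (\d_(0 : measurableTypeR R)))//.
    by rewrite integral_dirac// diracT mul1e expr0n.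
  by move=> A _; rewrite /centered_normal s0 eqxx.
exists (fine (\int[normal_prob 0 s]_t (t ^+ 2)%:E)) => x xS.
rewrite (transfer (normal_prob 0 s))//; last first.
  by move=> A _; rewrite /centered_normal (negbTE s0).
by rewrite fineK// ge0_fin_numE ?normal_second_moment// integral_ge0.
Qed.

(** Tonelli's theorem: the integral of a constant over a sphere of finite area.
    Almost every path is then square integrable, which is what gives sense to
    the coefficients of the field. *)
Lemma field_square_integrable :
  (\int[P]_w \int[sigma]_(x in sphere) ((X w x) ^+ 2)%:E < +oo)%E.
Proof.
have [m hm] := field_second_moment.
pose G (p : T * S2) : \bar R := ((fun p => ((X p.1 p.2) ^+ 2)%:E) \_ ([set: T] `*` sphere)) p.
have mG : measurable_fun setT G.
  apply: (measurable_restrictT _ (measurableX measurableT (@measurable_sphere R))).1.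
  by apply/measurable_EFinP; exact: measurable_funX.
have G0 p : (0 <= G p)%E.
  by rewrite /G patchE; case: ifP => // _; rewrite lee_fin sqr_ge0.
have GE w x : G (w, x) = ((fun x => ((X w x) ^+ 2)%:E) \_ sphere) x.
  rewrite /G !patchE; congr (if _ then _ else _).
  by apply/idP/idP; rewrite !inE/=; [case|split].
rewrite (_ : (\int[P]_w _) = \int[P]_w \int[sigma]_x G (w, x))%E; last first.
  apply: eq_integral => w _; rewrite [LHS]integral_mkcond.
  by apply: eq_integral => x _; rewrite GE.
rewrite fubini_tonelli//.
rewrite (_ : (\int[sigma]_x _) = \int[sigma]_(x in sphere) (cst m%:E) x)%E; last first.
  rewrite [RHS]integral_mkcond; apply: eq_integral => x _.
  rewrite patchE; case: ifPn => [|xS].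
    rewrite inE => xS; rewrite /= -(hm x xS); apply: eq_integral => w _.
    by rewrite GE patchE mem_set.
  rewrite (eq_integral (cst 0%E)) ?integral0// => w _.
  by rewrite GE patchE (negbTE xS).
rewrite integral_cst//.
by rewrite ltey_eq fin_numM// fin_num_measure.
Qed.

End field_second_moment.

(** * Covariance of linear functionals of the field *)

Section almost_everywhere.
Context d (T : measurableType d) (R : realType).
Variable mu : {measure set T -> \bar R}.
Variable G : set T.
Hypotheses (mG : measurable G) (G0 : mu (~` G) = 0%E).
Implicit Types f g : T -> R[i].

Let aeG (Q : T -> Prop) : (forall w, G w -> Q w) -> {ae mu, forall w, Q w}.
Proof.
move=> h; exists (~` G); split => //; first exact: measurableC.
by move=> w /= nQ Gw; apply: nQ; exact: h.
Qed.

Lemma ae_eq_cintegral f g : cmeasurable setT f -> cmeasurable setT g ->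
  (forall w, G w -> f w = g w) -> cintegral mu setT f = cintegral mu setT g.
Proof.
move=> [f1 f2] [g1 g2] fg; apply: complex_eqP; rewrite /= /Rintegral; congr fine;
  (apply: ae_eq_integral => //; [exact/measurable_EFinP|exact/measurable_EFinP|]);
  by apply: aeG => w Gw _; rewrite fg.
Qed.

Lemma ae_sq_integrable f g : cmeasurable setT f -> cmeasurable setT g ->
  (forall w, G w -> f w = g w) -> sq_integrable mu setT f -> sq_integrable mu setT g.
Proof.
move=> mf mg fg [f1 f2 fi]; have [g1 g2] := mg; split => //.
rewrite (_ : (\int[mu]_w _)%E = (\int[mu]_w (sqmod (f w))%:E)%E)//.
apply: ae_eq_integral => //.
- by apply/measurable_EFinP; exact: measurable_sqmod.
- by apply/measurable_EFinP; exact: measurable_sqmod.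
- by apply: aeG => w Gw _; rewrite fg.
Qed.

End almost_everywhere.

Section parametric_cintegral.
Variable R : realType.
Local Notation S2 := (R * R * R)%type.
Local Notation sigma := (@surface_measure R).
Context d (T : measurableType d).

Lemma cmeasurable_parametric (F : T -> S2 -> R[i]) :
  cmeasurable ([set: T] `*` sphere) (fun p : T * S2 => F p.1 p.2) ->
  cmeasurable setT (fun w => cintegral sigma sphere (F w)).
Proof.
move=> [F1 F2]; split => /=.
  exact: (@measurable_parametric_integral _ _ T S2 R sigma sphere
    (@measurable_sphere R) (fun p => complex.Re (F p.1 p.2))).
exact: (@measurable_parametric_integral _ _ T S2 R sigma sphere
    (@measurable_sphere R) (fun p => complex.Im (F p.1 p.2))).
Qed.

Lemma cmeasurable_snd (f : S2 -> R[i]) : cmeasurable sphere f ->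
  cmeasurable ([set: T] `*` sphere) (fun p : T * S2 => f p.2).
Proof.
move=> [f1 f2]; split.
- apply: (@measurable_comp _ _ _ _ _ _ sphere (fun x => complex.Re (f x))) => //.
  + by move=> _ [p [_ pS] <-].
  + by apply: measurable_funTS; exact: measurable_snd.
- apply: (@measurable_comp _ _ _ _ _ _ sphere (fun x => complex.Im (f x))) => //.
  + by move=> _ [p [_ pS] <-].
  + by apply: measurable_funTS; exact: measurable_snd.
Qed.

Lemma cmeasurable_field (X : T -> S2 -> R) : measurable_field X ->
  cmeasurable ([set: T] `*` sphere) (fun p : T * S2 => cfield X p.1 p.2).
Proof. by move=> mX; split => //; exact: measurable_cst. Qed.

Lemma cmeasurable_path (X : T -> S2 -> R) w : measurable_field X ->
  cmeasurable sphere (cfield X w).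
Proof.
move=> mX; split; last exact: measurable_cst.
apply: (@measurable_comp _ _ _ _ _ _ ([set: T] `*` sphere)
    (fun p : T * S2 => X p.1 p.2) _ (fun x => (w, x))) => //.
- exact: measurableX.
- by move=> _ [x xS <-]; split.
- by apply: measurable_funTS; exact: measurable_fun_pair.
Qed.

End parametric_cintegral.

Section covariance.
Variable R : realType.
Local Notation S2 := (R * R * R)%type.
Local Notation sigma := (@surface_measure R).
Local Notation "z %:Cx" := (real_complex R z) (at level 2, format "z %:Cx").
Local Notation sqi := (sq_integrable sigma sphere).
Local Notation N2 := (nrm2 sigma sphere).
Local Notation ipS := (ip sigma sphere).
Context d (T : measurableType d) (P : probability T R).
Local Notation ipP := (ip P [set: T]).
Local Notation sqP := (sq_integrable P [set: T]).

Section square_integrable_paths.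
Variable Y : T -> S2 -> R.
Hypothesis mY : measurable_field Y.
Hypothesis sY : forall w, sqi (cfield Y w).
Hypothesis iY : P.-integrable setT (fun w => (N2 (cfield Y w))%:E).

Definition pairing (f : S2 -> R[i]) (w : T) : R[i] := ipS (cfield Y w) f.

Lemma cmeasurable_pairing f : sqi f -> cmeasurable setT (pairing f).
Proof.
move=> hf; apply: cmeasurable_parametric; apply: cmeasurableM.
  exact: cmeasurable_field.
apply: (@cmeasurable_snd _ _ _ (fun x => (f x)^*)); apply: cmeasurable_conj.
exact: sq_integrable_meas hf.
Qed.

Lemma pairing_bound f w : sqi f -> sqmod (pairing f w) <= N2 f * N2 (cfield Y w).
Proof. by move=> hf; rewrite mulrC; exact: cauchy_schwarz_ip. Qed.

Let iYZ (a : R) : P.-integrable setT (EFin \o (fun w => a * N2 (cfield Y w))).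
Proof. exact: (integrableZl measurableT a iY). Qed.

Lemma sq_integrable_pairing f : sqi f -> sqP (pairing f).
Proof.
move=> hf; apply: (le_sq_integrable measurableT (cmeasurable_pairing hf) (iYZ (N2 f))).
by move=> w _; exact: pairing_bound.
Qed.

Lemma nrm2_pairing f : sqi f ->
  nrm2 P setT (pairing f) <= N2 f * \int[P]_w N2 (cfield Y w).
Proof.
move=> hf; rewrite -RintegralZl//; apply: le_Rintegral => //.
- exact: sq_integrable_sqmod (sq_integrable_pairing hf).
- by move=> w _; exact: pairing_bound.
Qed.

(** The Cauchy-Schwarz inequality, path by path, makes f |-> <Y, f> continuous
    from L^2 of the sphere to L^2 of the probability space. *)
Lemma pairing_cvg f : sqi f ->
  nrm2 P setT (fun w => pairing f w - pairing (fourier_sum n f) w) @[n --> \oo]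
    --> (0 : R).
Proof.
move=> hf; pose m := \int[P]_w N2 (cfield Y w).
apply: (@squeeze_cvgr _ _ _ _ (fun=> 0)
  (fun n => N2 (fun x => f x - fourier_sum n f x) * m)).
- near=> n; rewrite nrm2_ge0/=.
  have hn := sq_integrable_fourier_sum n f.
  rewrite (@eq_nrm2 _ _ _ _ _ _ (pairing (fun x => f x - fourier_sum n f x))).
    by apply: nrm2_pairing; exact: sq_integrableB.
  by move=> w _; rewrite /pairing ipBr.
- exact: cvg_cst.
- rewrite -[X in _ --> X](mul0r m); apply: cvgM; last exact: cvg_cst.
  exact: fourier_sum_cvg.
Unshelve. all: try end_near.
Qed.

End square_integrable_paths.

Variables (X : T -> S2 -> R) (C : nat -> R).
Hypotheses (mX : measurable_field X) (pX : power_spectrum P X C).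
Hypothesis iX : (\int[P]_w \int[sigma]_(x in sphere) ((X w x) ^+ 2)%:E < +oo)%E.

Let energy_path w : \bar R := (\int[sigma]_(x in sphere) ((X w x) ^+ 2)%:E)%E.

Let measurable_energy_path : measurable_fun setT energy_path.
Proof.
pose F (p : T * S2) : \bar R :=
  ((fun p => ((X p.1 p.2) ^+ 2)%:E) \_ ([set: T] `*` sphere)) p.
have mF : measurable_fun setT F.
  apply: (measurable_restrictT _ (measurableX measurableT (@measurable_sphere R))).1.
  by apply/measurable_EFinP; exact: measurable_funX.
have F0 p : (0 <= F p)%E.
  by rewrite /F patchE; case: ifP => // _; rewrite lee_fin sqr_ge0.
rewrite (_ : energy_path = fubini_F sigma F).
  exact: measurable_fun_fubini_tonelli_F.
apply/funext => w; rewrite /energy_path /fubini_F [LHS]integral_mkcond.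
apply: eq_integral => x _; rewrite /F !patchE; congr (if _ then _ else _).
by apply/idP/idP; rewrite !inE/=; [split|case].
Qed.

Let G : set T := [set w | (energy_path w < +oo)%E].

Let mG : measurable G.
Proof.
by rewrite -[G]setTI; exact: emeasurable_fun_infty_o.
Qed.

Let energy_path_ge0 w : (0 <= energy_path w)%E.
Proof. by apply: integral_ge0 => x _; rewrite lee_fin sqr_ge0. Qed.

Let energy_integrable : P.-integrable setT energy_path.
Proof.
apply/integrableP; split => //.
by under eq_integral do rewrite gee0_abs//.
Qed.

Let G0 : P (~` G) = 0%E.
Proof.
have [N [mN N0 sub]] := integrable_ae measurableT energy_integrable.
apply: (subset_measure0 (measurableC mG) mN) => // w nG; apply: sub => /= /(_ I) fn.
by apply: nG; rewrite /G /= -ge0_fin_numE.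
Qed.

Let G_sqi w : sqi (cfield X w) <-> G w.
Proof.
have e : (\int[sigma]_(x in sphere) (sqmod (cfield X w x))%:E = energy_path w)%E.
  by apply: eq_integral => x _; rewrite sqmod_real.
split; first by move=> [_ _]; rewrite e.
move=> Gw; have [m1 m2] := cmeasurable_path w mX.
by split => //; rewrite e.
Qed.

(** Only almost every path of X is square integrable. Replacing the others by 0
    changes no expectation. *)
Let Y w x := \1_G w * X w x.

Let YE w : G w -> Y w = X w.
Proof. by move=> Gw; apply/funext => x; rewrite /Y indicE mem_set// mul1r. Qed.

Let Y0 w : ~ G w -> Y w = fun=> 0.
Proof. by move=> Gw; apply/funext => x; rewrite /Y indicE memNset// mul0r. Qed.

Let mY : measurable_field Y.
Proof.
apply: measurable_funM => //; apply: measurable_funTS.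
by apply: measurableT_comp => //; exact: measurable_indic.
Qed.

Let sY w : sqi (cfield Y w).
Proof.
case: (pselect (G w)) => Gw; rewrite /cfield.
  by rewrite YE//; exact/G_sqi.
by rewrite Y0//; exact: sq_integrable_cst.
Qed.

Let iY : P.-integrable setT (fun w => (N2 (cfield Y w))%:E).
Proof.
apply: (le_integrable measurableT _ _ energy_integrable).
  apply/measurable_EFinP.
  apply: (@measurable_parametric_integral _ _ T S2 R sigma sphere
    (@measurable_sphere R) (fun p => sqmod (cfield Y p.1 p.2))).
  by apply: measurable_sqmod; exact: cmeasurable_field.
move=> w _; rewrite EFin_nrm2//.
rewrite !gee0_abs//; last by apply: integral_ge0 => x _; rewrite lee_fin.
apply: ge0_le_integral => //.
- by move=> x _; rewrite lee_fin.
- by apply/measurable_EFinP; apply: measurable_sqmod; exact: cmeasurable_path.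
- apply/measurable_EFinP; apply: measurable_funX.
  by have [] := cmeasurable_path w mX.
- move=> x _; rewrite lee_fin sqmod_real /Y exprMn indicE.
  by case: (_ \in _); rewrite ?expr1n ?mul1r// expr0n mul0r sqr_ge0.
Qed.

(** On Fourier sums the claim is the definition of the power spectrum, and the
    inner product of L^2 passes to the limit. The functionals are only known
    to be inner products on square integrable paths, and their values
    on the null set of other paths are arbitrary: hence A and B. *)
Theorem field_covariance f g (A B : T -> R[i]) : sqi f -> sqi g ->
  cmeasurable setT A -> cmeasurable setT B ->
  (forall w, sqi (cfield X w) -> A w = ipS (cfield X w) f) ->
  (forall w, sqi (cfield X w) -> B w = ipS (cfield X w) g) ->
  [/\ sqP A, sqP B & sqmod (ipP A B - \sum_(k <- lm_seq n)
     (C k.1)%:Cx * ((ipS f (Yk k))^* * ipS g (Yk k))) @[n --> \oo] --> (0 : R)].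
Proof.
move=> hf hg mA mB fA gB.
have AE w : G w -> pairing Y f w = A w.
  by move=> Gw; rewrite fA; [rewrite /pairing /cfield YE|exact/G_sqi].
have BE w : G w -> pairing Y g w = B w.
  by move=> Gw; rewrite gB; [rewrite /pairing /cfield YE|exact/G_sqi].
have sf := sq_integrable_pairing mY sY iY hf.
have sg := sq_integrable_pairing mY sY iY hg.
have mf := sq_integrable_meas sf; have mg := sq_integrable_meas sg.
split.
- exact: (ae_sq_integrable mG G0 mf mA AE sf).
- exact: (ae_sq_integrable mG G0 mg mB BE sg).
have -> : ipP A B = ipP (pairing Y f) (pairing Y g).
  apply: (ae_eq_cintegral mG G0).
  - by apply: cmeasurableM => //; exact: cmeasurable_conj.
  - by apply: cmeasurableM => //; exact: cmeasurable_conj.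
  - by move=> w Gw; rewrite AE// BE.
have spn (h : S2 -> R[i]) n := sq_integrable_pairing mY sY iY (sq_integrable_fourier_sum n h).
have := ip_cvg measurableT sf sg (spn f) (spn g)
  (pairing_cvg mY sY iY hf) (pairing_cvg mY sY iY hg).
apply: cvg_trans; apply: near_eq_cvg; near=> n; congr (sqmod (_ - _)).
have sYk k := sq_integrable_pairing mY sY iY (@sq_integrable_Yk R k).
have expand h w : pairing Y (fourier_sum n h) w =
    \sum_(k <- lm_seq n) (ipS h (Yk k))^* * pairing Y (Yk k) w.
  by rewrite /pairing /fourier_sum ip_sumr// => k _; exact: sq_integrable_Yk.
rewrite (@eq_ip _ _ _ _ _ _
  (fun w => \sum_(k <- lm_seq n) (ipS f (Yk k))^* * pairing Y (Yk k) w) _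
  (fun w => \sum_(k <- lm_seq n) (ipS g (Yk k))^* * pairing Y (Yk k) w)); first last.
- by move=> w _; exact: expand.
- by move=> w _; exact: expand.
have sum_sq (c : nat * int -> R[i]) :
    sqP (fun w => \sum_(k <- lm_seq n) c k * pairing Y (Yk k) w).
  apply: (sq_integrable_sum measurableT) => k _.
  exact: (sq_integrableZ measurableT _ (sYk k)).
rewrite (ip_suml measurableT _ (fun k _ => sYk k) (sum_sq _)).
have spec k j : k \in lm_seq n -> j \in lm_seq n ->
    ipP (pairing Y (Yk k)) (pairing Y (Yk j)) = if k == j then (C k.1)%:Cx else 0.
  rewrite !mem_lm_seq => /andP[_ kk] /andP[_ jj].
  have mcoef i : cmeasurable setT (fun w => coef (cfield X w) i.1 i.2).
    apply: cmeasurable_parametric; apply: cmeasurableM; first exact: cmeasurable_field.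
    apply: (@cmeasurable_snd _ _ _ (fun x => (Yk i x)^*)); apply: cmeasurable_conj.
    exact: cmeasurable_Ylm.
  have := pX kk jj; rewrite -xpair_eqE -!surjective_pairing => <-.
  apply: (ae_eq_cintegral mG G0).
  - by apply: cmeasurableM; [|apply: cmeasurable_conj]; exact: sq_integrable_meas (sYk _).
  - by apply: cmeasurableM => //; exact: cmeasurable_conj.
  - by move=> w Gw; rewrite /pairing /cfield YE.
apply: eq_big_seq => k kn.
rewrite (ip_sumr measurableT _ (fun k _ => sYk k) (sYk k)).
rewrite (bigD1_seq k)//= ?lm_seq_uniq// big_seq_cond big1 ?addr0.
  by rewrite spec// eqxx conjCK; ring.
by move=> j /andP[jn jk]; rewrite spec// eq_sym (negbTE jk) mulr0.
Unshelve. all: try end_near.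
Qed.

End covariance.

(** * Sums with finite support over product sets *)

Section finite_products.
Variable R : idomainType.

Lemma fsbig_setX_mul (I J : choiceType) (A : set I) (B : set J) (r : seq I)
    (s : seq J) (f : I -> R) (g : J -> R) :
  uniq r -> uniq s -> [set` r] `<=` A -> [set` s] `<=` B ->
  (forall i, A i -> i \notin r -> f i = 0) ->
  (forall j, B j -> j \notin s -> g j = 0) ->
  \sum_(p \in A `*` B) f p.1 * g p.2 = (\sum_(i <- r) f i) * (\sum_(j <- s) g j).
Proof.
move=> ur us rA sB fr gs.
rewrite (fsbigE [seq (i, j) | i <- r, j <- s]); last 3 first.
- by apply: allpairs_uniq => // -[a b] [c e] _ _.
- by move=> _ /allpairsP[[i j] [/= ir js ->]]; split; [exact: rA|exact: sB].
- move=> [i j] [/= Ai Bj] nij.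
  have [ir|/fr->//] := boolP (i \in r); last by rewrite mul0r.
  have [js|/gs->//] := boolP (j \in s); last by rewrite mulr0.
  by case/negP: nij; apply/allpairsP; exists (i, j).
rewrite big_seq_cond big_mkcondr/= -big_seq.
rewrite big_allpairs/= big_distrlr/=; apply: eq_big_seq => i ir.
by apply: eq_big_seq => j js; rewrite mem_set//; split; [exact: rA|exact: sB].
Qed.

Lemma finite_support_mul (I J : choiceType) (A : set I) (B : set J) (r : seq I)
    (s : seq J) (f : I -> R) (g : J -> R) :
  (forall i, A i -> i \notin r -> f i = 0) ->
  (forall j, B j -> j \notin s -> g j = 0) ->
  finite_set ((A `*` B) `&` [set p | f p.1 * g p.2 != 0]).
Proof.
move=> fr gs; apply: (@sub_finite_set _ _ [set` [seq (i, j) | i <- r, j <- s]]).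
  move=> [i j] [[/= Ai Bj]]; rewrite mulf_eq0 negb_or => /andP[fi gj].
  have ir : i \in r by apply: contraNT fi => /(fr _ Ai) ->.
  have js : j \in s by apply: contraNT gj => /(gs _ Bj) ->.
  by apply/allpairsP; exists (i, j).
exact: finite_seq.
Qed.

Lemma fsbig_setX3_mul (I : choiceType) (A : set I) (r s t : seq I) (f g h : I -> R) :
  uniq r -> uniq s -> uniq t -> [set` r] `<=` A -> [set` s] `<=` A ->
  [set` t] `<=` A ->
  (forall i, A i -> i \notin r -> f i = 0) ->
  (forall j, A j -> j \notin s -> g j = 0) ->
  (forall k, A k -> k \notin t -> h k = 0) ->
  \sum_(p \in A `*` A `*` A) f p.1.1 * g p.1.2 * h p.2 =
    (\sum_(i <- r) f i) * (\sum_(j <- s) g j) * (\sum_(k <- t) h k).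
Proof.
move=> ur us ut rA sA tA fr gs ht.
rewrite (@fsbig_setX_mul _ _ (A `*` A) A [seq (i, j) | i <- r, j <- s] t
  (fun q => f q.1 * g q.2) h)//.
- by congr (_ * _); rewrite big_allpairs/= big_distrlr.
- by apply: allpairs_uniq => // -[a b] [c e] _ _.
- by move=> _ /allpairsP[[i j] [/= ir js ->]]; split; [exact: rA|exact: sA].
- move=> [i j] [/= Ai Bj] nij.
  have [ir|/fr->//] := boolP (i \in r); last by rewrite mul0r.
  have [js|/gs->//] := boolP (j \in s); last by rewrite mulr0.
  by case/negP: nij; apply/allpairsP; exists (i, j).
Qed.

Lemma finite_support3_mul (I : choiceType) (A : set I) (r s t : seq I) (f g h : I -> R) :
  (forall i, A i -> i \notin r -> f i = 0) ->
  (forall j, A j -> j \notin s -> g j = 0) ->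
  (forall k, A k -> k \notin t -> h k = 0) ->
  finite_set ((A `*` A `*` A) `&` [set p | f p.1.1 * g p.1.2 * h p.2 != 0]).
Proof.
move=> fr gs ht.
apply: (@finite_support_mul _ _ (A `*` A) A [seq (i, j) | i <- r, j <- s] t
  (fun q => f q.1 * g q.2) h) => //.
move=> [i j] [/= Ai Bj] nij.
have [ir|/fr->//] := boolP (i \in r); last by rewrite mul0r.
have [js|/gs->//] := boolP (j \in s); last by rewrite mulr0.
by case/negP: nij; apply/allpairsP; exists (i, j).
Qed.

End finite_products.

(** * Complex series *)

Section complex_series.
Variable R : realType.

(** Convergence for the squared modulus is convergence for the topology of the
    modulus. *)
Lemma csum_cvg (u : nat -> R[i]) (L : R[i]) :
  sqmod (L - \sum_(0 <= k < n) u k) @[n --> \oo] --> (0 : R) ->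
  is_csummable u /\ csum u = L.
Proof.
move=> h; have c : series (u : nat -> R[i]^o) @ \oo --> (L : R[i]^o).
  apply/cvgrPdist_lt => e e0.
  have /andP[/eqP ei er] : (complex.Im e == 0) && (0 < complex.Re e).
    by move: e0; rewrite ltcE/= eq_sym.
  have er2 : 0 < complex.Re e ^+ 2 by rewrite exprn_gt0.
  have /cvgrPdist_lt/(_ _ er2)[n _ hn] := h.
  exists n => // k /hn; rewrite sub0r normrN ger0_norm// => hk.
  rewrite normc_def (_ : e = (complex.Re e)%:C%C); last exact: complex_eqP.
  by rewrite ltcR -[ltRHS]gtr0_norm// -sqrtr_sqr ltr_sqrt.
split; first by apply/cvg_ex; exists L.
by apply: cvg_lim c; exact: norm_hausdorff.
Qed.

End complex_series.

(** * Brackets and triple integrals *)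

Section three_harmonics.
Variable R : realType.
Local Notation S2 := (R * R * R)%type.
Local Notation sigma := (@surface_measure R).
Local Notation sqi := (sq_integrable sigma sphere).
Local Notation ipS := (ip sigma sphere).

(** The bracket with its middle harmonic replaced by an arbitrary function. *)
Definition triple_integral (F : S2 -> R[i]) l m l' m' : R[i] :=
  cintegral sigma sphere (fun x => F x * Ylm l m x * (Ylm l' m' x)^*).

Lemma sq_integrable_conj_mul l m l' m' :
  sqi (fun x => (Ylm l m x)^* * Ylm l' m' x).
Proof.
have [M hM] := @Ylm_bounded R l' m'.
apply: (sq_integrableMb _ _ _ hM) => //.
  by apply: sq_integrable_conj => //; exact: sq_integrable_Ylm.
exact: cmeasurable_Ylm.
Qed.

Lemma bracketE l1 m1 l2 m2 l3 m3 :
  (`|m1| <= l1)%N -> (`|m2| <= l2)%N -> (`|m3| <= l3)%N ->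
  bracket R l1 m1 l2 m2 l3 m3 =
  (ipS (fun x => (Ylm l1 m1 x)^* * Ylm l3 m3 x) (Yk (l2, m2)))^*.
Proof.
move=> h1 h2 h3; rewrite /bracket h1 h2 h3 /=.
rewrite /ip -cintegral_conj//; last first.
  by apply: cintegrable_ip => //; [exact: sq_integrable_conj_mul|exact: sq_integrable_Ylm].
by apply: eq_cintegral => x _; rewrite !conjM !conjCK /Yk/=; ring.
Qed.

Lemma conj_mul_in_span l m l' m' : (`|m| <= l)%N -> (`|m'| <= l')%N ->
  in_span (l + l').+1 (fun x : S2 => (Ylm l m x)^* * Ylm l' m' x).
Proof.
move=> h h'; rewrite addnC.
apply: (@eq_in_span _ _ (fun x => Yk (l', m') x * (Yk (l, m) x)^*)).
  by move=> x _; rewrite mulrC.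
exact: (@Yk_conjM_in_span R (l', m') (l, m)).
Qed.

(** The triangle condition: the product of the two outer harmonics lies in the
    span of the degrees at most l1 + l3, which is orthogonal to the middle one. *)
Lemma bracket_eq0 l1 m1 l2 m2 l3 m3 : (l1 + l3 < l2)%N ->
  bracket R l1 m1 l2 m2 l3 m3 = 0.
Proof.
move=> l2l; have [/and3P[h1 h2 h3]|/negbTE h] :=
  boolP [&& (`|m1| <= l1)%N, (`|m2| <= l2)%N & (`|m3| <= l3)%N]; last by rewrite /bracket h.
rewrite bracketE//; have [c hc] := conj_mul_in_span h1 h3.
rewrite (@eq_ip _ _ _ _ _ _ (fun x => \sum_(k <- lm_seq (l1 + l3).+1) c k * Yk k x) _
  (Yk (l2, m2))) => [|x /[!inE]|//]; last exact: hc.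
rewrite ip_suml//; last 2 first.
- by move=> k _; exact: sq_integrable_Yk.
- exact: sq_integrable_Yk.
rewrite big_seq big1 ?rmorph0// => k; rewrite mem_lm_seq => /andP[k1 k2].
rewrite Ylm_orthonormal//= (_ : (k.1 == l2) = false) ?mulr0//.
by apply/eqP => e; move: k1; rewrite e ltnS leqNgt l2l.
Qed.

(** Expand the product of the two harmonics, a finite combination of harmonics,
    instead of F: no convergence question arises. *)
Lemma triple_integral_sum F l m l' m' : sqi F ->
  (`|m| <= l)%N -> (`|m'| <= l')%N ->
  triple_integral F l m l' m' =
  \sum_(k <- lm_seq (l + l').+1) coef F k.1 k.2 * bracket R l m k.1 k.2 l' m'.
Proof.
move=> hF h h'; pose g := fun x : S2 => (Ylm l m x)^* * Ylm l' m' x.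
have -> : triple_integral F l m l' m' = ipS F g.
  by apply: eq_cintegral => x _; rewrite /g conjM conjCK mulrA.
rewrite (@eq_ip _ _ _ _ _ _ F _
  (fun x => \sum_(k <- lm_seq (l + l').+1) ipS g (Yk k) * Yk k x)) => [|//|x /[!inE] xS]; last first.
  exact: in_span_coef (conj_mul_in_span h h') xS.
rewrite ip_sumr//; last by move=> k _; exact: sq_integrable_Yk.
apply: eq_big_seq => k; rewrite mem_lm_seq => /andP[_ kk].
by rewrite bracketE// mulrC -surjective_pairing.
Qed.

End three_harmonics.

(** * Axisymmetric functions *)

Section axisymmetric_functions.
Variable R : realType.
Local Notation S2 := (R * R * R)%type.
Local Notation sigma := (@surface_measure R).
Local Notation lam := (@lebesgue_measure R).
Local Notation "z %:Cx" := (real_complex R z) (at level 2, format "z %:Cx").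
Local Notation sqi := (sq_integrable sigma sphere).
Implicit Types (F : S2 -> R[i]) (l : nat) (m : int).

Let Imer : set R := `[0, pi]%classic.
Let Ipar : set R := `[0, pi *+ 2[%classic.

Let mImer : measurable Imer. Proof. exact: measurable_itv. Qed.
Let mIpar : measurable Ipar. Proof. exact: measurable_itv. Qed.

Lemma colatitude_polar (t u : R) : t \in `[0, pi] -> colatitude (polar (t, u)) = t.
Proof. by move=> t0; rewrite /colatitude/= cosK. Qed.

Let measurable_polar_comp (h : S2 -> R) : measurable_fun sphere h ->
  measurable_fun [set: R * R] (fun p => h (polar p) * sin p.1).
Proof.
move=> mh; apply: measurable_funM.
  apply: (@measurable_comp _ _ _ _ _ _ sphere h) => //.
    by move=> _ [p _ <-]; exact: polar_sphere.
  exact: measurable_polar.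
by apply: measurableT_comp => //; apply: continuous_measurable_fun;
  exact: continuous_sin.
Qed.

Let measurable_parallel (h : S2 -> R) t : measurable_fun sphere h ->
  measurable_fun Ipar (fun u => (h (polar (t, u)) * sin t)%:E).
Proof.
move=> mh; apply/measurable_EFinP; apply: measurable_funTS.
exact: (measurable_fun_pair2 t (measurable_polar_comp mh)).
Qed.

Let measurable_meridian (h : S2 -> R) : measurable_fun sphere h ->
  measurable_fun Imer (fun t => \int[lam]_(u in Ipar) (h (polar (t, u)) * sin t)%:E)%E.
Proof.
move=> mh; apply: measurable_funTS.
apply: (@measurable_parametric_eintegral _ _ _ _ R lam Ipar mIpar
  (fun p => h (polar p) * sin p.1)).
by apply: measurable_funTS; exact: measurable_polar_comp.
Qed.

(** Fubini's theorem. The poles are left out because the density sin t vanishes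
    there. *)
Lemma negligible_parallels (N : set S2) : measurable N -> sigma N = 0%E ->
  {ae lam, forall t, Imer t -> sin t != 0 ->
    {ae lam, forall u, Ipar u -> ~ N (polar (t, u))}}.
Proof.
move=> mN N0; pose h (x : S2) : R := \1_N x.
have mh : measurable_fun sphere h by apply: measurable_funTS; exact: measurable_indic.
have ih : sigma.-integrable sphere (EFin \o h).
  apply: (@integrableS _ _ _ _ setT) => //.
  exact: integrable_indic.
have h0 t u : t \in `[0, pi] -> (0 <= (h (polar (t, u)) * sin t)%:E)%E.
  by rewrite in_itv/= => t0; rewrite lee_fin mulr_ge0// sin_ge0_pi.
have z : (\int[lam]_(t in Imer) `|\int[lam]_(u in Ipar) (h (polar (t, u)) * sin t)%:E| = 0)%E.
  have e : (\int[sigma]_(x in sphere) (h x)%:E = 0)%E.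
    apply/eqP; rewrite eq_le integral_ge0 ?andbT//; last first.
      by move=> x _; rewrite lee_fin.
    rewrite integral_indic// -N0; apply: le_measure; rewrite ?inE//.
    exact: measurableI.
  rewrite -[RHS]e surface_integral//; apply: eq_integral => t /[!inE] t0.
  by rewrite gee0_abs//; apply: integral_ge0 => u _; exact: h0.
have := (ae_eq_integral_abs lam mImer (measurable_meridian mh)).1 z.
apply: filterS => t + It st => /(_ It) /= zt.
have {}zt : (\int[lam]_(u in Ipar) `|(h (polar (t, u)) * sin t)%:E| = 0)%E.
  by rewrite -[RHS]zt; apply: eq_integral => u _; rewrite gee0_abs// h0.
have := (ae_eq_integral_abs lam mIpar (measurable_parallel t mh)).1 zt.
apply: filterS => u + Iu => /(_ Iu) /= [] /eqP.
rewrite mulf_eq0 (negbTE st) orbF /h indicE => + Nu.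
by rewrite mem_set//= oner_eq0.
Qed.

(** On almost every parallel F is almost everywhere equal to a constant, and the
    remaining factor integrates to zero over a period. As the function g
    that witnesses axisymmetry may fail to be measurable, it is only used at
    one colatitude at a time. *)
Lemma axisymmetric_cintegral F m (p : {poly R}) : sqi F -> axisymmetric F -> m != 0 ->
  cintegral sigma sphere (fun x => F x * zharm m p x) = 0.
Proof.
move=> hF [g [N [mN N0 sub]]] m0.
have n0 : (0 < `|m|)%N by rewrite absz_gt0.
have ci : cintegrable sigma sphere (fun x => F x * zharm m p x).
  by apply: sq_integrableM => //; exact: sq_integrable_zharm.
have [mR mI] : cmeasurable sphere (fun x => F x * zharm m p x).
  by apply: cmeasurableM; [exact: sq_integrable_meas hF|exact: cmeasurable_zharm].
have Fg t u : t \in `[0, pi] -> ~ N (polar (t, u)) -> F (polar (t, u)) = g t.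
  move=> t0 nN; apply: contrapT => nF; apply: nN; apply: sub => /= /(_ (polar_sphere _)).
  by rewrite colatitude_polar.
have key (h : S2 -> R) : measurable_fun sphere h ->
    sigma.-integrable sphere (EFin \o h) ->
    (forall t, exists a b : R, forall u, t \in `[0, pi] -> ~ N (polar (t, u)) ->
       h (polar (t, u)) = a * cos (`|m|%N%:R * u) + b * sin (`|m|%N%:R * u)) ->
    (\int[sigma]_(x in sphere) (h x)%:E = 0)%E.
  move=> mh ih hab; rewrite surface_integral//.
  rewrite (ae_eq_integral (cst 0%E)) ?integral0//; first exact: measurable_meridian.
  have := negligible_parallels mN N0.
  apply: filterS; first exact: (ae_filter_ringOfSetsType lam).
  move=> t + It => /(_ It) nt.
  have [a [b ab]] := hab t.
  have [st|st] := eqVneq (sin t) 0.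
    by rewrite (eq_integral (cst 0%E)) ?integral0// => u _; rewrite st mulr0.
  rewrite /= -[RHS](circle_integral (a * sin t) (b * sin t) n0).
  apply: ae_eq_integral => //; first exact: measurable_parallel.
    apply/measurable_EFinP; apply: measurable_funTS; apply: continuous_measurable_fun.
    exact: continuous_trig.
  have := nt st; apply: filterS; first exact: (ae_filter_ringOfSetsType lam).
  move=> u + Iu => /(_ Iu) nN.
  by congr EFin; rewrite ab//; ring.
have [iR iI] := ci.
have eR : (\int[sigma]_(x in sphere) (complex.Re (F x * zharm m p x))%:E = 0)%E.
  apply: key => // t; exists (complex.Re (g t) * (sin t ^+ `|m| * p.[cos t])),
    (- complex.Im (g t) * (sin t ^+ `|m| * p.[cos t] * (if 0 <= m then 1 else -1))).
  by move=> u t0 nN; rewrite complex_ReM Fg// Re_zharm_polar Im_zharm_polar; ring.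
have eI : (\int[sigma]_(x in sphere) (complex.Im (F x * zharm m p x))%:E = 0)%E.
  apply: key => // t; exists (complex.Im (g t) * (sin t ^+ `|m| * p.[cos t])),
    (complex.Re (g t) * (sin t ^+ `|m| * p.[cos t] * (if 0 <= m then 1 else -1))).
  by move=> u t0 nN; rewrite complex_ImM Fg// Re_zharm_polar Im_zharm_polar; ring.
by rewrite /cintegral /Rintegral eR eI.
Qed.

Lemma axisymmetric_coef F l m : sqi F -> axisymmetric F -> m != 0 -> coef F l m = 0.
Proof.
move=> hF aF m0; rewrite /coef /inner.
rewrite (@eq_cintegral _ _ _ _ _ _ (fun x => (ynorm R l m)%:Cx *
    (F x * zharm (- m) (ypoly R l m) x))); last first.
  by move=> x /[!inE] xS; rewrite Ylm_zharm// conjM conj_real zharm_conj; ring.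
rewrite cintegralZ//; last by apply: sq_integrableM => //; exact: sq_integrable_zharm.
by rewrite axisymmetric_cintegral ?mulr0// oppr_eq0.
Qed.

Lemma axisymmetric_onem F : axisymmetric F -> axisymmetric (fun x => 1 - F x).
Proof.
move=> [g hg]; exists (fun t => 1 - g t).
by move: hg; apply: filterS => x h xS; rewrite h.
Qed.

(** The bracket integrates an elementary harmonic of order m1 - m3 with real
    polynomial coefficient. *)
Let bracket_zharm l1 m1 l2 l3 m3 : exists r : {poly R}, exists c : R,
  (`|m1| <= l1)%N -> (`|m3| <= l3)%N ->
  bracket R l1 m1 l2 0 l3 m3 = c%:Cx * cintegral sigma sphere (zharm (m1 - m3) r).
Proof.
have [r [_ hr]] := zpowM R m1 (- m3).
exists (r * (ypoly R l1 m1 * ypoly R l2 0 * ypoly R l3 m3)),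
  (ynorm R l1 m1 * ynorm R l2 0 * ynorm R l3 m3) => h1 h3.
rewrite /bracket h1 h3/= -cintegralZ//; last first.
  by apply: sq_integrable_cintegrable; exact: sq_integrable_zharm.
apply: eq_cintegral => x /[!inE] xS.
rewrite !Ylm_zharm// conjM conj_real zharm_conj zharm0 /zharm.
move: (ynorm R l1 m1) (ynorm R l2 0) (ynorm R l3 m3) => a b c.
rewrite !hornerM !(rmorphM (real_complex R)) [zpow (m1 - m3) x * _]mulrA -(hr x xS).
by ring.
Qed.

Lemma bracket_order l1 m1 l2 l3 m3 : m1 != m3 -> bracket R l1 m1 l2 0 l3 m3 = 0.
Proof.
move=> m13; have [/and3P[h1 _ h3]|/negbTE h] :=
  boolP [&& (`|m1| <= l1)%N, (`|0| <= l2)%N & (`|m3| <= l3)%N]; last by rewrite /bracket h.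
have [r [c ->//]] := bracket_zharm l1 m1 l2 l3 m3.
by rewrite cintegral_zharm ?mulr0// subr_eq0.
Qed.

Lemma bracket_conj l1 m l2 l3 :
  (bracket R l1 m l2 0 l3 m)^* = bracket R l1 m l2 0 l3 m.
Proof.
have [/and3P[h1 _ h3]|/negbTE h] :=
  boolP [&& (`|m| <= l1)%N, (`|0| <= l2)%N & (`|m| <= l3)%N]; last first.
  by rewrite /bracket h rmorph0.
have [r [c ->//]] := bracket_zharm l1 m l2 l3 m.
by rewrite subrr cintegral_zharm0 conjM !conj_real.
Qed.

(** The harmonics of order 0 are real. *)
Lemma real_valued_coef0 F l : sqi F -> real_valued F -> (coef F l 0)^* = coef F l 0.
Proof.
move=> hF rF; rewrite /coef /inner -cintegral_conj//; last first.
  by apply: cintegrable_ip => //; exact: sq_integrable_Ylm.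
have Y0 (x : S2) : sphere x -> (Ylm l 0 x)^* = Ylm l 0 x.
  by move=> xS; rewrite !Ylm_zharm// conjM conj_real zharm_conj oppr0.
have mFY : cmeasurable sphere (fun x => F x * (Ylm l 0 x)^*).
  apply: cmeasurableM; first exact: sq_integrable_meas hF.
  by apply: cmeasurable_conj; exact: cmeasurable_Ylm.
have [m1 m2] := mFY; have [m3 m4] := cmeasurable_conj mFY.
rewrite /cintegral /Rintegral; congr (fine _ +i* fine _)%C.
  by apply: eq_integral => x _; rewrite complex_Re_conj.
apply: ae_eq_integral => //; try exact/measurable_EFinP.
move: rF; apply: filterS => x + xS => /(_ xS) Fx; congr EFin.
have : complex.Im (Ylm l 0 x) = 0.
  have := congr1 (@complex.Im R) (Y0 x xS); rewrite complex_Im_conj; lra.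
have FY0 : complex.Im (F x * (Ylm l 0 x)^*) = 0 ->
    complex.Im ((F x * (Ylm l 0 x)^*)^*) = complex.Im (F x * (Ylm l 0 x)^*).
  by rewrite complex_Im_conj => ->; rewrite oppr0.
by move=> Yi; apply: FY0; rewrite Y0// complex_ImM Fx Yi mulr0 mul0r addr0.
Qed.

End axisymmetric_functions.

(** * The inner sums of Q *)

Section spectral_sums.
Variable R : realType.
Local Notation S2 := (R * R * R)%type.
Local Notation sigma := (@surface_measure R).
Local Notation sqi := (sq_integrable sigma sphere).
Local Notation "z %:Cx" := (real_complex R z) (at level 2, format "z %:Cx").
Variables (C : nat -> R) (V D : S2 -> R[i]).
Hypotheses (hV : sqi V) (hD : sqi D).

Let lm_seq_pairs N : [set` lm_seq N] `<=` lm_pairs.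
Proof. by move=> k /=; rewrite mem_lm_seq => /andP[]. Qed.

Let notin_lm_seq N (k : nat * int) : lm_pairs k -> k \notin lm_seq N -> (N <= k.1)%N.
Proof. by rewrite mem_lm_seq /lm_pairs/= => ->; rewrite andbT -leqNgt. Qed.

Section factors.
Variables (l l' : nat) (m m' : int) (l1 : nat) (m1 : int).

Let f (k : nat * int) := coef V k.1 k.2 * bracket R l1 m1 k.1 k.2 l m.
Let g (k : nat * int) := (coef V k.1 k.2 * bracket R l1 m1 k.1 k.2 l' m')^*.
Let h (k : nat * int) := coef D k.1 k.2 * bracket R l m k.1 k.2 l' m'.

Let f0 k : lm_pairs k -> k \notin lm_seq (l1 + l).+1 -> f k = 0.
Proof. by move=> kp kn; rewrite /f bracket_eq0 ?mulr0// notin_lm_seq. Qed.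
Let g0 k : lm_pairs k -> k \notin lm_seq (l1 + l').+1 -> g k = 0.
Proof. by move=> kp kn; rewrite /g bracket_eq0 ?mulr0 ?rmorph0// notin_lm_seq. Qed.
Let h0 k : lm_pairs k -> k \notin lm_seq (l + l').+1 -> h k = 0.
Proof. by move=> kp kn; rewrite /h bracket_eq0 ?mulr0// notin_lm_seq. Qed.

Let Q_inner_termE p : Q_inner_term (coef V) (coef D) l l' m m' l1 m1 p =
  f p.1.1 * g p.1.2 * h p.2.
Proof.
by case: p => [[[l2 m2] [l3 m3]] [l4 m4]]; rewrite /Q_inner_term /f /g /h conjM/=; ring.
Qed.

Lemma Q_inner_term_finite : finite_set ((lm_pairs `*` lm_pairs `*` lm_pairs) `&`
  [set p | Q_inner_term (coef V) (coef D) l l' m m' l1 m1 p != 0]).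
Proof.
have := finite_support3_mul f0 g0 h0; congr (finite_set (_ `&` _)).
by apply/seteqP; split => p /=; rewrite Q_inner_termE.
Qed.

(** By the triangle condition each of the three sums is finite, so the triple sum
    factors into a product of sums, and each factor is an expansion of a
    triple integral. *)
Lemma Q_inner_sum : (`|m| <= l)%N -> (`|m'| <= l')%N -> (`|m1| <= l1)%N ->
  \sum_(p \in lm_pairs `*` lm_pairs `*` lm_pairs)
     Q_inner_term (coef V) (coef D) l l' m m' l1 m1 p =
  triple_integral V l1 m1 l m * (triple_integral V l1 m1 l' m')^* *
  triple_integral D l m l' m'.
Proof.
move=> ml ml' ml1; under eq_fsbigr do rewrite Q_inner_termE.
rewrite (fsbig_setX3_mul _ _ _ _ _ _ f0 g0 h0); try exact: lm_seq_uniq;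
  try exact: lm_seq_pairs.
by rewrite !triple_integral_sum// rmorph_sum.
Qed.

End factors.

Lemma Q_series_partial_sum l l' m m' n : (`|m| <= l)%N -> (`|m'| <= l')%N ->
  \sum_(0 <= l1 < n) Q_series C (coef V) (coef D) l l' m m' l1 =
  (\sum_(k <- lm_seq n) (C k.1)%:Cx * (triple_integral V k.1 k.2 l m *
     (triple_integral V k.1 k.2 l' m')^*)) * triple_integral D l m l' m'.
Proof.
move=> ml ml'; rewrite (sum_lm_seq n (fun l1 m1 => (C l1)%:Cx *
  (triple_integral V l1 m1 l m * (triple_integral V l1 m1 l' m')^*))).
rewrite big_distrl/=; apply: eq_bigr => l1 _; rewrite big_distrl/=.
apply: eq_big_seq => m1; rewrite mem_mrange => m1l.
by rewrite Q_inner_sum// !mulrA.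
Qed.

End spectral_sums.

Section axisymmetric_sums.
Variable R : realType.
Local Notation S2 := (R * R * R)%type.
Local Notation sigma := (@surface_measure R).
Local Notation sqi := (sq_integrable sigma sphere).
Local Notation "z %:Cx" := (real_complex R z) (at level 2, format "z %:Cx").
Variables (C : nat -> R) (V D : S2 -> R[i]).
Hypotheses (hV : sqi V) (hD : sqi D) (aV : axisymmetric V) (aD : axisymmetric D).

(** The coefficients of F vanish for m2 <> 0, and the brackets for m2 = 0. *)
Lemma axisymmetric_triple_eq0 F l1 m1 l m : sqi F -> axisymmetric F ->
  (`|m1| <= l1)%N -> (`|m| <= l)%N -> m1 != m -> triple_integral F l1 m1 l m = 0.
Proof.
move=> hF aF h1 h m1m; rewrite triple_integral_sum// big1// => -[l2 m2] _ /=.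
have [->|m20] := eqVneq m2 0; first by rewrite bracket_order ?mulr0.
by rewrite axisymmetric_coef ?mul0r.
Qed.

Lemma axisymmetric_triple F l1 l m N : sqi F -> axisymmetric F -> (l1 + l < N)%N ->
  (`|m| <= l1)%N -> (`|m| <= l)%N -> triple_integral F l1 m l m =
  \sum_(l2 <- iota 0 N) coef F l2 0 * bracket R l1 m l2 0 l m.
Proof.
move=> hF aF lN h1 h; rewrite triple_integral_sum//.
rewrite (sum_lm_seq _ (fun l2 m2 => coef F l2 m2 * bracket R l1 m l2 m2 l m)).
rewrite /index_iota subn0 -(subnKC lN) iotaD big_cat/= [X in _ + X]big_seq [X in _ + X]big1 ?addr0.
  apply: eq_bigr => l2 _; rewrite (bigD1_seq 0)/=; last 2 first.
  - by rewrite mem_mrange.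
  - exact: mrange_uniq.
  by rewrite big1 ?addr0// => m2 m20; rewrite axisymmetric_coef ?mul0r.
by move=> l2; rewrite mem_iota add0n => /andP[h2 _]; rewrite bracket_eq0 ?mulr0.
Qed.

Section factors.
Variables (l l' : nat) (m : int).
Hypotheses (ml : (`|m| <= l)%N) (ml' : (`|m| <= l')%N).
Let w0 (k : nat) := coef V k 0.
Let w0c (k : nat) := (coef V k 0)^*.
Let dd0 (k : nat) := coef D k 0.

Let f l1 k := w0 k * bracket R l1 m k 0 l m.
Let g l1 k := w0c k * bracket R l1 m k 0 l' m.

Let iota_notin n k : k \notin iota 0 n -> (n <= k)%N.
Proof. by rewrite mem_iota add0n/= -leqNgt. Qed.

Let f0 l1 k : setT k -> k \notin iota 0 (l1 + l).+1 -> f l1 k = 0.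
Proof. by move=> _ /iota_notin h; rewrite /f bracket_eq0 ?mulr0. Qed.
Let g0 l1 k : setT k -> k \notin iota 0 (l1 + l').+1 -> g l1 k = 0.
Proof. by move=> _ /iota_notin h; rewrite /g bracket_eq0 ?mulr0. Qed.
Let h0 k : setT k -> k \notin iota 0 (l + l').+1 -> D_term dd0 l l' m k = 0.
Proof. by move=> _ /iota_notin h; rewrite /D_term bracket_eq0 ?mulr0. Qed.

Let A_termE l1 p : A_term C w0 w0c l l' m l1 p = (C l1)%:Cx * (f l1 p.1 * g l1 p.2).
Proof. case: p => a e; rewrite /A_term /f /g/=.
generalize (C l1)%:Cx (w0 a) (w0c e) (bracket R l1 m a 0 l m) (bracket R l1 m e 0 l' m).
by move=> *; ring. Qed.

Let Qaxi_termE l1 p : Qaxi_term C w0 w0c dd0 l l' m l1 p =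
  (C l1)%:Cx * (f l1 p.1.1 * g l1 p.1.2 * D_term dd0 l l' m p.2).
Proof. case: p => [[a e] k]; rewrite /Qaxi_term /f /g /D_term/=.
generalize (C l1)%:Cx (w0 a) (w0c e) (dd0 k) (bracket R l1 m a 0 l m)
  (bracket R l1 m e 0 l' m) (bracket R l m k 0 l' m).
by move=> *; ring. Qed.

Lemma A_term_finite l1 : finite_set [set p | A_term C w0 w0c l l' m l1 p != 0].
Proof.
apply: sub_finite_set (finite_support_mul (f0 (l1 := l1)) (g0 (l1 := l1))) => p /=.
move=> h; split => //; apply: contraNN h => /eqP h; by rewrite A_termE h mulr0.
Qed.

Lemma Qaxi_term_finite l1 : finite_set [set p | Qaxi_term C w0 w0c dd0 l l' m l1 p != 0].
Proof.
apply: sub_finite_set (finite_support3_mul (f0 (l1 := l1)) (g0 (l1 := l1)) h0) => p /=.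
move=> h; split => //; apply: contraNN h => /eqP h; by rewrite Qaxi_termE h mulr0.
Qed.

Lemma D_term_finite : finite_set [set k | D_term dd0 l l' m k != 0].
Proof.
apply: (@sub_finite_set _ _ [set` iota 0 (l + l').+1]); last exact: finite_seq.
by move=> k /=; apply: contraNT => /(h0 I) ->.
Qed.

Lemma D_coefE : D_coef dd0 l l' m = triple_integral D l m l' m.
Proof.
rewrite /D_coef (fsbigE (iota 0 (l + l').+1)) ?iota_uniq//.
rewrite (axisymmetric_triple (N := (l + l').+1))//.
by apply: eq_bigl => k; rewrite in_setT.
Qed.

Let factor_sums l1 : (`|m| <= l1)%N ->
  \sum_(k <- iota 0 (l1 + l).+1) f l1 k = triple_integral V l1 m l m /\
  \sum_(k <- iota 0 (l1 + l').+1) g l1 k = (triple_integral V l1 m l' m)^*.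
Proof.
move=> h1; rewrite (axisymmetric_triple (N := (l1 + l).+1))//.
rewrite (axisymmetric_triple (N := (l1 + l').+1))// rmorph_sum/=; split => //.
by apply: eq_bigr => k _; rewrite /g /w0c conjM bracket_conj.
Qed.

Let factor_zero l1 : (l1 < `|m|)%N -> forall k, f l1 k = 0.
Proof. by move=> h k; rewrite /f /bracket leqNgt h/= mulr0. Qed.

(** The sums over l2 and l3 factor, and expand two triple integrals; for
    l1 < |m| the brackets are zero by convention. *)
Lemma A_seriesE l1 : A_series C w0 w0c l l' m l1 =
  if (`|m| <= l1)%N then (C l1)%:Cx *
    (triple_integral V l1 m l m * (triple_integral V l1 m l' m)^*) else 0.
Proof.
rewrite /A_series; under eq_fsbigr do rewrite A_termE.
case: leqP => h; last by rewrite fsbig1// => p _; rewrite factor_zero// mul0r mulr0.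
rewrite -mulr_fsumr; congr (_ * _); rewrite -setXTT.
rewrite (fsbig_setX_mul _ _ _ _ (f0 (l1 := l1)) (g0 (l1 := l1))) ?iota_uniq//.
by have [-> ->] := factor_sums h.
Qed.

(** The factor that depends on D does not involve l1. *)
Lemma Qaxi_seriesE l1 : Qaxi_series C w0 w0c dd0 l l' m l1 =
  A_series C w0 w0c l l' m l1 * D_coef dd0 l l' m.
Proof.
rewrite A_seriesE D_coefE /Qaxi_series; under eq_fsbigr do rewrite Qaxi_termE.
case: leqP => h; last by rewrite fsbig1 ?mul0r// => p _; rewrite factor_zero// !mul0r mulr0.
rewrite -mulr_fsumr -mulrA; congr (_ * _); rewrite -!setXTT.
rewrite (fsbig_setX3_mul _ _ _ _ _ _ (f0 (l1 := l1)) (g0 (l1 := l1)) h0) ?iota_uniq//.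
have [-> ->] := factor_sums h.
congr (_ * _).
by rewrite (@axisymmetric_triple D l l' m (l + l').+1).
Qed.

(** Axisymmetry leaves m1 = m alone in the sum over m1, which brings the series
    into the form of the covariance formula. *)
Lemma A_series_partial_sum n : \sum_(0 <= l1 < n) A_series C w0 w0c l l' m l1 =
  \sum_(k <- lm_seq n) (C k.1)%:Cx * (triple_integral V k.1 k.2 l m *
     (triple_integral V k.1 k.2 l' m)^*).
Proof.
rewrite (sum_lm_seq n (fun l1 m1 => (C l1)%:Cx *
  (triple_integral V l1 m1 l m * (triple_integral V l1 m1 l' m)^*))).
apply: eq_bigr => l1 _; rewrite A_seriesE.
have [h|h] := leqP `|m|%N l1; last first.
  rewrite big_seq big1// => m1; rewrite mem_mrange => h1.
  rewrite axisymmetric_triple_eq0 ?mul0r ?mulr0//.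
  by apply: contraTneq h1 => ->; rewrite -ltnNge.
rewrite (bigD1_seq m)/=; last 2 first.
- by rewrite mem_mrange.
- exact: mrange_uniq.
rewrite big_seq_cond big1 ?addr0// => m1 /andP[]; rewrite mem_mrange => h1 m1m.
by rewrite axisymmetric_triple_eq0 ?mul0r ?mulr0.
Qed.

End factors.

End axisymmetric_sums.

(** * Covariance of the error coefficients *)

Section analysis_error.
Variable R : realType.
Local Notation S2 := (R * R * R)%type.
Local Notation sigma := (@surface_measure R).
Local Notation sqi := (sq_integrable sigma sphere).
Local Notation ipS := (ip sigma sphere).
Local Notation "z %:Cx" := (real_complex R z) (at level 2, format "z %:Cx").
Context d (T : measurableType d) (P : probability T R).
Local Notation ipP := (ip P [set: T]).
Local Notation sqP := (sq_integrable P [set: T]).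
Variables (X : T -> S2 -> R) (C : nat -> R) (W D : S2 -> R[i]).

(** The difference of coefficients that occurs in the error; it is the
    coefficient of X (1 - W) for the paths along which the integrals converge. *)
Definition error_coef l m w : R[i] :=
  coef (cfield X w) l m - coef (fun y => cfield X w y * W y) l m.

Hypotheses (mX : measurable_field X) (pX : power_spectrum P X C).
Hypothesis iX : (\int[P]_w \int[sigma]_(x in sphere) ((X w x) ^+ 2)%:E < +oo)%E.
Hypotheses (hW : sqi W) (hD : sqi D).

Let V (x : S2) := 1 - W x.

Let hV : sqi V.
Proof. by apply: sq_integrableB => //; exact: sq_integrable_cst. Qed.

Let U l m (x : S2) := (V x)^* * Ylm l m x.

Let hU l m : sqi (U l m).
Proof.
have [M hM] := @Ylm_bounded R l m.
apply: (sq_integrableMb _ _ _ hM) => //; last exact: cmeasurable_Ylm.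
exact: sq_integrable_conj.
Qed.

Lemma cmeasurable_error_coef l m : cmeasurable setT (error_coef l m).
Proof.
have mY : cmeasurable ([set: T] `*` sphere) (fun p : T * S2 => (Ylm l m p.2)^*).
  apply: (@cmeasurable_snd _ _ _ (fun x => (Ylm l m x)^*)); apply: cmeasurable_conj.
  exact: cmeasurable_Ylm.
have mXW : cmeasurable ([set: T] `*` sphere) (fun p : T * S2 => cfield X p.1 p.2 * W p.2).
  apply: cmeasurableM; first exact: cmeasurable_field.
  by apply: cmeasurable_snd; exact: sq_integrable_meas hW.
have m1 : cmeasurable setT (fun w => coef (cfield X w) l m).
  apply: cmeasurable_parametric; apply: cmeasurableM mY.
  exact: cmeasurable_field.
have m2 : cmeasurable setT (fun w => coef (fun y => cfield X w y * W y) l m).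
  by apply: cmeasurable_parametric; exact: cmeasurableM mXW mY.
apply: (@eq_cmeasurable _ _ _ _
  (fun w => coef (cfield X w) l m + (-1) * coef (fun y => cfield X w y * W y) l m)).
  by move=> w _; rewrite mulN1r.
by apply: cmeasurableD => //; apply: cmeasurableM => //; exact: cmeasurable_cst.
Qed.

(** The product X W is integrable against the bounded harmonic because X and W
    are both square integrable. *)
Lemma error_coef_ip l m w : sqi (cfield X w) -> error_coef l m w = ipS (cfield X w) (U l m).
Proof.
move=> hX; rewrite /error_coef /coef /inner /ip.
have hY := @sq_integrable_Ylm R l m.
have i1 : cintegrable sigma sphere (fun x => cfield X w x * (Ylm l m x)^*).
  exact: cintegrable_ip.
have i2 : cintegrable sigma sphere (fun x => cfield X w x * W x * (Ylm l m x)^*).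
  have [M hM] := @Ylm_bounded R l m.
  apply: (eq_cintegrable (@measurable_sphere R) (f := fun x => cfield X w x * (W x * (Ylm l m x)^*))).
    by move=> x _; rewrite mulrA.
  apply: sq_integrableM => //; apply: (@sq_integrableMb _ _ _ _ _ _ _ _ M) => //.
    by apply: cmeasurable_conj; exact: cmeasurable_Ylm.
  by move=> x xS; rewrite sqmod_conj; exact: hM.
rewrite -cintegralB//; apply: eq_cintegral => x _.
by rewrite /U /V conjM conjCK; ring.
Qed.

Lemma triple_integral_ip k l m : (ipS (U l m) (Yk k))^* = triple_integral V k.1 k.2 l m.
Proof.
rewrite /ip -cintegral_conj//; last first.
  by apply: cintegrable_ip => //; exact: sq_integrable_Yk.
by apply: eq_cintegral => x _; rewrite /U /Yk !conjM !conjCK; ring.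
Qed.

(** The covariance formula for the functions conj V Y_lm. *)
Lemma error_covariance l m l' m' :
  [/\ sqP (error_coef l m), sqP (error_coef l' m') &
   sqmod (ipP (error_coef l m) (error_coef l' m') -
     \sum_(k <- lm_seq n) (C k.1)%:Cx * (triple_integral V k.1 k.2 l m *
       (triple_integral V k.1 k.2 l' m')^*)) @[n --> \oo] --> (0 : R)].
Proof.
have [h1 h2 h3] := field_covariance mX pX iX (hU l m) (hU l' m')
  (cmeasurable_error_coef l m) (cmeasurable_error_coef l' m')
  (@error_coef_ip l m) (@error_coef_ip l' m').
split; [exact: h1|exact: h2|]; move: h3; apply: cvg_trans; apply: near_eq_cvg; near=> n.
congr (sqmod (_ - _)); apply: eq_bigr => k _.
by rewrite -!triple_integral_ip conjCK.
Unshelve. all: end_near.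
Qed.

Lemma sq_integrable_error_coef l m : sqP (error_coef l m).
Proof. by have [] := error_covariance l m l m. Qed.

Lemma Q_seriesP l l' m m' : (`|m| <= l)%N -> (`|m'| <= l')%N ->
  is_csummable (Q_series C (coef V) (coef D) l l' m m') /\
  csum (Q_series C (coef V) (coef D) l l' m m') =
  ipP (error_coef l m) (error_coef l' m') * triple_integral D l m l' m'.
Proof.
move=> ml ml'; apply: csum_cvg; have [_ _ h] := error_covariance l m l' m'.
under eq_fun do rewrite Q_series_partial_sum// -mulrBl sqmodM.
have := cvgM h (cvg_cst (sqmod (triple_integral D l m l' m'))).
by rewrite mul0r; apply.
Qed.

Lemma A_seriesP l l' m : axisymmetric V -> (`|m| <= l)%N -> (`|m| <= l')%N ->
  is_csummable (A_series C (coef V ^~ 0) (fun k => (coef V k 0)^*) l l' m) /\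
  csum (A_series C (coef V ^~ 0) (fun k => (coef V k 0)^*) l l' m) =
  ipP (error_coef l m) (error_coef l' m).
Proof.
move=> aV ml ml'; apply: csum_cvg; have [_ _ h] := error_covariance l m l' m.
by under eq_fun do rewrite A_series_partial_sum//.
Qed.

Lemma Qaxi_seriesP l l' m : axisymmetric V -> axisymmetric D ->
  (`|m| <= l)%N -> (`|m| <= l')%N ->
  is_csummable (Qaxi_series C (coef V ^~ 0) (fun k => (coef V k 0)^*) (coef D ^~ 0) l l' m) /\
  csum (Qaxi_series C (coef V ^~ 0) (fun k => (coef V k 0)^*) (coef D ^~ 0) l l' m) =
  ipP (error_coef l m) (error_coef l' m) * triple_integral D l m l' m.
Proof.
move=> aV aD ml ml'; apply: csum_cvg; have [_ _ h] := error_covariance l m l' m.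
under eq_fun do under eq_bigr do rewrite Qaxi_seriesE//.
under eq_fun do rewrite -big_distrl/= A_series_partial_sum// D_coefE// -mulrBl sqmodM.
have := cvgM h (cvg_cst (sqmod (triple_integral D l m l' m))).
by rewrite mul0r; apply.
Qed.

End analysis_error.

(** * The mean square error as a quadratic form *)

Section mean_square_error.
Variable R : realType.
Local Notation S2 := (R * R * R)%type.
Local Notation sigma := (@surface_measure R).
Local Notation sqi := (sq_integrable sigma sphere).
Local Notation "z %:Cx" := (real_complex R z) (at level 2, format "z %:Cx").
Context d (T : measurableType d) (P : probability T R).
Local Notation ipP := (ip P [set: T]).
Variables (X : T -> S2 -> R) (C : nat -> R) (W D : S2 -> R[i]).
Variables (lmin lmax : nat) (b : 'cV[R]_((lmax - lmin).+1)).
Local Notation mult := (@mult lmin lmax).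

Let s := [seq (i, m) | i <- index_enum 'I_((lmax - lmin).+1), m <- mrange (mult i)].
Let Ek (k : 'I_((lmax - lmin).+1) * int) := error_coef X W (mult k.1) k.2.
Let YE (k : 'I_((lmax - lmin).+1) * int) := @Ylm R (mult k.1) k.2.
Let c := (Num.sqrt (energy C b))^-1.
Let a (k : 'I_((lmax - lmin).+1) * int) := (c * b k.1 0)%:Cx.

(** The sum over degrees and orders is over one list of pairs, so that squaring
    it gives a plain double sum. *)
Lemma epsE w x : eps X C W b w x = \sum_(k <- s) a k * (Ek k w * YE k x).
Proof.
rewrite big_allpairs_dep /eps /Phi -sumrB big_distrr/=; apply: eq_bigr => i _.
rewrite -mulrBr /Pi_ -sumrB !big_distrr/=; apply: eq_bigr => m _.
by rewrite /a rmorphM /Ek /YE /error_coef/=; ring.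
Qed.

Hypothesis (hD : sqi D).
Hypothesis hE : forall l m, sq_integrable P setT (error_coef X W l m).

Let T3 (k j : 'I_((lmax - lmin).+1) * int) :=
  triple_integral D (mult k.1) k.2 (mult j.1) j.2.

(** Both integrals are exchanged with finite sums only. *)
Lemma miseE : mise P X C W D b =
  \sum_(k <- s) \sum_(j <- s) a k * a j * ipP (Ek k) (Ek j) * T3 k j.
Proof.
have iD k j : cintegrable sigma sphere (fun x => D x * YE k x * (YE j x)^*).
  have [M hM] := @Ylm_bounded R (mult k.1) k.2.
  apply: sq_integrableM => //.
    by apply: (sq_integrableMb _ _ _ hM) => //; exact: cmeasurable_Ylm.
  by apply: sq_integrable_conj => //; exact: sq_integrable_Ylm.
have iE k j : cintegrable P setT (fun w => Ek k w * (Ek j w)^*).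
  by apply: cintegrable_ip => //; exact: hE.
have inner w : cintegral sigma sphere (fun x => D x * `|eps X C W b w x| ^+ 2) =
    \sum_(k <- s) \sum_(j <- s) (a k * a j * T3 k j) * (Ek k w * (Ek j w)^*).
  rewrite (@eq_cintegral _ _ _ _ _ _ (fun x => \sum_(k <- s) \sum_(j <- s)
    (a k * a j * (Ek k w * (Ek j w)^*)) * (D x * YE k x * (YE j x)^*))); last first.
    move=> x _; rewrite normr2_sqmod -mul_conj_sqmod epsE rmorph_sum/= big_distrlr/=.
    rewrite big_distrr/=; apply: eq_bigr => k _; rewrite big_distrr/=.
    by apply: eq_bigr => j _; rewrite !conjM conj_real; ring.
  rewrite cintegral_sum// => [|k _]; last first.
    by apply: cintegrable_sum => // j _; exact: cintegrableZ.
  apply: eq_bigr => k _; rewrite cintegral_sum// => [|j _]; last exact: cintegrableZ.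
  by apply: eq_bigr => j _; rewrite cintegralZ// /T3 /triple_integral; ring.
rewrite /mise (@eq_cintegral _ _ _ _ _ _ (fun w =>
  \sum_(k <- s) \sum_(j <- s) (a k * a j * T3 k j) * (Ek k w * (Ek j w)^*))) => [|w _]; last exact: inner.
rewrite cintegral_sum// => [|k _]; last first.
  by apply: cintegrable_sum => // j _; exact: cintegrableZ.
apply: eq_bigr => k _; rewrite cintegral_sum// => [|j _]; last exact: cintegrableZ.
by apply: eq_bigr => j _; rewrite cintegralZ// /ip; ring.
Qed.

Lemma mise_quadratic (Q : 'M[R[i]]_((lmax - lmin).+1)) : 0 < energy C b ->
  (forall i j, Q i j = \sum_(m <- mrange (mult i)) \sum_(m' <- mrange (mult j))
    ipP (error_coef X W (mult i) m) (error_coef X W (mult j) m') *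
    triple_integral D (mult i) m (mult j) m') ->
  mise P X C W D b = ((map_mx (real_complex R) b)^T *m Q *m map_mx (real_complex R) b) 0 0 /
   ((b^T *m diag_mx (\row_i sigma2 C (mult i)) *m b) 0 0)%:Cx.
Proof.
move=> e0 hQ.
have -> : (b^T *m diag_mx (\row_i sigma2 C (mult i)) *m b) 0 0 = energy C b.
  rewrite mul_mx_diag !mxE; apply: eq_bigr => i _; rewrite !mxE expr2; ring.
have cc : c * c = (energy C b)^-1.
  by rewrite /c -invfM -expr2 sqr_sqrtr// ltW.
transitivity (\sum_i \sum_j (c * c)%:Cx * ((b i 0)%:Cx * Q i j * (b j 0)%:Cx)).
  rewrite miseE big_allpairs_dep; apply: eq_bigr => i _ /=.
  under eq_bigr do rewrite big_allpairs_dep/=.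
  rewrite exchange_big/=; apply: eq_bigr => j _.
  rewrite hQ mulr_sumr mulr_suml mulr_sumr; apply: eq_bigr => m _.
  rewrite mulr_sumr mulr_suml mulr_sumr; apply: eq_bigr => m' _.
  by rewrite /a /Ek /T3/= !rmorphM/=; ring.
rewrite -fmorphV -cc mxE exchange_big/= mulr_suml; apply: eq_bigr => j _.
rewrite mxE !mulr_suml; apply: eq_bigr => i _.
by rewrite !mxE mulrC.
Qed.

End mean_square_error.

(** * Entries of Q and the theorem *)

Section axisymmetric_entries.
Variable R : realType.
Local Notation S2 := (R * R * R)%type.
Local Notation sigma := (@surface_measure R).
Local Notation sqi := (sq_integrable sigma sphere).
Context d (T : measurableType d) (P : probability T R).
Local Notation ipP := (ip P [set: T]).
Variables (X : T -> S2 -> R) (C : nat -> R) (W D : S2 -> R[i]).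
Hypotheses (mX : measurable_field X) (pX : power_spectrum P X C).
Hypothesis iX : (\int[P]_w \int[sigma]_(x in sphere) ((X w x) ^+ 2)%:E < +oo)%E.
Hypotheses (hW : sqi W) (hD : sqi D).
Let w := coef (fun x : S2 => 1 - W x).
Let dd := coef D.
Let e l m := error_coef X W l m.

Lemma Q_entryE l l' : Q_entry C w dd l l' =
  \sum_(m <- mrange l) \sum_(m' <- mrange l') ipP (e l m) (e l' m') *
    triple_integral D l m l' m'.
Proof.
apply: eq_big_seq => m; rewrite mem_mrange => ml.
apply: eq_big_seq => m'; rewrite mem_mrange => ml'.
by have [_ ->] := Q_seriesP mX pX iX hW hD ml ml'.
Qed.

Lemma sum_mrange_minn (l l' : nat) (F : int -> R[i]) :
  \sum_(m <- mrange l | (`|m| <= l')%N) F m = \sum_(m <- mrange (minn l l')) F m.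
Proof.
rewrite -big_filter; apply: perm_big; apply: uniq_perm.
- by rewrite filter_uniq// mrange_uniq.
- exact: mrange_uniq.
- by move=> m; rewrite mem_filter !mem_mrange leq_min andbC.
Qed.

Hypotheses (aW : axisymmetric W) (aD : axisymmetric D).

Let aV : axisymmetric (fun x : S2 => 1 - W x) := axisymmetric_onem aW.

(** The triple integral of D vanishes unless m = m', whence also the restriction
    to |m| at most l and l'. *)
Lemma Q_entry_diagonal l l' : Q_entry C w dd l l' =
  \sum_(m <- mrange (minn l l')) ipP (e l m) (e l' m) * triple_integral D l m l' m.
Proof.
rewrite Q_entryE -sum_mrange_minn [RHS]big_mkcond; apply: eq_big_seq => m.
rewrite mem_mrange => ml; case: ifPn => ml'.
  rewrite (bigD1_seq m) ?mem_mrange ?mrange_uniq//=.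
  rewrite big_seq_cond big1 ?addr0// => m' /andP[]; rewrite mem_mrange => h mm'.
  by rewrite axisymmetric_triple_eq0 ?mulr0// eq_sym.
rewrite big_seq big1// => m'; rewrite mem_mrange => h.
by rewrite axisymmetric_triple_eq0 ?mulr0//; apply: contraNneq ml' => ->.
Qed.

Lemma axisymmetric_entries l l' (w0c := fun k => (w k 0)^*) :
  [/\ forall m, m \in mrange (minn l l') ->
        Qaxi_summable C (w ^~ 0) w0c (dd ^~ 0) l l' m,
      Q_entry C w dd l l' = Qaxi_entry C (w ^~ 0) w0c (dd ^~ 0) l l' &
      Q_entry C w dd l l' = AD_entry C (w ^~ 0) w0c (dd ^~ 0) l l'].
Proof.
have hm m : m \in mrange (minn l l') -> (`|m| <= l)%N /\ (`|m| <= l')%N.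
  by rewrite mem_mrange leq_min => /andP.
split => [m /hm[ml ml']||].
- have [sQ _] := Qaxi_seriesP mX pX iX hW hD aV aD ml ml'.
  have [sA _] := A_seriesP mX pX iX hW aV ml ml'.
  split; [|exact: sQ| |exact: sA|exact: D_term_finite].
  + exact: Qaxi_term_finite.
  + exact: A_term_finite.
- rewrite Q_entry_diagonal; apply: eq_big_seq => m /hm[ml ml'].
  by have [_ ->] := Qaxi_seriesP mX pX iX hW hD aV aD ml ml'.
- rewrite Q_entry_diagonal; apply: eq_big_seq => m /hm[ml ml'].
  have [_ sA] := A_seriesP mX pX iX hW aV ml ml'.
  by rewrite /A_coef sA D_coefE.
Qed.

End axisymmetric_entries.

Theorem proposition2p2 (R : realType) (disp : measure_display)
    (T : measurableType disp) (P : probability T R)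
    (X : T -> R * R * R -> R) (C : nat -> R)
    (W D : R * R * R -> R[i]) (lmin lmax : nat)
    (b : 'cV[R]_((lmax - lmin).+1)) :
  measurable_field X -> gaussian_zero_mean P X -> isotropic P X ->
  power_spectrum P X C -> square_summable_spectrum C ->
  square_integrable W -> square_integrable D ->
  (lmin <= lmax)%N ->
  0 < energy C b ->
  let w := coef (fun x => 1 - W x) in
  let dd := coef D in
  let w0 := fun l => w l 0 in
  let dd0 := fun l => dd l 0 in
  let Q : 'M[R[i]]_((lmax - lmin).+1) :=
    \matrix_(i, j) Q_entry C w dd (mult i) (mult j) in
  let sigma : 'M[R]_((lmax - lmin).+1) :=
    diag_mx (\row_i sigma2 C (mult i)) in
  let bC := map_mx (real_complex R) b in
  [/\ forall (i j : 'I_(lmax - lmin).+1) m m', m \in mrange (mult i) ->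
        m' \in mrange (mult j) ->
        Q_summable C w dd (mult i) (mult j) m m',
      mise P X C W D b =
        (bC^T *m Q *m bC) 0 0 / ((b^T *m sigma *m b) 0 0)%:C%C &
      axisymmetric W -> axisymmetric D ->
        let w0c := fun l => (w0 l)^* in
        (forall i j : 'I_(lmax - lmin).+1,
          [/\ forall m,
                m \in mrange (minn (mult i) (mult j)) ->
                Qaxi_summable C w0 w0c dd0 (mult i) (mult j) m,
              Q i j = Qaxi_entry C w0 w0c dd0 (mult i) (mult j) &
              Q i j = AD_entry C w0 w0c dd0 (mult i) (mult j)]) /\
        (real_valued W -> forall i j : 'I_(lmax - lmin).+1,
          [/\ forall m,
                m \in mrange (minn (mult i) (mult j)) ->
                Qaxi_summable C w0 w0 dd0 (mult i) (mult j) m,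
              Q i j = Qaxi_entry C w0 w0 dd0 (mult i) (mult j) &
              Q i j = AD_entry C w0 w0 dd0 (mult i) (mult j)])].
Proof.
move=> mX gX iX pX _ hW hD _ e0 w dd w0 dd0 Q sigma bC.
have fX := field_square_integrable mX gX iX.
have QE i j : Q i j = Q_entry C w dd (mult i) (mult j) by rewrite mxE.
split.
- move=> i j m m'; rewrite !mem_mrange => ml ml'; split.
    by move=> l1 m1; exact: Q_inner_term_finite.
  by have [] := Q_seriesP mX pX fX hW hD ml ml'.
- apply: mise_quadratic => //; first exact: sq_integrable_error_coef pX fX hW.
  by move=> i j; rewrite QE (Q_entryE mX pX fX hW hD).
- move=> aW aD w0c.
  have h i j : [/\ forall m, m \in mrange (minn (mult i) (mult j)) ->
                Qaxi_summable C w0 w0c dd0 (mult i) (mult j) m,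
              Q i j = Qaxi_entry C w0 w0c dd0 (mult i) (mult j) &
              Q i j = AD_entry C w0 w0c dd0 (mult i) (mult j)].
    by rewrite QE; exact: (axisymmetric_entries mX pX fX hW hD aW aD).
  split; first exact: h.
  move=> rW; have e : w0c = w0.
    apply/funext => l; apply: real_valued_coef0.
      by apply: sq_integrableB => //; exact: sq_integrable_cst.
    move: rW; apply: filterS => x + xS => /(_ xS) Wx.
    by rewrite /= complex_ImD complex_ImN Wx oppr0 addr0.
  by rewrite e in h; exact: h.
Qed.
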